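(* Let $N\ge 2$, let $H$ be a Finsler norm on $\mathbb{R}^N$ and let $B$ satisfy the growth assumptions stated in the context with parameters $p\ge 2$, $\kappa\in[0,1]$, $\gamma>0$, $\Gamma>0$. Let $q>1$ and let $u$ be a weak stable solution of $$-\operatorname{div}\big(B'(H(\nabla u))\nabla H(\nabla u)\big)=|u|^{q-1}u\quad\text{in }\mathbb{R}^N.$$ Suppose that one of the following holds: (i) $\Gamma\kappa^{p-2}(p-1)\ge 1$, $\;q>\Gamma^2\kappa^{p-2}\gamma^{-1}(p-1)^2$ and $$N<2\,\frac{\Gamma^2\kappa^{p-2}\gamma^{-1}(p-1)^2(q-1)+2q+2\sqrt{q\big(q-\Gamma^2\kappa^{p-2}\gamma^{-1}(p-1)^2\big)}}{\Gamma^2\kappa^{p-2}\gamma^{-1}(p-1)^2(q-1)};$$ (ii) $0<\Gamma\kappa^{p-2}(p-1)<1$, $\;q>\kappa^{2-p}\gamma^{-1}$ and $$N<2\,\frac{\kappa^{2-p}\gamma^{-1}(q-1)+2q+2\sqrt{q\big(q-\kappa^{2-p}\gamma^{-1}\big)}}{\kappa^{2-p}\gamma^{-1}(q-1)};$$ (iii) $\kappa=0$, $\;q>\Gamma\gamma^{-1}(p-1)$ and $$N<p\,\frac{\Gamma\gamma^{-1}(p-1)(q-1)+2q+2\sqrt{q\big(q-\Gamma\gamma^{-1}(p-1)\big)}}{\Gamma\gamma^{-1}(p-1)\big(q-(p-1)\big)}.$$ Then $u\equiv 0$.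
   Context: Finsler norm: a function $H:\mathbb{R}^N\to[0,\infty)$ which is a norm on $\mathbb{R}^N$, is of class $C^2(\mathbb{R}^N\setminus\{0\})$, and whose unit ball $\{\xi\in\mathbb{R}^N: H(\xi)<1\}$ is uniformly convex, i.e. all the principal curvatures of its boundary are bounded away from zero (equivalently, there is $\Lambda>0$ with $\langle D^2H(\xi)v,v\rangle\ge\Lambda|v|^2$ for all $\xi$ with $H(\xi)=1$ and all $v\perp\nabla H(\xi)$). Growth assumptions on $B:[0,\infty)\to\mathbb{R}$: $B\in C^2((0,+\infty))$; $B(0)=B'(0)=0$ and $B(t),B'(t),B''(t)>0$ for all $t>0$; and, for the parameters $p>1$, $\kappa\in[0,1]$, $\gamma>0$, $\Gamma>0$, for all $t>0$, $$\gamma(\kappa+t)^{p-2}t\le B'(t)\le\Gamma(\kappa+t)^{p-2}t,\qquad \gamma(p-1)(\kappa+t)^{p-2}\le B''(t)\le\Gamma(p-1)(\kappa+t)^{p-2}.$$ When $p=2$, $\kappa^{p-2}$ and $\kappa^{2-p}$ mean $1$. Weak solution: for a domain $\Omega\subset\mathbb{R}^N$, a weak solution of $-\operatorname{div}(B'(H(\nabla u))\nabla H(\nabla u))=|u|^{q-1}u$ in $\Omega$ is a function $u\in W^{1,p}_{loc}(\Omega)\cap L^\infty_{loc}(\Omega)$ (real-valued, possibly sign-changing and globally unbounded) with $$\int_\Omega B'(H(\nabla u))\langle\nabla H(\nabla u),\nabla\varphi\rangle\,dx=\int_\Omega|u|^{q-1}u\,\varphi\,dx\quad\forall\varphi\in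 C^1_c(\Omega).$$ Such solutions are known to be of class $C^{1,\alpha}_{loc}(\Omega)$ for some $\alpha\in(0,1)$. Stability (for $p\ge2$): $u$ is stable in $\Omega$ if $L_u(\varphi,\varphi)\ge0$ for all $\varphi\in C^1_c(\Omega)$, where $$L_u(\varphi,\varphi)=\int_\Omega B''(H(\nabla u))\langle\nabla H(\nabla u),\nabla\varphi\rangle^2\,dx+\int_\Omega B'(H(\nabla u))\langle D^2H(\nabla u)\nabla\varphi,\nabla\varphi\rangle\,dx-\int_\Omega q|u|^{q-1}\varphi^2\,dx,$$ with the integrands of the first two integrals understood as $0$ at points where $\nabla u=0$. Here $\Omega=\mathbb{R}^N$. *)

(* Defs.v *)
From HB Require Import structures.
From mathcomp Require Import all_boot all_order all_algebra.
From mathcomp Require Import all_classical all_reals all_analysis.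

Set Implicit Arguments.
Unset Strict Implicit.
Unset Printing Implicit Defensive.

Import Order.TTheory GRing.Theory Num.Theory.
Import numFieldNormedType.Exports.

Local Open Scope classical_set_scope.
Local Open Scope ring_scope.

(* Lebesgue measure on R^n, R^n being 'rV[R]_n. The sigma-algebra is generated
   by the coordinate maps, i.e. it is the Borel one. *)

Definition rV_display : measure_display. Proof. exact. Qed.

Section rV_measurable.
Context (R : realType) (n : nat).

Definition rV_coord (i : 'I_n) (v : 'rV[R]_n) : measurableTypeR R := v ord0 i.

Let rV_set0 : g_sigma_preimage rV_coord set0.
Proof. exact: sigma_algebra0. Qed.

Let rV_setC A : g_sigma_preimage rV_coord A -> g_sigma_preimage rV_coord (~` A).
Proof. exact: sigma_algebraC. Qed.

Let rV_bigcup (F : (set 'rV[R]_n)^nat) :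
  (forall i, g_sigma_preimage rV_coord (F i)) ->
  g_sigma_preimage rV_coord (\bigcup_i (F i)).
Proof. exact: sigma_algebra_bigcup. Qed.

HB.instance Definition _ := @isMeasurable.Build rV_display
  'rV[R]_n (g_sigma_preimage rV_coord) rV_set0 rV_setC rV_bigcup.

Lemma measurable_rV_coord i : measurable_fun [set: 'rV[R]_n] (rV_coord i).
Proof.
move=> _ Y mY; rewrite setTI; apply: sub_sigma_algebra => /=.
rewrite -bigcup_seq/=; exists i => /=; first by rewrite mem_index_enum.
by exists Y => //; rewrite setTI.
Qed.

Lemma measurable_fun_rVP d (T : measurableType d) (f : T -> 'rV[R]_n) :
  (forall i, measurable_fun [set: T] (rV_coord i \o f)) ->
  measurable_fun [set: T] f.
Proof.
move=> mf _ A mA; rewrite setTI.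
have : g_sigma_preimage (fun i => rV_coord i \o f) `<=` measurable.
  apply: smallest_sub; first exact: sigma_algebra_measurable.
  rewrite -bigcup_seq; apply: bigcup_sub => i _ B [C mC <-].
  exact: mf.
apply; rewrite g_sigma_preimage_comp; exists A => //.
by rewrite setTI.
Qed.

End rV_measurable.

Section lebesgue_rV.
Context (R : realType).

Definition rV_cons n (xv : measurableTypeR R * 'rV[R]_n) : 'rV[R]_n.+1 :=
  row_mx (xv.1 : R)%:M xv.2.

Definition rV_uncons n (v : 'rV[R]_n.+1) : measurableTypeR R * 'rV[R]_n :=
  (v ord0 ord0, \row_i v ord0 (lift ord0 i)).

Lemma rV_cons0 n xv : (@rV_cons n xv) ord0 ord0 = xv.1.
Proof.
transitivity (rV_cons xv ord0 (lshift n (ord0 : 'I_1))).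
  by congr (_ _ _); apply: val_inj.
by apply: etrans (row_mxEl _ _ _ _) _; rewrite mxE eqxx mulr1n.
Qed.

Lemma rV_consS n xv i : (@rV_cons n xv) ord0 (lift ord0 i) = xv.2 ord0 i.
Proof.
transitivity (rV_cons xv ord0 (rshift 1 i)).
  by congr (_ _ _); apply: val_inj.
exact: row_mxEr.
Qed.

Lemma rV_consK n : cancel (@rV_cons n) (@rV_uncons n).
Proof.
move=> [x v]; rewrite /rV_uncons rV_cons0/=; congr pair.
by apply/rowP => i; rewrite mxE rV_consS.
Qed.

Lemma rV_unconsK n : cancel (@rV_uncons n) (@rV_cons n).
Proof.
move=> v; apply/rowP => i.
have [j ->|->] := unliftP ord0 i; last by rewrite rV_cons0.
by rewrite rV_consS/= mxE.
Qed.

Lemma measurable_rV_cons n : measurable_fun [set: _] (@rV_cons n).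
Proof.
apply: measurable_fun_rVP => i.
have [j ->|->] := unliftP ord0 i; last first.
  rewrite (_ : _ \o _ = fst) //.
  by apply/funext => xv; rewrite /= /rV_coord rV_cons0.
rewrite (_ : _ \o _ = @rV_coord R n j \o snd).
  by apply: measurableT_comp => //; exact: measurable_rV_coord.
by apply/funext => xv; rewrite /= /rV_coord rV_consS.
Qed.

Lemma measurable_rV_uncons n : measurable_fun [set: _] (@rV_uncons n).
Proof.
apply/measurable_fun_pairP; split.
  exact: (@measurable_rV_coord R n.+1 ord0).
apply: measurable_fun_rVP => i.
rewrite (_ : _ \o _ = @rV_coord R n.+1 (lift ord0 i)).
  exact: measurable_rV_coord.
by apply/funext => v; rewrite /rV_coord /= mxE.
Qed.

(* iterated product of the one-dimensional Lebesgue measure; lebesgue_rV_box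
   gives its value on boxes *)
Fixpoint lebesgue_rV n : set 'rV[R]_n -> \bar R :=
  if n is m.+1
  then fun A => (@lebesgue_measure R \x @lebesgue_rV m)%E (@rV_cons m @^-1` A)
  else fun A => \d_(0 : 'rV[R]_0) A.

Lemma lebesgue_rV_sigma_finite_measure n :
  exists mu : {sigma_finite_measure set 'rV[R]_n -> \bar R},
    mu = @lebesgue_rV n :> (set 'rV[R]_n -> \bar R).
Proof.
elim: n => [|n [mu muE]].
  by exists (\d_(0 : 'rV[R]_0)); apply/funext.
pose nu0 := (@lebesgue_measure R \x mu)%E.
pose pf := pushforward nu0 (@rV_cons n) : {measure set 'rV[R]_n.+1 -> \bar R}.
pose nu := pf (@measurable_rV_cons n).
have nuE : nu = @lebesgue_rV n.+1 :> (set 'rV[R]_n.+1 -> \bar R).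
  by apply/funext => A; rewrite /nu /= /pushforward /nu0 /= muE.
have nu_sf : sigma_finite setT nu.
  have /sigma_finiteP[F [FT ndF Foo]] := sigma_finiteT (@lebesgue_measure R).
  have /sigma_finiteP[G [GT ndG Goo]] := sigma_finiteT mu.
  exists (fun k => @rV_uncons n @^-1` (F k `*` G k)).
    rewrite -preimage_bigcup; apply/seteqP; split => // v _.
    have [a _ Fa] : (\bigcup_k F k) (rV_uncons v).1 by rewrite -FT.
    have [b _ Gb] : (\bigcup_k G k) (rV_uncons v).2 by rewrite -GT.
    exists (maxn a b) => //; split.
      by move: Fa; apply/subsetPset/ndF/leq_maxl.
    by move: Gb; apply/subsetPset/ndG/leq_maxr.
  move=> k; have [mF Fk] := Foo k; have [mG Gk] := Goo k; split.
    by rewrite -[X in measurable X]setTI; apply: measurable_rV_uncons => //;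
      exact: measurableX.
  rewrite /nu /= /pushforward -comp_preimage.
  rewrite (_ : _ \o _ = id); last by apply/funext => xv /=; rewrite rV_consK.
  by rewrite preimage_id /nu0 product_measure1E// lte_mul_pinfty// ge0_fin_numE.
pose sf := Measure_isSigmaFinite.Build _ _ _ nu nu_sf.
pose m : {sigma_finite_measure set 'rV[R]_n.+1 -> \bar R} :=
  HB.pack (nu : set _ -> \bar R) (Measure.on nu) sf.
by exists m.
Qed.

Section instances.
Variable n : nat.

Let lebesgue_rV0 : @lebesgue_rV n set0 = 0%E.
Proof. by have [mu <-] := lebesgue_rV_sigma_finite_measure n; exact: measure0. Qed.

Let lebesgue_rV_ge0 A : (0 <= @lebesgue_rV n A)%E.
Proof. by have [mu <-] := lebesgue_rV_sigma_finite_measure n. Qed.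

Let lebesgue_rV_sigma_additive : semi_sigma_additive (@lebesgue_rV n).
Proof.
have [mu <-] := lebesgue_rV_sigma_finite_measure n.
exact: measure_semi_sigma_additive.
Qed.

HB.instance Definition _ := isMeasure.Build _ _ _ (@lebesgue_rV n)
  lebesgue_rV0 lebesgue_rV_ge0 lebesgue_rV_sigma_additive.

Let lebesgue_rV_sigma_finite : sigma_finite setT (@lebesgue_rV n).
Proof.
have [mu <-] := lebesgue_rV_sigma_finite_measure n.
exact: sigma_finiteT.
Qed.

HB.instance Definition _ := Measure_isSigmaFinite.Build _ _ _ (@lebesgue_rV n)
  lebesgue_rV_sigma_finite.

End instances.

Lemma lebesgue_rV_box n (A : 'I_n -> set (measurableTypeR R)) :
  (forall i, measurable (A i)) ->
  lebesgue_rV [set v : 'rV[R]_n | forall i, A i (v ord0 i)] =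
  (\prod_(i < n) lebesgue_measure (A i))%E.
Proof.
elim: n A => [|n IH] A mA.
  by rewrite big_ord0 /= diracE mem_set//= => -[].
rewrite big_ord_recl -IH//.
have mB : measurable [set v : 'rV[R]_n | forall i, A (lift ord0 i) (v ord0 i)].
  rewrite (_ : [set _ | _] =
      \big[setI/setT]_(i < n) (@rV_coord R n i @^-1` A (lift ord0 i))).
    apply: big_ind => //; first exact: measurableI.
    move=> i _; rewrite -[X in measurable X]setTI.
    exact: measurable_rV_coord.
  rewrite -bigcap_seq; apply/seteqP; split => v /= vA i; first by move=> _; exact: vA.
  by apply: (vA i) => /=; exact: mem_index_enum.
rewrite -(product_measure1E lebesgue_measure (@lebesgue_rV n))//=.
congr (_ _); apply/seteqP; split => -[x v] /=.
  by move=> vA; split=> [|i]; have := vA _; [move=> /(_ ord0)|move=> /(_ (lift ord0 i))];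
    rewrite ?rV_cons0 ?rV_consS.
move=> [Ax Av] i; have [j ->|->] := unliftP ord0 i.
  by rewrite rV_consS; exact: Av.
by rewrite rV_cons0.
Qed.

End lebesgue_rV.

Section calculus.
Context (R : realType) (N : nat).
Implicit Types (f : 'rV[R]_N -> R) (x v w : 'rV[R]_N) (A : set 'rV[R]_N).

Definition dotv v w : R := \sum_(i < N) v ord0 i * w ord0 i.

(* Euclidean norm; `|v| is the sup norm on 'rV[R]_N *)
Definition enorm v : R := Num.sqrt (dotv v v).

Definition partial (i : 'I_N) f x : R := 'D_(delta_mx ord0 i) f x.

Definition grad f x : 'rV[R]_N := \row_i partial i f x.

Definition hess f x : 'M[R]_N := \matrix_(i, j) partial i (partial j f) x.

(* meant for A open *)
Definition C1_on A f := forall x, A x -> forall i,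
  derivable f x (delta_mx ord0 i) /\ {for x, continuous (partial i f)}.

Definition C2_on A f := C1_on A f /\ forall i, C1_on A (partial i f).

Definition C1c f := C1_on setT f /\ compact (closure [set x | f x != 0]).

End calculus.

Section finsler.
Context (R : realType) (N : nat).
Implicit Types (H : 'rV[R]_N -> R) (x v : 'rV[R]_N).

(* unit normal to the level sets of H, pointing outwards *)
Definition unit_normal H x : 'rV[R]_N := (enorm (grad H x))^-1 *: grad H x.

(* k is a principal curvature at x of the level set of H through x, i.e. an
   eigenvalue of the shape operator v |-> D_v nu on the tangent space nu^\perp;
   with the outward normal nu, spheres have positive curvature *)
Definition principal_curvature H x (k : R) :=
  exists v, [/\ v != 0, dotv (unit_normal H x) v = 0 &
                'D_v (unit_normal H) x = k *: v].

(* the boundary of the unit ball {H < 1} is {H = 1} *)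
Definition uniformly_convex_ball H :=
  exists2 L : R, 0 < L &
    forall x k, H x = 1 -> principal_curvature H x k -> L <= k.

Record finsler_norm H : Prop := {
  finsler_ge0 : forall x, 0 <= H x ;
  finsler_eq0 : forall x, H x = 0 -> x = 0 ;
  finslerZ : forall (a : R) x, H (a *: x) = `|a| * H x ;
  finslerD : forall x y, H (x + y) <= H x + H y ;
  finsler_C2 : C2_on [set x | x != 0] H ;
  finsler_uniformly_convex : uniformly_convex_ball H
}.

End finsler.

(* Only the values of B on [0, +oo[ matter. *)
Record growth (R : realType) (p kappa gamma Gamma : R) (B : R -> R) : Prop := {
  growth_C2 : forall t, 0 < t ->
    [/\ derivable B t 1, derivable (derive1 B) t 1 &
        {for t, continuous (derive1n 2 B)}] ;
  growth_0 : B 0 = 0 ;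
  growth_deriv0 : (fun h => h^-1 * (B h - B 0)) @ 0^'+ --> (0 : R) ;
  growth_gt0 : forall t, 0 < t ->
    [/\ 0 < B t, 0 < derive1 B t & 0 < derive1n 2 B t] ;
  growth_deriv1 : forall t, 0 < t ->
    gamma * (kappa + t) `^ (p - 2) * t <= derive1 B t
      <= Gamma * (kappa + t) `^ (p - 2) * t ;
  growth_deriv2 : forall t, 0 < t ->
    gamma * (p - 1) * (kappa + t) `^ (p - 2) <= derive1n 2 B t
      <= Gamma * (p - 1) * (kappa + t) `^ (p - 2)
}.

Section solutions.
Context (R : realType) (N : nat).
Implicit Types (H u phi : 'rV[R]_N -> R) (Du : 'rV[R]_N -> 'rV[R]_N)
  (xi : 'rV[R]_N) (B : R -> R).

Let leb := @lebesgue_rV R N.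

Definition Lp_loc (p : R) (f : 'rV[R]_N -> R) :=
  measurable_fun setT f /\
  forall K, compact K -> (\int[leb]_(x in K) (`|f x| `^ p)%:E < +oo)%E.

Definition Linfty_loc (f : 'rV[R]_N -> R) :=
  measurable_fun setT f /\
  forall K, compact K ->
    exists M : R, {ae leb, forall x, K x -> `|f x| <= M}.

(* C^1_c test functions are equivalent to C^oo_c ones, by mollification *)
Definition weak_gradient u Du := forall phi, C1c phi -> forall i,
  \int[leb]_x (u x * partial i phi x) =
  - \int[leb]_x (Du x ord0 i * phi x).

(* u is in W^{1,p}_loc(R^N), with weak gradient Du *)
Definition W1p_loc (p : R) u Du :=
  [/\ Lp_loc p u, (forall i, Lp_loc p (fun x => Du x ord0 i)) &
      weak_gradient u Du].

(* B'(H(xi)) grad H(xi), extended by B'(0) = 0 at the origin, where H is not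
   differentiable *)
Definition flux B H xi : 'rV[R]_N :=
  if xi == 0 then 0 else derive1 B (H xi) *: grad H xi.

Record weak_solution (p q : R) B H u Du : Prop := {
  weak_solution_W1p : W1p_loc p u Du ;
  weak_solution_Linfty : Linfty_loc u ;
  weak_solution_eq : forall phi, C1c phi ->
    \int[leb]_x dotv (flux B H (Du x)) (grad phi x) =
    \int[leb]_x (`|u x| `^ (q - 1) * u x * phi x)
}.

Definition stability_form (q : R) B H u Du phi : R :=
  \int[leb]_x (if Du x == 0 then 0
               else derive1n 2 B (H (Du x)) *
                    dotv (grad H (Du x)) (grad phi x) ^+ 2)
  + \int[leb]_x (if Du x == 0 then 0
                 else derive1 B (H (Du x)) *
                      dotv (grad phi x *m hess H (Du x)) (grad phi x))
  - \int[leb]_x (q * `|u x| `^ (q - 1) * phi x ^+ 2).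

Definition stable (q : R) B H u Du :=
  forall phi, C1c phi -> 0 <= stability_form q B H u Du phi.

End solutions.

(* Main.v *)
(* Farina's argument. For alpha > 1, test the equation with
   |u|^(alpha-1) u zeta^2 and the stability inequality with
   |u|^((alpha-1)/2) u zeta, zeta being a power of the cut-off
   max(0, rho^2 - |x|^2). These tests are only W^{1,p}, so they are first done
   with mollifications of u, and the limit is taken by dominated convergence;
   no regularity of u is needed. Homogeneity of H (grad H(x).x = H(x) and
   D^2 H(x) x = 0) decouples the radial part of the test gradients from the
   gradient of zeta. If Gamma (p-1) (alpha+1)^2 / gamma < 4 q alpha, the
   equation and the inequality combine, after Young's inequality, into
     int |u|^(q+alpha) zeta^2
       <= C rho^(4m+N) (rho^(-p(q+alpha)/(q-p+1))
                        + kappa^(p-2) rho^(-2(q+alpha)/(q-1))),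
   where zeta^2 has order rho^(4m) near the origin. Each of the three
   hypotheses allows an alpha for which both exponents beat N, and
   rho -> +oo gives u = 0. *)

From HB Require Import structures.
Require Import Defs.
From mathcomp Require Import all_boot all_order all_algebra.
From mathcomp Require Import all_classical all_reals all_analysis.
From mathcomp Require Import measurable_realfun lebesgue_integral_under.
From mathcomp Require Import ring lra.
Import Order.TTheory GRing.Theory Num.Theory.
Import numFieldNormedType.Exports.
Local Open Scope classical_set_scope.
Local Open Scope ring_scope.

Set Implicit Arguments.
Unset Strict Implicit.
Unset Printing Implicit Defensive.

(** Write E for the integral of B'(H(Du)) H(Du) |u|^(alpha-1) zeta^2 and J for that of |u|^(q+alpha)
    zeta^2. Up to small errors the equation gives alpha E <= J, and stability gives q J <= Gamma
    (p-1) / gamma ((alpha+1)/2)^2 E, because the growth bounds imply t B''(t) <= Gamma (p-1) / gamma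
    B'(t). These two leave no room for J > 0 under the stated condition on alpha. The largest alpha
    allowed is the larger root of a quadratic, whence the square root in the hypotheses. The errors
    carry theta^2, where theta = rho / (rho^2 - |x|^2) measures |grad zeta| / zeta. Young's
    inequality turns theta^2 into higher powers, which blow up at the edge of the ball; the power of
    the cut-off is taken large enough to compensate them. Passing from mollified tests to the limit
    requires one p-integrable majorant for all gradients. Mollifications with summable L^p errors
    are chosen: the sum of the errors is integrable, which gives almost everywhere convergence and
    domination together. *)

Lemma eq_ler (R : numDomainType) (x y : R) : x = y -> x <= y.
Proof. by move->. Qed.

(** * Lebesgue measure on the space of row vectors *)

Definition rV_box (R : realType) n (A : 'I_n -> set R) : set 'rV[R]_n :=
  [set v | forall i, A i (v ord0 i)].

Lemma measurable_rV_box (R : realType) n (A : 'I_n -> set (measurableTypeR R)) :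
  (forall i, measurable (A i)) -> measurable (rV_box A).
Proof.
move=> mA; rewrite (_ : rV_box _ =
    \big[setI/setT]_(i < n) (@rV_coord R n i @^-1` A i)).
  apply: big_ind => //; first exact: measurableI.
  move=> i _; rewrite -[X in measurable X]setTI.
  exact: measurable_rV_coord.
rewrite -bigcap_seq; apply/seteqP; split => v /= vA i; first by move=> _; exact: vA.
by apply: (vA i) => /=; exact: mem_index_enum.
Qed.

(** Boxes are stable under intersection, so with them as generators a measure is determined by its
    values on boxes. *)
Lemma measurable_rV_boxes (R : realType) n :
  @measurable _ 'rV[R]_n =
  <<s [set B | exists2 A : 'I_n -> set (measurableTypeR R),
         (forall i, measurable (A i)) & B = rV_box A] >>.
Proof.
apply/seteqP; split.
  apply: smallest_sub; first exact: smallest_sigma_algebra.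
  rewrite -bigcup_seq; apply: bigcup_sub => i _ B [C mC <-].
  rewrite setTI; apply: sub_sigma_algebra.
  (* The preimage of [C] under one coordinate is the box whose other sides are the whole line. *)
  exists (fun j => if j == i then C else setT) => [j|]; first by case: ifP.
  apply/seteqP; split => v /=; rewrite /rV_coord /rV_box /=.
    by move=> Cv j; case: eqP => // ->.
  by move=> /(_ i); rewrite eqxx.
apply: smallest_sub; first exact: sigma_algebra_measurable.
by move=> B [A mA ->]; exact: measurable_rV_box.
Qed.

Lemma lebesgue_measure_shift (R : realType) (a : R) (A : set (measurableTypeR R)) :
  measurable A -> lebesgue_measure ((fun x => x + a) @^-1` A) = lebesgue_measure A.
Proof.
move=> mA.
have mf : measurable_fun [set: measurableTypeR R] (fun x : measurableTypeR R => x + a : measurableTypeR R).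
  exact: measurable_funD.
pose m := pushforward (@lebesgue_measure R) (fun x : measurableTypeR R => x + a : measurableTypeR R) : {measure set _ -> \bar R}.
pose m' := m mf.
rewrite -[LHS]/(m' A); apply/esym/lebesgue_measure_unique => //= _ [[b c]] _ <-.
rewrite /m' /m /= /pushforward /=.
rewrite (_ : _ @^-1` _ = `]b - a, c - a]%classic); last first.
  by apply/seteqP; split => x /=; rewrite !in_itv/= ltrBlDr lerBrDr.
rewrite !lebesgue_measure_itv /= !lte_fin ltrD2r.
by case: ifPn => // _; rewrite -!EFinB; congr (_%:E); ring.
Qed.

Lemma rV_box_shift (R : realType) n (B : 'I_n -> set R) (z : 'rV[R]_n) :
  (fun x => x + z) @^-1` (rV_box B) =
  rV_box (fun i => (fun x => x + z ord0 i) @^-1` B i).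
Proof.
by apply/seteqP; split => v /= h i; have := h i; rewrite /= mxE.
Qed.

Lemma measurable_shift_preimage (R : realType) (a : R) (B : set (measurableTypeR R)) :
  measurable B -> measurable ((fun x : measurableTypeR R => x + a : measurableTypeR R) @^-1` B).
Proof.
move=> mB; rewrite -[X in measurable X]setTI.
have : measurable_fun [set: measurableTypeR R] (fun x : measurableTypeR R => x + a : measurableTypeR R).
  exact: measurable_funD.
exact.
Qed.

Lemma le_coord_norm (R : realType) n (v : 'rV[R]_n) i : `|v ord0 i| <= `|v|.
Proof.
rewrite [leRHS]/Num.norm/= mx_normrE.
exact: (le_bigmax _ (fun ij => `|v ij.1 ij.2|) (ord0, i)).
Qed.

Lemma rV_norm_le (R : realType) n (v : 'rV[R]_n) (r : R) : 0 <= r ->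
  (forall i, `|v ord0 i| <= r) -> `|v| <= r.
Proof.
move=> r0 h; rewrite [leLHS]/Num.norm/= mx_normrE.
by apply/bigmax_leP; split => // -[i j] _ /=; rewrite ord1.
Qed.

Lemma rV_norm_lt (R : realType) n (v : 'rV[R]_n) (r : R) : 0 < r ->
  (forall i, `|v ord0 i| < r) -> `|v| < r.
Proof.
move=> r0 h; rewrite [ltLHS]/Num.norm/= mx_normrE.
by apply/bigmax_ltP; split => // -[i j] _ /=; rewrite ord1.
Qed.

Lemma prode_lty (R : realType) n (f : 'I_n -> \bar R) : (forall i, 0 <= f i)%E ->
  (forall i, f i < +oo)%E -> (\prod_(i < n) f i < +oo)%E.
Proof.
move=> f0 foo; suff : (0 <= \prod_(i < n) f i < +oo)%E by case/andP.
apply: (big_ind (fun x : \bar R => 0 <= x < +oo)%E).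
- by rewrite lee01 ltey.
- move=> x y /andP[x0 xoo] /andP[y0 yoo]; rewrite mule_ge0//=.
  by rewrite lte_mul_pinfty// ge0_fin_numE.
- by move=> i _; rewrite f0 foo.
Qed.

(** * Translation invariance of Lebesgue measure *)

Section translation.
Context (R : realType) (n : nat).
Notation mu := (@lebesgue_rV R n).

Lemma measurable_rV_shift (z : 'rV[R]_n) :
  measurable_fun setT (fun x : 'rV[R]_n => x + z).
Proof.
apply: measurable_fun_rVP => i.
rewrite (_ : _ \o _ = fun x : 'rV[R]_n => (rV_coord i x : R) + z ord0 i).
  by apply: measurable_funD => //; exact: measurable_rV_coord.
by apply/funext => x /=; rewrite /rV_coord mxE.
Qed.

(** Uniqueness of measures on the intersection-stable family of boxes, with the cubes [[-k, k]^n] as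
    exhausting sequence of finite measure; on a box the claim reduces to each side. *)
Lemma lebesgue_rV_shift (z : 'rV[R]_n) A : measurable A ->
  mu ((fun x => x + z) @^-1` A) = mu A.
Proof.
move=> mA.
pose m := pushforward mu (fun x : 'rV[R]_n => x + z) : {measure set _ -> \bar R}.
pose m' := m (measurable_rV_shift z).
rewrite -[LHS]/(m' A).
pose bx k : 'I_n -> set (measurableTypeR R) := fun=> `[-k%:R, k%:R]%classic.
apply: (measure_unique _ (fun k => rV_box (bx k)) (@measurable_rV_boxes R n)) => //.
- move=> _ _ [B mB ->] [C mC ->]; exists (fun i => B i `&` C i).
    by move=> i; exact: measurableI.
  apply/seteqP; split => v /=; rewrite /rV_box /=.
    by move=> [? ?] i.
  by move=> h; split => i; have [] := h i.
- by move=> k; exists (bx k) => // i; exact: measurable_itv.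
- apply/seteqP; split => // v _.
  exists (Num.truncn `|v|).+1 => // i; rewrite /bx /= in_itv /= -ler_norml.
  exact: le_trans (le_coord_norm v i) (ltW (truncnS_gt _)).
- move=> _ [B mB ->].
  rewrite /m' /m /= /pushforward /= [RHS]lebesgue_rV_box// rV_box_shift.
  rewrite lebesgue_rV_box.
    by apply: eq_bigr => i _; exact: (lebesgue_measure_shift _ (mB i)).
  by move=> i; exact: measurable_shift_preimage.
- move=> k; rewrite /m' /m /= /pushforward /= rV_box_shift.
  rewrite lebesgue_rV_box.
    apply: prode_lty => // i; rewrite lebesgue_measure_shift; last exact: measurable_itv.
    by rewrite /bx lebesgue_measure_itv /=; case: ifP => _; rewrite -?EFinB ltry.
  by move=> i; apply: measurable_shift_preimage; exact: measurable_itv.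
Qed.

End translation.

(** The sigma-algebra is defined through coordinates, not through open sets. In the sup norm balls
    are boxes, and an open set is the union of the countably many boxes with rational centre and
    radius [1/(k+1)] that it contains. *)
Lemma open_measurable_rV (R : realType) n (A : set 'rV[R]_n) :
  open A -> measurable A.
Proof.
move=> oA.
pose B (p : {ffun 'I_n -> rat} * nat) : set 'rV[R]_n :=
  rV_box (fun i => ball (ratr (p.1 i) : R) (p.2.+1%:R^-1)).
have mB p : measurable (B p).
  by apply: measurable_rV_box => i; exact: measurable_ball.
pose F p := if `[< B p `<=` A >] then B p else set0.
rewrite (_ : A = \bigcup_p F p); last first.
  apply/seteqP; split => x; last first.
    by move=> [p _]; rewrite /F; case: ifPn => // /asboolP; exact.
  move=> Ax; have /nbhs_ballP[e /= e0 xeA] := open_nbhs_nbhs (conj oA Ax).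
  (* Since [2/(k+1) <= e], a box of radius [1/(k+1)] that contains [x] lies in the ball of radius
     [e] around [x]. *)
  pose k := Num.truncn (2 / e).
  have ke : 2 * k.+1%:R^-1 <= e :> R.
    rewrite ler_pdivrMr// mulrC -ler_pdivrMr//.
    exact: ltW (truncnS_gt _).
  have /choice[c hc] : forall i, exists q : rat, ball (ratr q : R) (k.+1%:R^-1) (x ord0 i).
    move=> i; have /rat_in_itvoo[q] : x ord0 i - k.+1%:R^-1 < x ord0 i + k.+1%:R^-1.
      by rewrite ltrBlDr -addrA ltrDl addr_gt0// invr_gt0.
    rewrite in_itv /= => /andP[h1 h2]; exists q; by rewrite /ball /= ltr_distl h1 h2.
  exists ([ffun i => c i], k) => //; rewrite /F ifT; last first.
    apply/asboolP => y Bxy; apply: xeA.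
    rewrite mx_norm_ball /ball_ /=.
    apply: (@lt_le_trans _ _ (2 * k.+1%:R^-1)) => //.
    apply: rV_norm_lt => [|i]; first by rewrite mulr_gt0// invr_gt0.
    rewrite !mxE; have := Bxy i; have := hc i; rewrite /= ffunE /ball /= => h1 h2.
    rewrite -(subrKA (ratr (c i))) (le_lt_trans (ler_normD _ _))//.
    by rewrite mulr_natl mulr2n ltrD// distrC.
  by move=> i /=; rewrite ffunE; exact: hc.
apply: countable_bigcupT_measurable => // p.
by rewrite /F; case: ifP.
Qed.

(** * Measurability of continuous functions, possibly off the origin *)

Section continuous_measurable.
Context (R : realType) (n : nat).

Lemma continuous_on_measurable_rV (D : set 'rV[R]_n) (f : 'rV[R]_n -> R) :
  open D -> (forall x, D x -> {for x, continuous f}) -> measurable_fun D f.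
Proof.
move=> oD cf; apply: (measurability _ (RGenOpens.measurableE R)) => _ [_ [a [b ->]] <-].
apply: open_measurable_rV.
rewrite openE => x [Dx fx]; rewrite /interior.
apply: filterI; first exact: open_nbhs_nbhs.
by apply: (cf x Dx); apply: open_nbhs_nbhs; split => //; exact: itv_open.
Qed.

Lemma continuous_measurable_rV (f : 'rV[R]_n -> R) :
  continuous f -> measurable_fun setT f.
Proof.
by move=> cf; apply: continuous_on_measurable_rV => [|x _]; [exact: openT|exact: cf].
Qed.

Lemma measurable_rV_set1 (x : 'rV[R]_n) : measurable [set x].
Proof.
rewrite (_ : [set x] = rV_box (fun i => [set x ord0 i])).
  by apply: (@measurable_rV_box _ _ (fun i => [set x ord0 i])) => i; exact: measurable_set1.
apply/seteqP; split => v /=; first by move=> ->.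
by move=> h; apply/rowP => i; exact: h.
Qed.

(** Meant for the derivatives of a Finsler norm, which are continuous only away from the origin; the
    origin is a measurable singleton, so a value can be prescribed there. *)
Lemma measurable_rV_off0 (f : 'rV[R]_n -> R) (c : R) :
  (forall x : 'rV[R]_n, x != 0 -> {for x, continuous f}) ->
  measurable_fun setT (fun x : 'rV[R]_n => if x == 0 then c else f x).
Proof.
move=> cf.
have m0 : measurable (~` [set (0 : 'rV[R]_n)]) by apply: measurableC; exact: measurable_rV_set1.
have mD : measurable_fun (~` [set (0 : 'rV[R]_n)]) f.
  apply: continuous_on_measurable_rV => [|x /eqP]; last exact: cf.
  by apply: closed_openC; apply: accessible_closed_set1; exact: hausdorff_accessible.
have preE (b : bool) : (fun x : 'rV[R]_n => x == 0) @^-1` [set b] =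
    if b then [set (0 : 'rV[R]_n)] else ~` [set (0 : 'rV[R]_n)].
  by apply/seteqP; case: b; split => x /=; case: eqP => //.
apply: (@measurable_fun_if _ _ _ _ (fun=> c) f setT measurableT (fun x : 'rV[R]_n => x == 0)).
- apply: (measurable_fun_bool true); rewrite setTI (preE true).
  exact: measurable_rV_set1.
- by [].
- by rewrite setTI (preE false).
Qed.

End continuous_measurable.

Section change_of_variables.
Context (R : realType) (n : nat).
Notation mu := (@lebesgue_rV R n).

Lemma ge0_integral_shift (z : 'rV[R]_n) (f : 'rV[R]_n -> \bar R) :
  measurable_fun setT f -> (forall x, 0 <= f x)%E ->
  (\int[mu]_x f (x + z)%R = \int[mu]_x f x)%E.
Proof.
move=> mf f0.
have := @ge0_integral_pushforward _ _ _ _ _ _ (measurable_rV_shift z) mu setT f measurableT mf (fun x _ => f0 x).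
rewrite preimage_setT => <-.
by apply: eq_measure_integral => [|mz A mA _]; [exact: measurable_rV_shift|exact: (lebesgue_rV_shift z mA)].
Qed.

Lemma measurable_norm_ball (r : R) : measurable [set x : 'rV[R]_n | `|x| <= r].
Proof.
rewrite -[X in measurable X]setTI.
rewrite (_ : [set x : 'rV[R]_n | `|x| <= r] = (fun x : 'rV[R]_n => `|x|) @^-1` `]-oo, r]).
  by apply: continuous_measurable_rV => //; exact: norm_continuous.
by apply/seteqP; split => x /=; rewrite in_itv.
Qed.

Lemma lebesgue_rV_cube (r : R) : 0 <= r ->
  mu [set x : 'rV[R]_n | `|x| <= r] = ((2 * r) ^+ n)%:E.
Proof.
move=> r0.
rewrite (_ : [set x : 'rV[R]_n | `|x| <= r] = rV_box (fun=> `[-r, r]%classic)).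
  rewrite (@lebesgue_rV_box R n (fun=> `[-r, r]%classic)); last by move=> i; exact: measurable_itv.
  rewrite (eq_bigr (fun=> (2 * r)%:E)); last first.
    move=> i _; rewrite lebesgue_measure_itv /= lte_fin -EFinB opprK -mulr2n -mulr_natl.
    case: ltP => // rr; congr (_%:E); lra.
  by rewrite prodEFin prodr_const card_ord.
apply/seteqP; split => x /=.
  by move=> xr i /=; rewrite in_itv /= -ler_norml (le_trans (le_coord_norm _ _)).
move=> h; apply: rV_norm_le => // i.
by have := h i; rewrite /= in_itv /= -ler_norml.
Qed.

Lemma compact_bounded_rV (K : set 'rV[R]_n) : compact K ->
  exists2 r : R, 0 <= r & K `<=` [set x | `|x| <= r].
Proof.
move=> /compact_bounded[M [Mreal hM]]; exists (`|M| + 1) => //.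
by move=> x /= Kx; apply: (hM (`|M| + 1)) => //; rewrite (le_lt_trans (ler_norm _))// ltrDl.
Qed.

Lemma compact_norm_ball (r : R) : compact [set x : 'rV[R]_n | `|x| <= r].
Proof.
apply: bounded_closed_compact.
  exists `|r|; split => // x rx y /= yr.
  by rewrite (le_trans yr)// (le_trans (ler_norm _))// ltW.
rewrite (_ : [set x : 'rV[R]_n | `|x| <= r] = (fun x : 'rV[R]_n => `|x|) @^-1` [set y | y <= r]) //.
apply: preimage_closed; last exact: closed_le.
by move=> x _; exact: norm_continuous.
Qed.

Lemma measurable_compact_rV (K : set 'rV[R]_n) : compact K -> measurable K.
Proof.
move=> /compact_closed cK.
rewrite -(setCK K); apply: measurableC; apply: open_measurable_rV.
by apply: closed_openC; apply: cK; exact: norm_hausdorff.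
Qed.

Lemma lebesgue_rV_compact_lty (K : set 'rV[R]_n) : compact K -> (mu K < +oo)%E.
Proof.
move=> cK; have [r r0 Kr] := compact_bounded_rV cK.
apply: (@le_lt_trans _ _ (mu [set x : 'rV[R]_n | `|x| <= r])).
  apply: le_measure => //; rewrite inE.
    exact: measurable_compact_rV.
  exact: measurable_norm_ball.
by rewrite lebesgue_rV_cube// ltry.
Qed.

End change_of_variables.

(** * Translations in L^p *)

Section powR_continuity.
Context (R : realType).

Lemma continuous_powR_gt0 (r x : R) : 0 < x -> {for x, continuous (fun y : R => y `^ r)}.
Proof.
move=> x0; apply/differentiable_continuous/derivable1_diffP.
by have [] := @is_derive1_powR R r x x0.
Qed.

Lemma continuous_norm_powR (r : R) : 0 <= r -> continuous (fun x : R => `|x| `^ r).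
Proof.
rewrite le_eqVlt => /predU1P[<-|r0] x.
  by under eq_fun do rewrite powRr0; exact: cvg_cst.
have [->|x0] := eqVneq x 0; last first.
  apply: (@continuous_comp _ _ _ (fun x : R => `|x|) (fun y : R => y `^ r)).
    exact: norm_continuous.
  by apply: continuous_powR_gt0; rewrite normr_gt0.
rewrite /continuous_at normr0 powR0 ?gt_eqF//; apply/cvgrPdist_lt => e e0.
near=> y.
rewrite sub0r normrN ger0_norm ?powR_ge0//.
(* With [e] written as an [r]-th power, smallness of [|y|^r] becomes smallness of [|y|]. *)
have -> : e = (e `^ (r^-1)) `^ r.
  by rewrite -powRrM mulVf ?gt_eqF// powRr1// ltW.
apply: gt0_ltr_powR => //; rewrite ?nnegrE ?powR_ge0//.
near: y; apply/nbhs_ballP; exists (e `^ r^-1) => /=; first exact: powR_gt0.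
by move=> y; rewrite /ball /= sub0r normrN.
Unshelve. all: by end_near. Qed.

End powR_continuity.

Section translation_continuity.
Context (R : realType) (n : nat).
Notation mu := (@lebesgue_rV R n).
Implicit Types (f g h : 'rV[R]_n -> R) (p e : R) (z : 'rV[R]_n).

(** The p-th power of the L^p distance. Without the root it is a plain integral, at the price of a
    factor [2 ^ p] in the triangle inequality. *)
Definition pdist p f g : \bar R := (\int[mu]_x (`|f x - g x| `^ p)%:E)%E.

Definition translate z f := fun x => f (x + z).

Definition translation_continuous p f := forall e, 0 < e ->
  exists2 d, 0 < d & forall z, `|z| < d -> (pdist p (translate z f) f <= e%:E)%E.

Lemma measurable_translate z f : measurable_fun setT f -> measurable_fun setT (translate z f).
Proof. move=> mf; exact: measurableT_comp mf (measurable_rV_shift z). Qed.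

Lemma measurable_powR_dist p f g : measurable_fun setT f -> measurable_fun setT g ->
  measurable_fun setT (fun x => (`|f x - g x| `^ p)%:E).
Proof.
move=> mf mg; apply/measurable_EFinP.
apply: (measurableT_comp (measurable_powR _)).
apply: measurableT_comp => //; exact: measurable_funB.
Qed.

(** [|a + b|] is at most twice the larger of [|a|] and [|b|], whose p-th power is one of the two
    summands. *)
Lemma powR_normD_le p (a b : R) : 0 <= p ->
  `|a + b| `^ p <= 2 `^ p * (`|a| `^ p + `|b| `^ p).
Proof.
move=> p0; pose m := Num.max `|a| `|b|.
have m0 : 0 <= m by rewrite le_max normr_ge0.
apply: (@le_trans _ _ ((2 * m) `^ p)).
  apply: ge0_ler_powR => //; rewrite ?nnegrE ?mulr_ge0//.
  rewrite (le_trans (ler_normD _ _))// mulr_natl mulr2n lerD// /m le_max lexx ?orbT//.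
rewrite powRM// ler_wpM2l ?powR_ge0// /m.
by have [ab|/ltW ab] := leP `|a| `|b|; rewrite ?(max_r ab) ?(max_l ab) ?lerDl ?lerDr powR_ge0.
Qed.

Lemma pdist_triangle p f g h : 0 <= p -> measurable_fun setT f ->
  measurable_fun setT g -> measurable_fun setT h ->
  (pdist p f h <= (2 `^ p)%:E * (pdist p f g + pdist p g h))%E.
Proof.
move=> p0 mf mg mh; rewrite /pdist.
have P0 (a b : 'rV[R]_n -> R) (x : 'rV[R]_n) : [set: 'rV[R]_n] x -> (0 <= (`|a x - b x| `^ p)%:E)%E.
  by move=> _; rewrite lee_fin powR_ge0.
have mfg := measurable_powR_dist p mf mg; have mgh := measurable_powR_dist p mg mh.
rewrite -(ge0_integralD mu measurableT (P0 f g) mfg (P0 g h) mgh).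
rewrite -ge0_integralZl_EFin ?powR_ge0//; last 2 first.
- by move=> x _; apply: adde_ge0; [exact: (P0 f g)|exact: (P0 g h)].
- exact: emeasurable_funD.
apply: ge0_le_integral => //.
- exact: measurable_powR_dist.
- by apply: emeasurable_funM => //; exact: emeasurable_funD.
- move=> x _; rewrite -EFinD -EFinM lee_fin.
  have -> : f x - h x = (f x - g x) + (g x - h x) by ring.
  exact: powR_normD_le.
Qed.

Lemma pdist_translate p z f g : measurable_fun setT f -> measurable_fun setT g ->
  pdist p (translate z f) (translate z g) = pdist p f g.
Proof.
move=> mf mg; rewrite /pdist /translate.
rewrite (ge0_integral_shift z (measurable_powR_dist p mf mg))//.
Qed.

Lemma pdistC p f g : pdist p f g = pdist p g f.
Proof. by apply: eq_integral => x _; rewrite distrC. Qed.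

(** The translate of [f] is compared with [f] through [g] and its translate; translation invariance
    makes two of the three errors equal. *)
Lemma translation_continuous_closure p f : 0 <= p -> measurable_fun setT f ->
  (forall e, 0 < e -> exists g, [/\ measurable_fun setT g,
     translation_continuous p g & (pdist p f g <= e%:E)%E]) ->
  translation_continuous p f.
Proof.
move=> p0 mf H e e0.
(* The factor accumulated by two uses of the weak triangle inequality, each of the three errors
   being [e / K]. *)
pose K : R := 2 `^ p * (1 + 2 `^ p * 2).
have K0 : 0 < K by rewrite mulr_gt0 ?powR_gt0// addr_gt0// mulr_gt0 ?powR_gt0.
have eK0 : 0 < e / K by rewrite divr_gt0.
have [g [mg tg fg]] := H _ eK0.
have [d d0 hd] := tg _ eK0; exists d => // z zd.
have mzf := measurable_translate z mf; have mzg := measurable_translate z mg.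
apply: (le_trans (pdist_triangle p0 mzf mzg mf)).
apply: (@le_trans _ _ ((2 `^ p)%:E * ((e / K)%:E + (2 `^ p)%:E * ((e / K)%:E + (e / K)%:E)))%E).
  rewrite lee_wpmul2l ?lee_fin ?powR_ge0//.
  apply: leeD; first by rewrite pdist_translate.
  apply: (le_trans (pdist_triangle p0 mzg mg mf)).
  rewrite lee_wpmul2l ?lee_fin ?powR_ge0//.
  by apply: leeD; [exact: hd|rewrite pdistC].
rewrite -[leLHS]/((2 `^ p * (e / K + 2 `^ p * (e / K + e / K)))%:E) lee_fin.
suff -> : 2 `^ p * (e / K + 2 `^ p * (e / K + e / K)) = e by [].
rewrite /K; field.
by rewrite !gt_eqF ?powR_gt0// addr_gt0// mulr_gt0 ?powR_gt0.
Qed.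

Lemma translation_continuousD p f g : 0 <= p -> measurable_fun setT f ->
  measurable_fun setT g -> translation_continuous p f -> translation_continuous p g ->
  translation_continuous p (f \+ g).
Proof.
move=> p0 mf mg tf tg e e0.
pose K : R := 2 `^ p * 2.
have K0 : 0 < K by rewrite mulr_gt0 ?powR_gt0.
have eK0 : 0 < e / K by rewrite divr_gt0.
have [d d0 hd] := tf _ eK0; have [d' d'0 hd'] := tg _ eK0.
exists (Num.min d d'); first by rewrite lt_min d0.
move=> z; rewrite lt_min => /andP[zd zd'].
have mzf := measurable_translate z mf; have mzg := measurable_translate z mg.
have mD : measurable_fun setT (translate z f \+ g) by exact: measurable_funD.
apply: (@le_trans _ _ ((2 `^ p)%:E * (pdist p (translate z g) g + pdist p (translate z f) f))%E).
  have := @pdist_triangle p (translate z (f \+ g)) (translate z f \+ g) (f \+ g) p0.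
  rewrite (_ : pdist p (translate z (f \+ g)) (translate z f \+ g) = pdist p (translate z g) g); last first.
    by apply: eq_integral => x _ /=; congr ((`| _ | `^ _)%:E); rewrite /translate /=; ring.
  rewrite (_ : pdist p (translate z f \+ g) (f \+ g) = pdist p (translate z f) f); last first.
    by apply: eq_integral => x _ /=; congr ((`| _ | `^ _)%:E); rewrite /translate /=; ring.
  apply => //; [apply: measurable_translate|]; exact: measurable_funD.
apply: (@le_trans _ _ ((2 `^ p)%:E * ((e / K)%:E + (e / K)%:E))%E).
  rewrite lee_wpmul2l ?lee_fin ?powR_ge0//.
  by apply: leeD; [exact: hd'|exact: hd].
rewrite -[leLHS]/((2 `^ p * (e / K + e / K))%:E) lee_fin.
suff -> : 2 `^ p * (e / K + e / K) = e by [].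
by rewrite /K; field; rewrite gt_eqF ?powR_gt0.
Qed.

Lemma translation_continuousZ p (c : R) f : 0 < p -> measurable_fun setT f ->
  translation_continuous p f -> translation_continuous p (fun x => c * f x).
Proof.
move=> p0 mf tf e e0.
pose K : R := `|c| `^ p + 1.
have K0 : 0 < K by rewrite ltr_wpDl ?powR_ge0.
have eK0 : 0 < e / K by rewrite divr_gt0.
have [d d0 hd] := tf _ eK0; exists d => // z zd.
have mzf := measurable_translate z mf.
have -> : pdist p (translate z (fun x => c * f x)) (fun x => c * f x) =
  ((`|c| `^ p)%:E * pdist p (translate z f) f)%E.
  rewrite /pdist -ge0_integralZl_EFin ?powR_ge0//; last exact: measurable_powR_dist.
  by apply: eq_integral => x _; rewrite -EFinM -powRM// /translate -normrM mulrBr.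
apply: (@le_trans _ _ ((`|c| `^ p)%:E * (e / K)%:E)%E).
  by rewrite lee_wpmul2l ?lee_fin ?powR_ge0//; exact: hd.
rewrite -EFinM lee_fin /K mulrCA ger_pMr// ler_pdivrMr//.
by rewrite mul1r lerDl.
Qed.

Lemma translation_continuousB p f g : 0 < p -> measurable_fun setT f ->
  measurable_fun setT g -> translation_continuous p f -> translation_continuous p g ->
  translation_continuous p (fun x => f x - g x).
Proof.
move=> p0 mf mg tf tg.
have -> : (fun x => f x - g x) = f \+ (fun x => -1 * g x).
  by apply/funext => x /=; rewrite mulN1r.
apply: (@translation_continuousD p f (fun x => -1 * g x) (ltW p0) mf) => //.
  exact: measurable_funM.
exact: translation_continuousZ.
Qed.

(** Makes the open sets, an intersection-stable family, available as generators for a Dynkin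
    induction. *)
Lemma sigma_algebra_open_rV :
  @measurable _ 'rV[R]_n = <<s [set A : set 'rV[R]_n | open A] >>.
Proof.
apply/seteqP; split; last first.
  apply: smallest_sub; first exact: sigma_algebra_measurable.
  by move=> A; exact: open_measurable_rV.
apply: smallest_sub; first exact: smallest_sigma_algebra.
rewrite -bigcup_seq; apply: bigcup_sub => i _ _ [C mC <-].
pose T := g_sigma_algebraType [set A : set 'rV[R]_n | open A].
have mc : measurable_fun setT (fun v : T => (v : 'rV[R]_n) ord0 i).
  apply: (measurability _ (RGenOpens.measurableE R)) => _ [_ [a [b ->]] <-].
  apply: sub_sigma_algebra; rewrite setTI /=.
  apply: open_comp; last exact: itv_open.
  by move=> x _; exact: coord_continuous.
exact: mc.
Qed.

Lemma powR_indicB p (A B : set 'rV[R]_n) x : 0 < p ->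
  `|(\1_A x : R) - \1_B x| `^ p = \1_((A `\` B) `|` (B `\` A)) x.
Proof.
move=> p0; rewrite !indicE in_setU !in_setD.
by case: (x \in A); case: (x \in B); rewrite /= ?subrr ?subr0 ?sub0r ?normrN ?normr1 ?normr0 ?powR1 ?powR0// gt_eqF.
Qed.

Lemma pdist_indic p (A B : set 'rV[R]_n) : 0 < p -> measurable A -> measurable B ->
  pdist p \1_A \1_B = mu ((A `\` B) `|` (B `\` A)).
Proof.
move=> p0 mA mB; rewrite /pdist.
under eq_integral do rewrite powR_indicB//.
have mAB : measurable ((A `\` B) `|` (B `\` A)).
  by apply: measurableU; apply: measurableD.
by rewrite integral_indic// setIT.
Qed.

Lemma cvge0_le (u : (\bar R)^nat) e : u @ \oo --> 0%E -> 0 < e ->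
  exists N, forall k, (N <= k)%N -> (u k <= e%:E)%E.
Proof.
move=> u0 e0; have : nbhs (0 : \bar R)%E [set x | (x < e%:E)%E].
  by apply: open_nbhs_nbhs; split; [exact: open_ereal_lt_ereal|rewrite /= lte_fin].
by move=> /u0[N _ hN]; exists N => k /hN /ltW.
Qed.

(** The points whose ball of radius [1/(k+1)] stays in [A] form sets [B k] that exhaust [A], so [A]
    minus [B k] has small measure. A shift shorter than [1/(k+1)] can only change membership, up to
    translation, on that difference. *)
Lemma translation_continuous_open p (A : set 'rV[R]_n) : 0 < p -> open A ->
  (mu A < +oo)%E -> translation_continuous p \1_A.
Proof.
move=> p0 oA Aoo e e0.
have mA := open_measurable_rV oA.
pose B k := [set x | ball x (k.+1%:R^-1) `<=` A].
have mB k : measurable (B k).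
  rewrite -(setCK (B k)); apply: measurableC; apply: open_measurable_rV.
  rewrite (_ : ~` B k = \bigcup_(y in ~` A) ball y (k.+1%:R^-1)).
    by apply: bigcup_open => y _; apply: ball_open; rewrite invr_gt0.
  apply/seteqP; split => x /=.
    by move=> /existsNP[y /not_implyP[xy nAy]]; exists y => //; exact: ball_sym.
  by move=> [y nAy /ball_sym xy]; apply/existsNP; exists y; apply/not_implyP.
have BA k : B k `<=` A by move=> x; apply; apply: ballxx; rewrite invr_gt0.
have UB : \bigcup_k B k = A.
  apply/seteqP; split; first by move=> x [k _]; exact: BA.
  move=> x Ax; have /nbhs_ballP[d /= d0 xdA] := open_nbhs_nbhs (conj oA Ax).
  exists (Num.truncn (d^-1)) => // y xy; apply: xdA; apply: le_ball xy.
  by rewrite -[leRHS]invrK lef_pV2 ?posrE ?invr_gt0// ltW// truncnS_gt.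
have ndB : {homo B : m k / (m <= k)%N >-> (m <= k)%O}.
  move=> m k mk; apply/subsetPset => x xA y xy; apply: xA; apply: le_ball xy.
  by rewrite lef_pV2 ?posrE// ler_nat.
have mAB k : measurable (A `\` B k) by exact: measurableD.
have [k hk] : exists k, (mu (A `\` B k) <= (e / 2)%:E)%E.
  have : mu (A `\` B k) @[k --> \oo] --> (0 : \bar R)%E.
    rewrite -(measure0 mu).
    have <- : \bigcap_k (A `\` B k) = set0.
      apply/seteqP; split => // x h; have [Ax _] := h 0%N I.
      have [k _ Bx] : (\bigcup_k B k) x by rewrite UB.
      by have [] := h k I.
    apply: nonincreasing_cvg_mu => //; first last.
    - by move=> m k mk; apply/subsetPset; apply: setDS; apply/subsetPset; exact: ndB.
    - exact: bigcapT_measurable.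
    - apply: le_lt_trans Aoo; apply: le_measure; rewrite ?inE//.
  have e20 : 0 < e / 2 by rewrite divr_gt0.
  by move=> /cvge0_le /(_ e20)[N hN]; exists N; exact: hN.
exists (k.+1%:R^-1); first by rewrite invr_gt0.
move=> z zk.
pose A' := (fun x => x + z) @^-1` A.
have mA' : measurable A'.
  by rewrite -[X in measurable X]setTI; exact: measurable_rV_shift.
rewrite (_ : translate z \1_A = \1_A'); last by apply/funext => x; rewrite /translate !indicE.
rewrite pdist_indic//.
apply: (le_trans (measureU2 _ _ _)); [exact: measurableD|exact: measurableD|].
rewrite (splitr e) EFinD; apply: leeD.
  (* A point carried into [A] from outside lands in [A] minus [B k], and the shifted copy of that
     set has the same measure. *)
  rewrite (le_trans _ hk)// -(lebesgue_rV_shift z (mAB k)).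
  apply: le_measure; rewrite ?inE; first exact: measurableD.
    by rewrite -[X in measurable X]setTI; exact: measurable_rV_shift.
  move=> x [A'x nAx]; split => // Bx; apply: nAx; apply: Bx.
  by rewrite -ball_normE /ball_ /= addrC addKr.
rewrite (le_trans _ hk)//; apply: le_measure; rewrite ?inE//; first exact: measurableD.
move=> x [Ax nA'x]; split => // Bx; apply: nA'x; apply: Bx.
by rewrite -ball_normE /ball_ /= opprD addNKr normrN.
Qed.

(** Dynkin's theorem, starting from open sets. The intersection with [Q] keeps measures finite, so
    that a complement becomes a difference of integrable indicators. *)
Lemma translation_continuous_measurable p (Q A : set 'rV[R]_n) : 0 < p -> open Q ->
  (mu Q < +oo)%E -> measurable A -> translation_continuous p \1_(A `&` Q).
Proof.
move=> p0 oQ Qoo; have mQ := open_measurable_rV oQ.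
have tQ := translation_continuous_open p0 oQ Qoo.
have mI E : measurable E -> measurable_fun setT (\1_(E `&` Q) : _ -> R).
  by move=> mA; apply/measurable_indicP/measurableI.
rewrite sigma_algebra_open_rV => sA; move: A sA.
apply: dynkin_induction.
- exact: sigma_algebra_open_rV.
- by move=> A B /= oA oB; exact: openI.
- by rewrite setTI.
- move=> A /= oA; apply: translation_continuous_open => //; first exact: openI.
  by apply: le_lt_trans Qoo; apply: le_measure; rewrite ?inE//; apply: measurableI => //; exact: open_measurable_rV.
- move=> S mS tS.
  rewrite (_ : \1_(~` S `&` Q) = fun x => \1_Q x - \1_(S `&` Q) x).
    apply: translation_continuousB => //; exact: mI.
  apply/funext => x; rewrite !indicE !in_setI in_setC.
  by case: (x \in S); case: (x \in Q); rewrite /= ?subrr ?subr0.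
- move=> F mF tF tcF.
  have mG k : measurable (\bigcup_(i < k) F i) by exact: bigcup_measurable.
  have tG k : translation_continuous p \1_((\bigcup_(i < k) F i) `&` Q).
    elim: k => [|k IH].
      rewrite bigcup_mkord big_ord0 set0I.
      move=> e e0; exists 1 => // z _; rewrite /pdist integral0_eq ?lee_fin ?ltW// => x _.
      by rewrite /translate !indicE !in_set0 subrr normr0 powR0// gt_eqF.
    rewrite (_ : \1_(_ `&` Q) = \1_((\bigcup_(i < k) F i) `&` Q) \+ \1_(F k `&` Q)).
      by apply: translation_continuousD => //; [exact: ltW|exact: mI|exact: mI].
    apply/funext => x /=; rewrite !indicE !in_setI.
    rewrite bigcup_mkord big_ord_recr /= -bigcup_mkord in_setU.
    case: (x \in Q); rewrite ?andbF ?addr0// !andbT.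
    have [xF|] := boolP (x \in F k); last by rewrite orbF addr0.
    rewrite orbT (_ : (x \in _) = false) ?add0r//.
    apply/negbTE/negP; rewrite !inE => -[i /= ik Fix].
    move: xF; rewrite inE => Fkx.
    have eik := tF i k I I (ex_intro _ x (conj Fix Fkx)).
    by rewrite eik ltnn in ik.
  (* A countable disjoint union is approximated by its finite unions: the tails inside [Q] decrease
     to the empty set and have finite measure. *)
  apply: translation_continuous_closure; first exact: ltW.
    by apply: mI; exact: bigcupT_measurable.
  move=> e e0.
  pose D k := ((\bigcup_k F k) `\` (\bigcup_(i < k) F i)) `&` Q.
  have mD k : measurable (D k).
    by apply: measurableI => //; apply: measurableD => //; exact: bigcupT_measurable.
  have : mu (D k) @[k --> \oo] --> (0 : \bar R)%E.
    rewrite -(measure0 mu).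
    have <- : \bigcap_k D k = set0.
      apply/seteqP; split => // x h; have [[[k _ Fx] _] _] := h 0%N I.
      by have [[_ +] _] := h k.+1 I; apply; exists k => /=.
    apply: nonincreasing_cvg_mu => //; first last.
    - move=> m k mk; apply/subsetPset => x [[x1 x2] x3]; split => //; split => //.
      by move=> [i /= im Fx]; apply: x2; exists i => //=; exact: leq_trans mk.
    - exact: bigcapT_measurable.
    - by apply: le_lt_trans Qoo; apply: le_measure; rewrite ?inE// => x [].
  move=> /cvge0_le /(_ e0)[N /(_ N (leqnn _)) hN].
  exists (\1_((\bigcup_(i < N) F i) `&` Q)); split => //; first exact: mI.
  rewrite pdist_indic//; last 2 first.
    by apply: measurableI => //; exact: bigcupT_measurable.
    exact: measurableI.
  apply: le_trans hN; apply: le_measure; rewrite ?inE//.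
    by apply: measurableU; apply: measurableD => //; apply: measurableI => //; exact: bigcupT_measurable.
  move=> x [[[Fx Qx] nx]|[[[i /= iN Fx] Qx] nx]].
    by split => //; split => // h; apply: nx.
  by exfalso; apply: nx; split => //; exists i.
Qed.

Lemma translation_continuous_sum p (s : seq R) (F : R -> 'rV[R]_n -> R) : 0 < p ->
  (forall y, measurable_fun setT (F y)) -> (forall y, translation_continuous p (F y)) ->
  translation_continuous p (fun x => \sum_(y <- s) y * F y x).
Proof.
move=> p0 mF tF; elim: s => [|y s IH].
  under eq_fun do rewrite big_nil.
  move=> e e0; exists 1 => // z _; rewrite /pdist integral0_eq ?lee_fin ?ltW// => x _.
  by rewrite subrr normr0 powR0// gt_eqF.
under eq_fun do rewrite big_cons.
apply: (@translation_continuousD p (fun x => y * F y x)) => //.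
- exact: ltW.
- exact: measurable_funM.
- by apply: measurable_sum => i; exact: measurable_funM.
- exact: translation_continuousZ.
Qed.

Import HBNNSimple.

(** Simple functions increasing to [f], cut off by [Q], converge to [f] in L^p by domination, and
    they are finite combinations of the indicators already treated. *)
Lemma translation_continuous_Lp_ge0 p (Q : set 'rV[R]_n) f : 0 < p -> open Q ->
  (mu Q < +oo)%E -> measurable_fun setT f -> (forall x, ~ Q x -> f x = 0) ->
  (forall x, 0 <= f x) -> (\int[mu]_x (`|f x| `^ p)%:E < +oo)%E ->
  translation_continuous p f.
Proof.
move=> p0 oQ Qoo mf fQ f0 fp.
have mQ := open_measurable_rV oQ.
have mf' : measurable_fun setT (EFin \o f) by exact/measurable_EFinP.
pose g k : {nnsfun _ >-> R} := nnsfun_approx measurableT mf' k.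
have cg x : g k x @[k --> \oo] --> f x.
  have f0' y : [set: 'rV[R]_n] y -> (0 <= (EFin \o f) y)%E by rewrite lee_fin.
  have /fine_cvg := cvg_nnsfun_approx measurableT mf' f0' (I : [set: 'rV[R]_n] x).
  exact.
have gf k x : g k x <= f x.
  have nd : nondecreasing_seq (fun k => g k x).
    by move=> a b ab; have /lefP := nd_nnsfun_approx measurableT mf' ab; exact.
  rewrite -(cvg_lim _ (cg x))//; apply: nondecreasing_cvgn_le => //.
  by apply/cvg_ex; exists (f x).
pose G k x := g k x * \1_Q x.
have mG k : measurable_fun setT (G k).
  by apply: measurable_funM; [exact: measurable_funP|exact/measurable_indicP].
have tG k : translation_continuous p (G k).
  rewrite (_ : G k = fun x => \sum_(y <- finmap.enum_fset (fset_set (range (g k)))) y * \1_((g k @^-1` [set y]) `&` Q) x).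
    apply: translation_continuous_sum => // y.
      by apply/measurable_indicP/measurableI.
    exact: translation_continuous_measurable.
  apply/funext => x; rewrite /G fimfunE fsbig_finite//= mulr_suml.
  by apply: eq_bigr => y _; rewrite -mulrA indicI.
have GE k x : 0 <= f x - G k x <= f x.
  rewrite /G indicE; have [Qx|nQx] := pselect (Q x).
    by rewrite mem_set// mulr1 subr_ge0 gf/= lerBlDr lerDl.
  by rewrite memNset// mulr0 subr0 lexx f0.
apply: translation_continuous_closure => //; first exact: ltW.
move=> e e0.
suff /cvge0_le /(_ e0)[N /(_ N (leqnn _)) hN] : pdist p f (G k) @[k --> \oo] --> (0 : \bar R)%E.
  by exists (G N).
rewrite /pdist.
have -> : (0 : \bar R) = (\int[mu]_x (cst (0 : \bar R) x))%E by rewrite integral0.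
apply: (@dominated_cvg _ _ _ mu setT measurableT _ _ (fun x => (`|f x| `^ p)%:E)) => //.
- by move=> k; exact: measurable_powR_dist.
- move=> x _; rewrite /cst; apply/fine_cvgP; split; first exact: nearW.
  have h : f x - G k x @[k --> \oo] --> f x - f x.
    apply: cvgB; first exact: cvg_cst.
    rewrite /G; have [Qx|nQx] := pselect (Q x).
      by rewrite indicE mem_set//; under eq_fun do rewrite mulr1; exact: cg.
    by rewrite indicE memNset//; under eq_fun do rewrite mulr0; rewrite fQ//; exact: cvg_cst.
  rewrite subrr in h.
  have := @continuous_cvg _ _ _ _ _ _ _ _ (@continuous_norm_powR R p (ltW p0) 0) h.
  by rewrite normr0 powR0 ?gt_eqF//; apply.
- apply/integrableP; split.
    apply/measurable_EFinP; apply: (measurableT_comp (measurable_powR _)).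
    exact: measurableT_comp.
  by under eq_integral do rewrite gee0_abs ?lee_fin ?powR_ge0//.
- move=> k x _; rewrite abse_EFin lee_fin ger0_norm ?powR_ge0//.
  have /andP[h1 h2] := GE k x.
  by apply: ge0_ler_powR; rewrite ?nnegrE ?(ltW p0)// !ger0_norm.
Qed.

Lemma translation_continuous_Lp p (Q : set 'rV[R]_n) f : 0 < p -> open Q ->
  (mu Q < +oo)%E -> measurable_fun setT f -> (forall x, ~ Q x -> f x = 0) ->
  (\int[mu]_x (`|f x| `^ p)%:E < +oo)%E ->
  translation_continuous p f.
Proof.
move=> p0 oQ Qoo mf fQ fp.
rewrite (_ : f = fun x => Num.max (f x) 0 - Num.max (- f x) 0); last first.
  apply/funext => x; case: (leP (f x) 0) => fx.
    by rewrite max_l ?oppr_ge0// opprK add0r.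
  by rewrite max_r ?oppr_le0 ?ltW// subr0.
have mN : measurable_fun setT (fun x => - f x) by exact: measurable_funN.
have mp : measurable_fun setT (fun x => Num.max (f x) 0) by exact: measurable_maxr.
have mn : measurable_fun setT (fun x => Num.max (- f x) 0) by exact: measurable_maxr.
have mabs (g : 'rV[R]_n -> R) : measurable_fun setT g -> measurable_fun setT (fun x => (`|g x| `^ p)%:E).
  move=> mg; apply/measurable_EFinP; apply: (measurableT_comp (measurable_powR _)).
  exact: measurableT_comp.
apply: translation_continuousB => //.
- apply: (@translation_continuous_Lp_ge0 p Q) => //.
  + by move=> x /fQ ->; rewrite maxxx.
  + by move=> x; rewrite le_max lexx orbT.
  + apply: le_lt_trans fp; apply: ge0_le_integral => //; try exact: mabs.
    move=> x _; rewrite lee_fin ge0_ler_powR ?nnegrE ?(ltW p0)//.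
    by case: (leP (f x) 0) => // fx; rewrite ?normr0 ?normr_ge0.
- apply: (@translation_continuous_Lp_ge0 p Q) => //.
  + by move=> x /fQ ->; rewrite oppr0 maxxx.
  + by move=> x; rewrite le_max lexx orbT.
  + apply: le_lt_trans fp; apply: ge0_le_integral => //; try exact: mabs.
    move=> x _; rewrite lee_fin ge0_ler_powR ?nnegrE ?(ltW p0)//.
    by case: (leP (- f x) 0) => // fx; rewrite ?normr0 ?normr_ge0 ?normrN.
Qed.

End translation_continuity.

(** * Differential calculus and cut-off functions *)

Section directional.
Context (R : realType) (V : normedModType R).

(** Directional derivatives are transferred to one-variable restrictions, where the chain rule and
    the mean value theorem of the line apply. *)
Lemma is_derive_line (f : V -> R) (x v : V) (t : R) (l : R) :
  is_derive (x + t *: v) v f l -> is_derive t 1 (fun s : R => f (x + s *: v)) l.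
Proof.
have E : (fun h : R => h^-1 *: (f (h *: v + (x + t *: v)) - f (x + t *: v))) =
    (fun h : R => h^-1 *: ((fun s : R => f (x + s *: v)) (h *: 1 + t) - f (x + t *: v))).
  apply/funext => h; congr (_ *: (f _ - _)).
  by rewrite [h *: 1]mulr1 scalerDl addrCA addrA.
move=> [df <-]; split.
  by move: df; rewrite /derivable E.
by rewrite /derive E.
Qed.

Lemma is_derive_line0 (f : V -> R) (x v : V) (l : R) :
  is_derive (0 : R) 1 (fun s : R => f (x + s *: v)) l -> is_derive x v f l.
Proof.
have E : (fun h : R => h^-1 *: (f (h *: v + x) - f x)) =
    (fun h : R => h^-1 *: ((fun s : R => f (x + s *: v)) (h *: 1 + 0) - f (x + 0 *: v))).
  apply/funext => h; congr (_ *: (f _ - f _)).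
    by rewrite [h *: 1]mulr1 addr0 addrC.
  by rewrite scale0r addr0.
move=> [df <-]; split.
  by move: df; rewrite /derivable E.
by rewrite /derive E.
Qed.

Lemma is_derive_dcomp (G : R -> R) (f : V -> R) (x v : V) (dG df : R) :
  is_derive (f x) 1 G dG -> is_derive x v f df -> is_derive x v (G \o f) (dG * df).
Proof.
move=> hG hf; apply: is_derive_line0.
have hf' : is_derive (0 : R) 1 (fun s : R => f (x + s *: v)) df.
  by apply: is_derive_line; rewrite scale0r addr0.
have hG' : is_derive (f (x + (0 : R) *: v)) 1 G dG by rewrite scale0r addr0.
exact: (@is_derive1_comp R G (fun s : R => f (x + s *: v)) 0 dG df).
Qed.

End directional.

Section continuous_sums.
Context (R : realType).

Lemma cvg_fin_sum (T : Type) (F : set_system T) {FF : Filter F} n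
    (f : 'I_n -> T -> R) (l : 'I_n -> R) :
  (forall i, f i x @[x --> F] --> l i) ->
  \sum_(i < n) f i x @[x --> F] --> \sum_(i < n) l i.
Proof.
elim: n f l => [|n IH] f l h.
  by under eq_fun do rewrite big_ord0; rewrite big_ord0; exact: cvg_cst.
under eq_fun do rewrite big_ord_recl.
rewrite big_ord_recl; apply: cvgD; first exact: h.
by apply: (IH (fun i => f (lift ord0 i))) => i; exact: h.
Qed.

End continuous_sums.

(** * Continuous partial derivatives imply differentiability *)

Section C1_differentiable.
Context (R : realType) (N : nat).
Implicit Types (f : 'rV[R]_N -> R) (x v : 'rV[R]_N) (A : set 'rV[R]_N).

Notation e_ i := (delta_mx ord0 i : 'rV[R]_N).

Lemma norm_delta_le i : `|e_ i| <= 1.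
Proof.
apply: rV_norm_le => // j; rewrite mxE eqxx /=.
by case: eqP; rewrite ?normr1 ?normr0.
Qed.

(** Mean value theorem along the segment, which stays in the ball by convexity. *)
Lemma coord_increment f i x (c e r : R) (x0 : 'rV[R]_N) (s : R) :
  (forall y, `|y - x0| < r -> derivable f y (e_ i) /\ `|partial i f y - c| <= e) ->
  `|x - x0| < r -> `|x + s *: e_ i - x0| < r ->
  `|f (x + s *: e_ i) - f x - s * c| <= `|s| * e.
Proof.
(* For negative [s] the segment is run backwards from its other end point. *)
wlog s0 : x s / 0 <= s => [H|].
  have [/H|/ltW s0] := leP 0 s; first exact.
  move=> hf h1 h2.
  have E : x + s *: e_ i + - s *: e_ i = x by rewrite scaleNr addrK.
  have := H (x + s *: e_ i) (- s); rewrite oppr_ge0 E => /(_ s0 hf h2 h1).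
  rewrite normrN; apply: le_trans; rewrite -[leLHS]normrN.
  by apply: eq_ler; congr (`| _ |); ring.
move=> hf h1 h2.
have hseg t : t \in `[0, s] -> `|x + t *: e_ i - x0| < r.
  rewrite in_itv /= => /andP[t0 ts].
  have [s00|sN0] := eqVneq s 0.
    by have -> : t = s by apply/eqP; rewrite eq_le ts s00.
  have [l lE] : exists l, l = t / s by exists (t / s).
  have sp : 0 < s by rewrite lt_def sN0.
  have l0 : 0 <= l by rewrite lE divr_ge0.
  have l1 : l <= 1 by rewrite lE ler_pdivrMr ?mul1r.
  have -> : x + t *: e_ i - x0 = (1 - l) *: (x - x0) + l *: (x + s *: e_ i - x0).
    apply/rowP => j; rewrite !mxE lE; field; exact: sN0.
  apply: (le_lt_trans (ler_normD _ _)); rewrite !normrZ (ger0_norm l0) (@ger0_norm _ (1 - l)) ?subr_ge0//.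
  have [l00|lN0] := eqVneq l 0; first by rewrite l00 subr0 mul1r mul0r addr0.
  rewrite [ltRHS](_ : r = (1 - l) * r + l * r); last by ring.
  apply: ler_ltD; first by rewrite ler_wpM2l ?subr_ge0// ltW.
  by rewrite ltr_pM2l// lt_def lN0.
pose g t := f (x + t *: e_ i).
have dg t : t \in `[0, s] -> is_derive t 1 g (partial i f (x + t *: e_ i)).
  move=> ht; apply: is_derive_line; apply: derivableP.
  by have [] := hf _ (hseg t ht).
have cg : {within `[0, s], continuous g}.
  apply: derivable_within_continuous => t ht; by have [] := dg t ht.
have dg' t : t \in `]0, s[ -> is_derive t 1 g (partial i f (x + t *: e_ i)).
  by move=> /subset_itv_oo_cc; exact: dg.
have [t ts gE] := @MVT_segment R g (fun t => partial i f (x + t *: e_ i)) 0 s s0 dg' cg.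
rewrite /g scale0r addr0 subr0 in gE; rewrite gE.
rewrite [s * c]mulrC -mulrBl normrM mulrC ler_wpM2l//.
by have [] := hf _ (hseg t ts).
Qed.

(** The increment of [f] is split into [N] increments along the axes, each controlled by the
    continuity of one partial derivative. *)
Lemma C1_on_differentiable A f x : open A -> C1_on A f -> A x ->
  differentiable f x /\ forall v, 'D_v f x = \sum_(i < N) v ord0 i * partial i f x.
Proof.
move=> oA hf Ax.
pose L (v : 'rV[R]_N) : R := \sum_(i < N) v ord0 i * partial i f x.
have Llin : linear L.
  move=> a v w; rewrite /L scaler_sumr -big_split; apply: eq_bigr => i _ /=.
  by rewrite !mxE mulrDl -mulrA.
pose Lm := GRing.isLinear.Build R 'rV[R]_N R *:%R L Llin.
pose LL : {linear 'rV[R]_N -> R} := HB.pack L Lm.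
have Lc : continuous L.
  move=> v; rewrite /L; apply: (@cvg_fin_sum R _ (nbhs v) _ N (fun i (w : 'rV[R]_N) => w ord0 i * partial i f x) (fun i => v ord0 i * partial i f x)) => i.
  apply: cvgM; last exact: cvg_cst.
  exact: coord_continuous.
have hd : f \o shift x = cst (f x) + LL +o_ (0 : 'rV[R]_N) id.
  apply/eqaddoP => e e0.
  (* The share of [e] left to each of the [N] steps; dividing by [N.+1] also covers dimension 0. *)
  have e'0 : 0 < e / (N.+1)%:R by rewrite divr_gt0.
  have : \forall y \near x, A y /\ forall i, `|partial i f y - partial i f x| <= e / N.+1%:R.
    have hP (i : 'I_N) : nbhs x (fun y => `|partial i f y - partial i f x| <= e / N.+1%:R).
      have [_ ci] := hf x Ax i.
      by have /cvgrPdist_le /(_ _ e'0) := ci; apply: filterS => y; rewrite distrC.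
    have hA : nbhs x A by exact: open_nbhs_nbhs.
    have hB : nbhs x (fun y => forall i, `|partial i f y - partial i f x| <= e / N.+1%:R).
      exact: (@filter_forall _ _ _ _ _ hP).
    exact: filterI hA hB.
  move=> /nbhs_ballP[r /= r0 hr].
  apply/nbhs_ballP; exists r => //= h; rewrite -ball_normE /ball_ /= sub0r normrN => hr'.
  (* [hk k] keeps the first [k] coordinates of [h], so consecutive vectors differ along one axis
     only. *)
  pose hk (k : nat) : 'rV[R]_N := \row_i (if (i < k)%N then h ord0 i else 0).
  have hk_le k : `|hk k| < r.
    apply: le_lt_trans hr'; apply: rV_norm_le => // i; rewrite mxE; case: ifP => _.
      exact: le_coord_norm.
    by rewrite normr0.
  have hkS (k : 'I_N) : hk k.+1 = hk k + h ord0 k *: e_ k.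
    apply/rowP => i; rewrite !mxE eqxx /= ltnS.
    rewrite -val_eqE /=; case: (ltngtP i k) => ik; rewrite ?mulr0 ?addr0 ?mulr1 ?add0r//.
    by congr (h ord0 _); apply: val_inj.
  have hkN : hk N = h by apply/rowP => i; rewrite mxE ltn_ord.
  have hk0 : hk 0%N = 0 by apply/rowP => i; rewrite !mxE.
  have step (k : 'I_N) : `|f (x + hk k.+1) - f (x + hk k) - h ord0 k * partial k f x|
      <= `|h ord0 k| * (e / N.+1%:R).
    have E : x + hk k.+1 = x + hk k + h ord0 k *: e_ k by rewrite hkS addrA.
    rewrite E; apply: (@coord_increment f k (x + hk k) _ _ r x).
    - move=> y yr; have [|Ay hy] := hr y; first by rewrite -ball_normE /ball_ /= distrC.
      by split; [have [] := hf y Ay k|exact: hy].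
    - by rewrite addrC addKr.
    - by rewrite -E addrC addKr.
  have tel : f (x + h) - f x - L h =
      \sum_(k < N) (f (x + hk k.+1) - f (x + hk k) - h ord0 k * partial k f x).
    rewrite sumrB; congr (_ - _).
    rewrite -(big_mkord xpredT (fun k => f (x + hk k.+1) - f (x + hk k))).
    by rewrite (telescope_sumr (fun k => f (x + hk k)))// hkN hk0 addr0.
  rewrite (_ : (f \o +%R^~ x - (cst (f x) + L)) h = f (x + h) - f x - L h); last first.
    by rewrite !fctE /= opprD addrA [h + x]addrC.
  rewrite tel; apply: (le_trans (ler_norm_sum _ _ _)).
  apply: (@le_trans _ _ (\sum_(k < N) (`|h| * (e / N.+1%:R)))).
    apply: ler_sum => k _; apply: (le_trans (step k)).
    by rewrite ler_wpM2r ?(ltW e'0)// le_coord_norm.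
  rewrite sumr_const card_ord -[leLHS]mulr_natr -mulrA [leRHS]mulrC ler_wpM2l//.
  by rewrite mulrAC ler_pdivrMr// ler_wpM2l ?(ltW e0)// ler_nat.
have dE : 'd f x = LL :> (_ -> _) by exact: diff_unique.
have df : differentiable f x by apply/diff_locallyP; rewrite dE.
split => // v.
by rewrite deriveE// dE.
Qed.

End C1_differentiable.

Lemma is_derive_cvg (R : realType) (V : normedModType R) (f : V -> R) (x v : V) (l : R) :
  h^-1 *: (f (h *: v + x) - f x) @[h --> 0^'] --> l -> is_derive x v f l.
Proof.
move=> hl; split; first by apply/cvg_ex; exists l.
exact: cvg_lim hl.
Qed.

(** * Powers of the positive part *)

Section truncated_power.
Context (R : realType).
Implicit Types (t : R) (m : nat).

(** An exponent of at least 2 makes the one-sided derivatives agree at 0, where the difference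
    quotient is at most [|h|] for small [h]. *)
Lemma is_derive_maxrX m t :
  is_derive t 1 (fun s : R => Num.max 0 s ^+ m.+2) (m.+2%:R * Num.max 0 t ^+ m.+1).
Proof.
have [t0|t0|<-] := ltgtP 0 t.
- have dX : is_derive t 1 (fun s : R => s ^+ m.+2) (m.+2%:R * t ^+ m.+1).
    apply: DeriveDef; first exact: exprn_derivable.
    by rewrite exp_derive [_ *: _]mulr1.
  apply: near_eq_is_derive dX.
  near=> s; rewrite max_r// ltW//; near: s; exact: lt_nbhsr.
- rewrite expr0n mulr0; apply: (@near_eq_is_derive _ _ _ (cst 0)).
  near=> s; rewrite max_l ?expr0n// ltW//; near: s; exact: lt_nbhsl.
- rewrite expr0n mulr0; apply: is_derive_cvg.
  rewrite maxxx expr0n; apply/cvgrPdist_le => e e0.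
  near=> h.
  rewrite sub0r normrN subr0 [h *: 1]mulr1 addr0 [_ *: _]mulrC.
  have h0 : h != 0 by near: h; exact: nbhs_dnbhs_neq.
  have h1 : `|h| <= Num.min 1 e.
    near: h; apply: nbhs_dnbhs; apply/nbhs_ballP; exists (Num.min 1 e) => /=.
      by rewrite lt_min ltr01.
    by move=> h; rewrite /ball /= sub0r normrN => /ltW.
  rewrite normrM normfV ler_pdivrMr ?normr_gt0//.
  rewrite ger0_norm ?exprn_ge0 ?le_max ?lexx// exprS.
  have hm : Num.max 0 h <= `|h| by rewrite ge_max normr_ge0 ler_norm.
  have m0 : 0 <= Num.max 0 h by rewrite le_max lexx.
  rewrite le_min in h1; case/andP: h1 => h1 he.
  rewrite mulrC ler_pM ?exprn_ge0// exprS.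
  rewrite (le_trans _ he)// -[leRHS]mulr1 ler_pM ?exprn_ge0//.
  by rewrite exprn_ile1// (le_trans hm).
Unshelve. all: by end_near. Qed.

Lemma continuous_maxrX m : continuous (fun s : R => Num.max 0 s ^+ m).
Proof.
move=> s; apply: (@continuous_comp _ _ _ (fun s : R => Num.max 0 s) (fun s => s ^+ m)).
  rewrite (_ : (fun s => _) = fun s : R => 2^-1 * (s + `|s|)).
    apply: cvgM; first exact: cvg_cst.
    by apply: cvgD; [exact: cvg_id|exact: norm_continuous].
  apply/funext => r; case: (leP 0 r) => r0.
    by rewrite ger0_norm//; field.
  by rewrite ltr0_norm// subrr mulr0.
exact: exprn_continuous.
Qed.

End truncated_power.

(** * Calculus of C^1 functions and the cut-off functions *)

Section C1_functions.
Context (R : realType) (N : nat).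
Implicit Types (f g : 'rV[R]_N -> R) (x v : 'rV[R]_N).
Notation e_ i := (delta_mx ord0 i : 'rV[R]_N).

Lemma C1_on_continuous f : C1_on setT f -> continuous f.
Proof.
move=> hf x; have [df _] := C1_on_differentiable openT hf (I : setT x).
exact: differentiable_continuous df.
Qed.

Lemma C1_on_is_derive f x i : C1_on setT f -> is_derive x (e_ i) f (partial i f x).
Proof. by move=> hf; have [df _] := hf x I i; exact: derivableP. Qed.

Lemma C1_on_intro f (Df : 'I_N -> 'rV[R]_N -> R) :
  (forall x i, is_derive x (e_ i) f (Df i x)) ->
  (forall i x, {for x, continuous (Df i)}) ->
  C1_on setT f /\ forall i x, partial i f x = Df i x.
Proof.
move=> hf cf; have E i x : partial i f x = Df i x by have [_ <-] := hf x i.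
split => // x _ i; split; first by have [] := hf x i.
by rewrite (_ : partial i f = Df i) ?funeqE//; exact: cf.
Qed.

Lemma C1_on_mul f g : C1_on setT f -> C1_on setT g ->
  C1_on setT (fun x => f x * g x) /\
  forall i x, partial i (fun x => f x * g x) x = f x * partial i g x + g x * partial i f x.
Proof.
move=> hf hg; apply: (@C1_on_intro _ (fun i x => f x * partial i g x + g x * partial i f x)) => [x i|i x].
  have df := C1_on_is_derive x i hf; have dg := C1_on_is_derive x i hg.
  exact: (@is_deriveM R _ f g x (e_ i)).
have [_ cf] := hf x I i; have [_ cg] := hg x I i.
have ccf : {for x, continuous f} by exact: C1_on_continuous.
have ccg : {for x, continuous g} by exact: C1_on_continuous.
exact: (cvgD (cvgM ccf cg) (cvgM ccg cf)).
Qed.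

Lemma C1_on_comp (G dG : R -> R) f : (forall t : R, is_derive t 1 G (dG t)) ->
  continuous dG -> C1_on setT f ->
  C1_on setT (fun x => G (f x)) /\
  forall i x, partial i (fun x => G (f x)) x = dG (f x) * partial i f x.
Proof.
move=> hG cG hf; apply: (@C1_on_intro _ (fun i x => dG (f x) * partial i f x)) => [x i|i x].
  exact: is_derive_dcomp (hG (f x)) (C1_on_is_derive x i hf).
have [_ cf] := hf x I i.
have cGf : {for x, continuous (fun y => dG (f y))}.
  by apply: (@continuous_comp _ _ _ f dG); [exact: C1_on_continuous|exact: cG].
exact: cvgM cGf cf.
Qed.

Lemma C1c_intro f (r : R) : C1_on setT f -> (forall x, r < `|x| -> f x = 0) -> C1c f.
Proof.
move=> hf f0; split => //.
apply: (subclosed_compact _ (@compact_norm_ball R N r)); first exact: closed_closure.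
have cb : closed [set x : 'rV[R]_N | `|x| <= r].
  by apply: compact_closed; [exact: norm_hausdorff|exact: compact_norm_ball].
rewrite [X in _ `<=` X](closure_id _).1//; apply: closureS => x /= fx.
by rewrite leNgt; apply/negP => /f0 /eqP; apply/negP.
Qed.

Lemma dotvDZ_delta x i (s : R) :
  dotv (x + s *: e_ i) (x + s *: e_ i) = dotv x x + (2 * x ord0 i * s + s ^+ 2).
Proof.
rewrite /dotv (bigD1 i)//= [X in _ = X + _](bigD1 i)//=.
rewrite !mxE !eqxx mulr1 (eq_bigr (fun j => x ord0 j * x ord0 j)); first by ring.
by move=> j ji; rewrite !mxE eqxx (negbTE ji) mulr0 addr0.
Qed.

Lemma is_derive_dotv x i : is_derive x (e_ i) (fun x => dotv x x) (2 * x ord0 i).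
Proof.
apply: is_derive_cvg; apply: (@cvg_trans _ ((fun h : R => 2 * x ord0 i + h) @ 0^')).
  apply: near_eq_cvg; near=> h.
  have h0 : h != 0 by near: h; exact: nbhs_dnbhs_neq.
  rewrite [h *: _ + _]addrC dotvDZ_delta.
  rewrite -[RHS]/(h^-1 * (dotv x x + (2 * x ord0 i * h + h ^+ 2) - dotv x x)).
  by field.
have hl : 2 * x ord0 i + h @[h --> (0 : R)] --> 2 * x ord0 i + 0.
  by apply: cvgD; [exact: cvg_cst|exact: cvg_id].
rewrite addr0 in hl; exact: cvg_within_filter hl.
Unshelve. all: by end_near. Qed.

(** A family closed under what the proof needs: its gradient is expressed by a bump of lower power
    and its square is a bump ([sqr_bump]). It supplies both the cut-off functions and the mollifying
    kernels. *)
Definition bump m (a : R) x := Num.max 0 (a - dotv x x) ^+ m.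

Lemma continuous_dotv : continuous (fun x : 'rV[R]_N => dotv x x).
Proof.
move=> x; apply: (@cvg_fin_sum R _ (nbhs x) _ N (fun i (w : 'rV[R]_N) => w ord0 i * w ord0 i) (fun i => x ord0 i * x ord0 i)) => i.
apply: cvgM; exact: coord_continuous.
Qed.

Lemma C1_on_bump m a : C1_on setT (bump m.+2 a) /\
  forall i x, partial i (bump m.+2 a) x = m.+2%:R * bump m.+1 a x * (- (2 * x ord0 i)).
Proof.
apply: (@C1_on_intro _ (fun i x => m.+2%:R * bump m.+1 a x * (- (2 * x ord0 i)))) => [x i|i x].
  apply: (@is_derive_dcomp R _ (fun s => Num.max 0 s ^+ m.+2) (fun x => a - dotv x x)).
    exact: is_derive_maxrX.
  rewrite -[- (2 * _)]add0r; apply: is_deriveB; exact: is_derive_dotv.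
have h1 : {for x, continuous (fun y : 'rV[R]_N => y ord0 i)} by exact: coord_continuous.
have cc (c : R) : {for x, continuous (fun _ : 'rV[R]_N => c)} by exact: cst_continuous.
have hb : {for x, continuous (bump m.+1 a)}.
  apply: (@continuous_comp _ _ _ (fun x => a - dotv x x) (fun s => Num.max 0 s ^+ m.+1)).
    have hd : {for x, continuous (fun y : 'rV[R]_N => dotv y y)} by exact: continuous_dotv.
    exact: (cvgB (cc a) hd).
  exact: continuous_maxrX.
exact: (cvgM (cvgM (cc _) hb) (cvgN (cvgM (cc 2) h1))).
Qed.

Lemma sqr_bump m a x : bump m.+2 a x ^+ 2 = bump (m.*2.+2).+2 a x.
Proof. by rewrite /bump -exprM muln2 !doubleS. Qed.

Lemma bump_ge0 m a x : 0 <= bump m a x.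
Proof. by rewrite exprn_ge0// le_max lexx. Qed.

(** Compares the two norms in play: the cubes are balls of the sup norm, while the bumps are built
    on the Euclidean one. *)
Lemma sqr_norm_le_dotv x : `|x| ^+ 2 <= dotv x x.
Proof.
have d0 : 0 <= dotv x x by apply: sumr_ge0 => i _; rewrite -expr2 sqr_ge0.
rewrite -[leRHS]sqr_sqrtr// lerXn2r ?nnegrE ?sqrtr_ge0//.
apply: rV_norm_le => [|i]; first exact: sqrtr_ge0.
rewrite -sqrtr_sqr ler_wsqrtr// /dotv (bigD1 i)//= -expr2 lerDl.
by apply: sumr_ge0 => j _; rewrite -expr2 sqr_ge0.
Qed.

Lemma dotv_le_sqr_norm x : dotv x x <= N%:R * `|x| ^+ 2.
Proof.
apply: (@le_trans _ _ (\sum_(i < N) `|x| ^+ 2)).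
  apply: ler_sum => i _; rewrite -expr2 -real_normK ?num_real//.
  by rewrite lerXn2r ?nnegrE// le_coord_norm.
by rewrite sumr_const card_ord mulr_natl.
Qed.

Lemma bump_eq0 m (r : R) x : 0 <= r -> r <= `|x| -> bump m.+1 (r ^+ 2) x = 0.
Proof.
move=> r0 rx; rewrite /bump max_l ?expr0n// subr_le0.
by rewrite (le_trans _ (sqr_norm_le_dotv x))// lerXn2r ?nnegrE.
Qed.

Lemma bump_le m (r : R) x : bump m (r ^+ 2) x <= (r ^+ 2) ^+ m.
Proof.
have d0 : 0 <= dotv x x by apply: sumr_ge0 => i _; rewrite -expr2 sqr_ge0.
rewrite lerXn2r ?nnegrE ?sqr_ge0 ?le_max ?lexx//.
by rewrite ge_max sqr_ge0 lerBlDr lerDl.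
Qed.

End C1_functions.

(** * Mollification *)

Section real_integrals.
Context (R : realType) (n : nat).
Notation mu := (@lebesgue_rV R n).
Notation L1 f := (mu.-integrable [set: 'rV[R]_n] (EFin \o f)).
Implicit Types (f g : 'rV[R]_n -> R).

Lemma L1_measurable f : L1 f -> measurable_fun setT f.
Proof. by move=> /integrableP[/measurable_EFinP]. Qed.

Lemma L1_le f g : measurable_fun setT f -> (forall x, `|f x| <= g x) -> L1 g -> L1 f.
Proof.
move=> mf fg; apply: le_integrable => //; first exact/measurable_EFinP.
move=> x _; rewrite !abse_EFin lee_fin (le_trans (fg x))//; exact: ler_norm.
Qed.

Lemma L1D f g : L1 f -> L1 g -> L1 (fun x => f x + g x).
Proof. by move=> hf hg; exact: (integrableD measurableT hf hg). Qed.

Lemma L1B f g : L1 f -> L1 g -> L1 (fun x => f x - g x).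
Proof. by move=> hf hg; exact: (integrableB measurableT hf hg). Qed.

Lemma L1Z (c : R) f : L1 f -> L1 (fun x => c * f x).
Proof. by move=> hf; exact: (integrableZl measurableT c hf). Qed.

Lemma L1_norm f : L1 f -> L1 (fun x => `|f x|).
Proof.
move=> hf; have mf := L1_measurable hf; apply: le_integrable hf => //.
  by apply/measurable_EFinP; exact: measurableT_comp.
by move=> x _ /=; rewrite normr_id.
Qed.

Lemma L1_mul_bounded f g (M : R) : L1 f -> measurable_fun setT g ->
  (forall x, `|g x| <= M) -> L1 (fun x => f x * g x).
Proof.
move=> hf mg gM; apply: (@L1_le _ (fun x => M * `|f x|)).
- by apply: measurable_funM => //; exact: L1_measurable.
- by move=> x; rewrite normrM mulrC ler_wpM2r.
- exact/L1Z/L1_norm.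
Qed.

Lemma L1_ge0 f : measurable_fun setT f -> (forall x, 0 <= f x) ->
  (\int[mu]_x (f x)%:E < +oo)%E -> L1 f.
Proof.
move=> mf f0 foo; apply/integrableP; split; first exact/measurable_EFinP.
by under eq_integral do rewrite gee0_abs ?lee_fin//.
Qed.

Lemma L1_lty f : L1 f -> (\int[mu]_x (`|f x|)%:E < +oo)%E.
Proof. by move=> /integrableP[]. Qed.

Lemma EFin_Rintegral f : L1 f -> (\int[mu]_x f x)%:E = (\int[mu]_x (f x)%:E)%E.
Proof. by move=> hf; rewrite /Rintegral fineK//; exact: integrable_fin_num. Qed.

Lemma Rintegral_le_EFin f (e : R) : measurable_fun setT f -> (forall x, 0 <= f x) ->
  (\int[mu]_x (f x)%:E <= e%:E)%E -> \int[mu]_x f x <= e.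
Proof.
move=> mf f0 fe; have hf : L1 f by apply: L1_ge0 => //; exact: le_lt_trans fe (ltry _).
by rewrite -lee_fin EFin_Rintegral.
Qed.

Lemma Rintegral_translate (z : 'rV[R]_n) f : measurable_fun setT f ->
  \int[mu]_x f (x + z) = \int[mu]_x f x.
Proof.
move=> mf; rewrite /Rintegral integralE [in RHS]integralE; congr (fine (_ - _)%E).
  rewrite -[RHS](@ge0_integral_shift R n z ((EFin \o f)^\+%E)); first by apply: eq_integral => x _; rewrite !funeposE || rewrite !funenegE.
    by apply/measurable_funepos/measurable_EFinP.
  by move=> x; exact: funepos_ge0.
rewrite -[RHS](@ge0_integral_shift R n z ((EFin \o f)^\-%E)); first by apply: eq_integral => x _; rewrite !funeposE || rewrite !funenegE.
  by apply/measurable_funeneg/measurable_EFinP.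
by move=> x; exact: funeneg_ge0.
Qed.

Lemma L1_translate (z : 'rV[R]_n) f : L1 f -> L1 (translate z f).
Proof.
move=> hf; have mf := L1_measurable hf.
apply/integrableP; split; first by apply/measurable_EFinP; exact: measurable_translate.
have := L1_lty hf; rewrite -(ge0_integral_shift z)//.
by apply/measurable_EFinP; exact: measurableT_comp.
Qed.

Lemma L1_bounded_support f (r M : R) : measurable_fun setT f ->
  (forall x, `|f x| <= M) -> (forall x, r < `|x| -> f x = 0) -> L1 f.
Proof.
move=> mf fM fr.
pose K := [set x : 'rV[R]_n | `|x| <= r].
have mK : measurable K by exact: measurable_norm_ball.
apply: (@L1_le _ (fun x => M * \1_K x)) => //.
  move=> x; rewrite indicE; have [xK|xK] := pselect (K x).
    by rewrite mem_set// mulr1.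
  by rewrite memNset// mulr0 fr ?normr0//; rewrite ltNge; apply/negP.
apply: L1Z; apply: L1_ge0 => //.
rewrite integral_indic// setIT.
by apply: lebesgue_rV_compact_lty; exact: compact_norm_ball.
Qed.

End real_integrals.

(** * Correlation with a kernel *)

Section correlation.
Context (R : realType) (n : nat).
Notation mu := (@lebesgue_rV R n).
Notation L1 f := (mu.-integrable [set: 'rV[R]_n] (EFin \o f)).
Notation e_ i := (delta_mx ord0 i : 'rV[R]_n).
Implicit Types (f g psi : 'rV[R]_n -> R) (x z : 'rV[R]_n).

(** A correlation rather than a convolution: the kernel enters as its translate [psi (y - x)], which
    is directly a test function of [y]. *)
Definition corr f psi x : R := \int[mu]_y (f y * psi (y - x)).

Lemma L1_corr f psi (M : R) x : L1 f -> measurable_fun setT psi ->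
  (forall x, `|psi x| <= M) -> L1 (fun y => f y * psi (y - x)).
Proof.
move=> hf mpsi hM; apply: (@L1_mul_bounded _ _ _ (fun y => psi (y - x)) M) => //.
exact: (measurable_translate (- x) mpsi).
Qed.

Lemma corrE f psi x : measurable_fun setT f -> measurable_fun setT psi ->
  corr f psi x = \int[mu]_z (f (z + x) * psi z).
Proof.
move=> mf mpsi; rewrite /corr -(Rintegral_translate x); last first.
  by apply: measurable_funM => //; exact: (measurable_translate (- x) mpsi).
by apply: eq_Rintegral => z _; rewrite addrK.
Qed.

(** Translating the integral moves the increment of [x] from the kernel to [f]; what remains is [M]
    times the L^1 distance between [f] and a translate. *)
Lemma continuous_corr f psi (M : R) x : L1 f -> translation_continuous 1 f ->
  measurable_fun setT psi -> (forall x, `|psi x| <= M) -> {for x, continuous (corr f psi)}.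
Proof.
move=> hf tf mpsi hM; have mf := L1_measurable hf.
have M0 : 0 <= M by rewrite (le_trans _ (hM 0)).
apply/(@cvgrPdist_le _ _ _ (nbhs x)) => e e0.
have eM0 : 0 < e / (M + 1) by rewrite divr_gt0// ltr_wpDl.
have [d d0 hd] := tf _ eM0.
apply/nbhs_ballP; exists d => //= y; rewrite -ball_normE /ball_ /= => xy.
rewrite distrC; pose h := y - x.
have hh : `|h| < d by rewrite /h distrC.
have -> : corr f psi y = \int[mu]_z (translate h f z * psi (z - x)).
  rewrite /corr -(Rintegral_translate h); last first.
    by apply: measurable_funM => //; exact: (measurable_translate (- y) mpsi).
  apply: eq_Rintegral => z _; congr (_ * psi _).
  by rewrite /h addrA [_ - x - y]addrAC addrK.
have hT := L1_translate h hf.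
rewrite /corr -RintegralB//; [|exact: (@L1_corr (translate h f) psi M)|exact: (@L1_corr _ _ M)].
have hD : L1 (fun z => translate h f z * psi (z - x) - f z * psi (z - x)).
  by apply: L1B; exact: (@L1_corr _ _ M).
apply: (le_trans (le_normr_Rintegral _ hD)) => //.
have hfe : \int[mu]_z `|translate h f z - f z| <= e / (M + 1).
  apply: Rintegral_le_EFin => //.
    by apply: measurableT_comp => //; apply: measurable_funB => //; exact: measurable_translate.
  apply: le_trans (hd _ hh); rewrite /pdist.
  by under [leRHS]eq_integral do rewrite powRr1//.
apply: (@le_trans _ _ (\int[mu]_z (M * `|translate h f z - f z|))).
  apply: le_Rintegral => //; first exact: L1_norm.
    by apply: L1Z; apply: L1_norm; exact: L1B.
  move=> z _; rewrite -mulrBl normrM mulrC ler_wpM2r//.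
rewrite RintegralZl//; last by apply: L1_norm; exact: L1B.
apply: (@le_trans _ _ (M * (e / (M + 1)))); first by rewrite ler_wpM2l.
by rewrite mulrCA ger_pMr// ler_pdivrMr ?ltr_wpDl// mul1r lerDl.
Qed.

(** Differentiation under the integral with majorant [|f| * M']; the sign comes from the argument
    [y - x] of the kernel. *)
Lemma is_derive_corr f psi (M M' : R) x i : L1 f -> C1_on setT psi ->
  (forall x, `|psi x| <= M) -> (forall x, `|partial i psi x| <= M') ->
  is_derive x (e_ i) (corr f psi) (- corr f (partial i psi) x).
Proof.
move=> hf hpsi hM hM'.
have mf := L1_measurable hf.
have mpsi : measurable_fun setT psi by apply: continuous_measurable_rV; exact: C1_on_continuous.
apply: is_derive_line0.
pose F (s : R) y := f y * psi (y - x + (- s) *: e_ i).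
pose DF (s : R) y := f y * - partial i psi (y - x + (- s) *: e_ i).
have dF (s : R) y : is_derive s 1 (F^~ y) (DF s y).
  have h1 : is_derive (- s) 1 (fun t : R => psi (y - x + t *: e_ i)) (partial i psi (y - x + (- s) *: e_ i)).
    by apply: is_derive_line; exact: C1_on_is_derive.
  have h2 : is_derive s 1 (fun t : R => - t) (- 1) by apply: is_deriveN.
  have h3 : is_derive s 1 (fun t : R => psi (y - x + (- t) *: e_ i)) (- partial i psi (y - x + (- s) *: e_ i)).
    have := @is_derive1_comp R (fun t : R => psi (y - x + t *: e_ i)) (fun t : R => - t) s _ _ h1 h2.
    by rewrite mulrN1.
  exact: (@is_deriveZ R R R (fun t : R => psi (y - x + (- t) *: e_ i)) (f y) s 1 _ h3).
have mDpsi : measurable_fun setT (partial i psi).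
  by apply: continuous_measurable_rV => y; have [] := hpsi y I i.
have FE s : corr f psi (x + s *: e_ i) = \int[mu]_y F s y.
  by apply: eq_Rintegral => y _; rewrite /F opprD addrA scaleNr.
have hF (s : R) : L1 (F s).
  have := L1_corr (x + s *: e_ i) hf mpsi hM.
  by under eq_fun do rewrite opprD addrA -scaleNr.
apply: is_derive_cvg.
have := @cvg_differentiation_under_integral R _ _ mu F setT measurableT 0 (-1) 1 _ _ _ (fun y => `|f y| * M') _ _ _.
have -> : \int[mu]_y partial1of2 F 0 y = - corr f (partial i psi) x.
  rewrite /corr -mulN1r -RintegralZl//; last exact: (@L1_corr _ _ M').
  apply: eq_Rintegral => y _; rewrite partial1of2E; have [_ ->] := dF 0 y.
  by rewrite /DF oppr0 scale0r addr0 mulN1r mulrN.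
move=> H; apply: cvg_trans; last apply: H.
- apply: near_eq_cvg; near=> h; congr (_ *: (_ - _)).
    by rewrite FE [h *: 1]mulr1.
  by rewrite FE.
- by rewrite /= in_itv /= ltrN10 ltr01.
- by [].
- by move=> s y _ _; have [] := dF s y.
- by move=> y; rewrite mulr_ge0// (le_trans _ (hM' 0)).
- under eq_fun do rewrite mulrC; apply: L1Z; exact: L1_norm.
- move=> s y _ _; rewrite partial1of2E; have [_ ->] := dF s y.
  by rewrite /DF normrM normrN ler_wpM2l.
Unshelve. all: by end_near. Qed.

End correlation.

(** * Jensen's inequality and L^p distance to an average of translates *)

Section jensen.
Context (R : realType) (n : nat).
Notation mu := (@lebesgue_rV R n).
Notation L1 f := (mu.-integrable [set: 'rV[R]_n] (EFin \o f)).
Implicit Types (f g k D : 'rV[R]_n -> R) (x z : 'rV[R]_n).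

(** The graph of [t ^ p] lies above its tangent at [s]. This is Young's inequality for [t] and
    [s ^ (p - 1)] with exponents [p] and [p / (p - 1)]. *)
Lemma powR_tangent (p s t : R) : 1 < p -> 0 < s -> 0 <= t ->
  p * s `^ (p - 1) * t <= t `^ p + (p - 1) * s `^ p.
Proof.
move=> p1 s0 t0.
have p0 : 0 < p by rewrite (lt_trans ltr01).
have p10 : 0 < p - 1 by rewrite subr_gt0.
have q0 : 0 < p / (p - 1) by rewrite divr_gt0.
have e1 : p^-1 + (p / (p - 1))^-1 = 1.
  by field; rewrite ?gt_eqF.
have := conjugate_powR t0 (powR_ge0 s (p - 1)) p0 q0 e1.
have -> : (s `^ (p - 1)) `^ (p / (p - 1)) = s `^ p.
  by rewrite -powRrM; congr (_ `^ _); field; rewrite gt_eqF.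
move=> h; have := ler_wpM2l (ltW p0) h.
rewrite (_ : p * s `^ (p - 1) * t = p * (t * s `^ (p - 1))); last by ring.
move=> h'; apply: (le_trans h').
apply: eq_ler; field.
by rewrite !gt_eqF.
Qed.

(** The tangent inequality taken at the mean value [s] and integrated against [k]. The right side is
    an extended real since it may be infinite. *)
Lemma jensen_powR (p c : R) D k : 1 < p -> measurable_fun setT D ->
  (forall x, 0 <= D x) -> (forall x, 0 <= k x) -> L1 k ->
  \int[mu]_x k x = c -> 0 < c -> L1 (fun x => D x * k x) ->
  (((c^-1 * \int[mu]_x (D x * k x)) `^ p)%:E <=
    (c^-1)%:E * \int[mu]_x (D x `^ p * k x)%:E)%E.
Proof.
move=> p1 mD D0 k0 hk kc c0 hDk.
have mk := L1_measurable hk.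
have p0 : 0 < p by rewrite (lt_trans ltr01).
have mDp : measurable_fun setT (fun x => D x `^ p * k x).
  by apply: measurable_funM => //; exact: (measurableT_comp (measurable_powR _)).
have [hoo|hoo] := ltP (\int[mu]_x (D x `^ p * k x)%:E)%E +oo%E; last first.
  move: hoo; rewrite leye_eq => /eqP ->.
  by rewrite gt0_muley ?lte_fin ?invr_gt0// leey.
have hDp : L1 (fun x => D x `^ p * k x).
  by apply: L1_ge0 => // x; rewrite mulr_ge0 ?powR_ge0.
rewrite -EFin_Rintegral// -EFinM lee_fin.
set I := \int[mu]_x (D x * k x); set J := \int[mu]_x (D x `^ p * k x).
have J0 : 0 <= J by apply: Rintegral_ge0 => x _; rewrite mulr_ge0 ?powR_ge0.
have I0 : 0 <= I by apply: Rintegral_ge0 => x _; rewrite mulr_ge0.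
pose s := c^-1 * I.
have s0 : 0 <= s by rewrite mulr_ge0// invr_ge0 ltW.
rewrite -/s; move: s0; rewrite le_eqVlt => /predU1P[s0|s0].
  by rewrite -s0 powR0 ?gt_eqF// mulr_ge0// invr_ge0 ltW.
have key : p * s `^ (p - 1) * I <= J + (p - 1) * s `^ p * c.
  rewrite -kc /I /J -!RintegralZl// -RintegralD//; last exact: L1Z.
  apply: le_Rintegral => //; first exact: L1Z.
    by apply: L1D => //; exact: L1Z.
  move=> x _; rewrite mulrA -mulrDl ler_wpM2r//.
  exact: powR_tangent.
have Es : s `^ (p - 1) * s = s `^ p.
  rewrite -[X in _ * X](powRr1 (ltW s0)) -powRD; last by rewrite (gt_eqF s0) implybT.
  by rewrite subrK.
have EI : I = c * s by rewrite /s mulrA divff ?gt_eqF// mul1r.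
rewrite ler_pdivlMl//.
have E : c * s `^ p = p * s `^ (p - 1) * I - (p - 1) * s `^ p * c by rewrite EI -Es; ring.
by rewrite E lerBlDr.
Qed.

(** The error is an average of differences between translates of [g] and [g]. Jensen moves the power
    inside the average, and Tonelli leaves an average of p-distances over the support of [k]. *)
Lemma pdist_mollify (p c e d M : R) g k : 1 < p -> L1 g ->
  measurable_fun setT (corr g k) -> (forall x, 0 <= k x) -> (forall x, k x <= M) -> L1 k -> 0 <= e ->
  \int[mu]_x k x = c -> 0 < c -> (forall x, k x != 0 -> `|x| < d) ->
  (forall z, `|z| < d -> (pdist p (translate z g) g <= e%:E)%E) ->
  (pdist p (fun x => c^-1 * corr g k x)%R g <= e%:E)%E.
Proof.
move=> p1 hg mc k0 kM hk e0 kc c0 kd hd.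
have p0 : 0 < p by rewrite (lt_trans ltr01).
have mk := L1_measurable hk; have mg := L1_measurable hg.
have k_abs x : `|k x| <= M by rewrite ger0_norm.
pose F (xz : 'rV[R]_n * 'rV[R]_n) : \bar R := (`|g (xz.1 + xz.2) - g xz.1| `^ p * k xz.2)%:E.
have mF : measurable_fun setT F.
  apply/measurable_EFinP; apply: measurable_funM; last exact: measurableT_comp.
  apply: (measurableT_comp (measurable_powR _)); apply: measurableT_comp => //.
  apply: measurable_funB; last exact: measurableT_comp.
  apply: (measurableT_comp mg); apply: measurable_fun_rVP => i.
  rewrite (_ : _ \o _ = fun xz : 'rV[R]_n * 'rV[R]_n => (rV_coord i xz.1 : R) + rV_coord i xz.2).
    by apply: measurable_funD; apply: measurableT_comp => //; exact: measurable_rV_coord.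
  by apply/funext => xz /=; rewrite /rV_coord mxE.
have F0 xz : (0 <= F xz)%E by rewrite lee_fin mulr_ge0 ?powR_ge0.
have mI : measurable_fun setT (fun x => \int[mu]_z F (x, z))%E.
  by apply: (measurable_fun_fubini_tonelli_F F) => //.
have pt x : ((`|c^-1 * corr g k x - g x| `^ p)%:E <= (c^-1)%:E * \int[mu]_z F (x, z))%E.
  have mT : measurable_fun setT (fun z => g (x + z)).
    by have := measurable_translate x mg; rewrite /translate; under eq_fun do rewrite addrC.
  have mD : measurable_fun setT (fun z => `|g (x + z) - g x|).
    by apply: measurableT_comp => //; exact: measurable_funB.
  have hT : L1 (fun z => g (x + z)).
    by have := L1_translate x hg; rewrite /translate; under eq_fun do rewrite addrC.
  have hTk : L1 (fun z => g (x + z) * k z) by exact: L1_mul_bounded hT mk k_abs.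
  have hDk : L1 (fun z => (g (x + z) - g x) * k z).
    under eq_fun do rewrite mulrBl; apply: L1B => //; exact: L1Z.
  have hDk' : L1 (fun z => `|g (x + z) - g x| * k z).
    have := L1_norm hDk; under eq_fun do rewrite normrM (ger0_norm (k0 _)); exact.
  have := jensen_powR p1 mD (fun=> normr_ge0 _) k0 hk kc c0 hDk'.
  apply: le_trans; rewrite lee_fin ge0_ler_powR ?nnegrE ?(ltW p0)//.
    by rewrite mulr_ge0 ?invr_ge0 ?(ltW c0)//; apply: Rintegral_ge0 => z _; rewrite mulr_ge0.
  have -> : c^-1 * corr g k x - g x = c^-1 * \int[mu]_z ((g (x + z) - g x) * k z).
    rewrite (eq_Rintegral _ (g := fun z => g (x + z) * k z - g x * k z)); last first.
      by move=> z _; rewrite mulrBl.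
    rewrite RintegralB//; last exact: L1Z.
    rewrite RintegralZl// kc mulrBr mulrCA mulVf ?gt_eqF// mulr1 corrE//; congr (_ * _ - _).
    by apply: eq_Rintegral => z _; rewrite addrC.
  rewrite normrM gtr0_norm ?invr_gt0// ler_wpM2l ?invr_ge0 ?(ltW c0)//.
  apply: le_trans (le_normr_Rintegral _ hDk) _ => //.
  apply: eq_ler; apply: eq_Rintegral => z _.
  by rewrite normrM (ger0_norm (k0 _)).
rewrite /pdist.
apply: (@le_trans _ _ (\int[mu]_x ((c^-1)%:E * \int[mu]_z F (x, z)))%E).
  apply: ge0_le_integral => //.
  - by apply: measurable_powR_dist => //; exact: measurable_funM.
  - exact: emeasurable_funM.
rewrite ge0_integralZl_EFin ?invr_ge0 ?(ltW c0)//; last first.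
  by move=> x _; apply: integral_ge0.
rewrite (fubini_tonelli F mF F0).
apply: (@le_trans _ _ ((c^-1)%:E * \int[mu]_z (e%:E * (k z)%:E))%E).
  rewrite lee_wpmul2l ?lee_fin ?invr_ge0 ?(ltW c0)//.
  apply: ge0_le_integral => //.
  - by move=> z _; apply: integral_ge0.
  - by apply: (measurable_fun_fubini_tonelli_G F) => //.
  - by apply: emeasurable_funM => //; exact/measurable_EFinP.
  - move=> z _; rewrite /F /=.
    under eq_integral do rewrite EFinM muleC.
    rewrite ge0_integralZl_EFin//; last exact: measurable_powR_dist (measurable_translate z mg) mg.
    have [->|kz] := eqVneq (k z) 0; first by rewrite mul0e mule0.
    by rewrite muleC lee_wpmul2r ?lee_fin//; exact: hd (kd _ kz).
rewrite ge0_integralZl_EFin//; last 2 first.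
- by move=> x _; rewrite lee_fin.
- exact/measurable_EFinP.
rewrite -EFin_Rintegral// kc -!EFinM lee_fin mulrCA mulVf ?mulr1//.
by rewrite gt_eqF.
Qed.

End jensen.

(** * The mollifier *)

Section mollification.
Context (R : realType) (n : nat).
Notation mu := (@lebesgue_rV R n).
Notation L1 f := (mu.-integrable [set: 'rV[R]_n] (EFin \o f)).
Notation e_ i := (delta_mx ord0 i : 'rV[R]_n).
Implicit Types (f g : 'rV[R]_n -> R) (x z : 'rV[R]_n) (j : nat).

Lemma measurable_bump m a : measurable_fun setT (@bump R n m a).
Proof.
apply: continuous_measurable_rV => x.
apply: (@continuous_comp _ _ _ (fun x => a - dotv x x) (fun s => Num.max 0 s ^+ m)).
  have hd : {for x, continuous (fun y : 'rV[R]_n => dotv y y)} by exact: continuous_dotv.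
  have hc : {for x, continuous (fun _ : 'rV[R]_n => a)} by exact: cst_continuous.
  exact: (cvgB hc hd).
exact: continuous_maxrX.
Qed.

Lemma L1_bump m (r : R) : 0 <= r -> L1 (bump m.+1 (r ^+ 2)).
Proof.
move=> r0; apply: (@L1_bounded_support R n _ r ((r ^+ 2) ^+ m.+1)).
- exact: measurable_bump.
- by move=> x; rewrite ger0_norm ?bump_ge0 ?bump_le.
- by move=> x rx; rewrite bump_eq0// ltW.
Qed.

Lemma Rintegral_bump_gt0 m (r : R) : 0 < r ->
  0 < \int[mu]_x bump m.+1 (r ^+ 2) x.
Proof.
(* On the cube of half-side [d] the squared Euclidean norm is at most [n * d ^ 2 <= r ^ 2 / 2],
   which keeps the bump above the constant [b] below. *)
move=> r0; pose d : R := r / (2 * n.+1%:R).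
have d0 : 0 < d by rewrite divr_gt0.
pose K := [set x : 'rV[R]_n | `|x| <= d].
have mK : measurable K by exact: measurable_norm_ball.
have muK : mu K = ((2 * d) ^+ n)%:E by exact: lebesgue_rV_cube (ltW d0).
have hK : L1 \1_K.
  apply: L1_ge0 => //; rewrite integral_indic// setIT.
  by rewrite -[X in (X < _)%E]/(mu K) muK ltry.
pose b : R := (r ^+ 2 / 2) ^+ m.+1.
have b0 : 0 < b by rewrite exprn_gt0// divr_gt0// exprn_gt0.
apply: (@lt_le_trans _ _ (\int[mu]_x (b * \1_K x))).
  rewrite RintegralZl// mulr_gt0// -lte_fin EFin_Rintegral// integral_indic// setIT.
  by rewrite -[X in (_ < X)%E]/(mu K) muK lte_fin exprn_gt0// mulr_gt0.
apply: le_Rintegral => //; [exact: L1Z|exact: L1_bump (ltW r0)|].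
move=> x _; rewrite indicE; have [xK|xK] := pselect (K x); last first.
  by rewrite memNset// mulr0 bump_ge0.
rewrite mem_set// mulr1 /b /bump lerXn2r ?nnegrE ?le_max ?lexx//.
  by rewrite divr_ge0// sqr_ge0.
rewrite orbC; apply/orP; left.
rewrite lerBrDl -lerBrDr; apply: (le_trans (dotv_le_sqr_norm x)).
apply: (@le_trans _ _ (n%:R * d ^+ 2)).
  by rewrite ler_wpM2l// lerXn2r ?nnegrE// ltW.
have -> : r ^+ 2 - r ^+ 2 / 2 = r ^+ 2 / 2 by field.
rewrite /d expr_div_n mulrCA ler_wpM2l ?sqr_ge0//.
rewrite ler_pdivrMr ?exprn_gt0 ?mulr_gt0// exprMn.
have -> : 2^-1 * (2 ^+ 2 * n.+1%:R ^+ 2) = 2 * n.+1%:R ^+ 2 :> R by field.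
have h1 : n%:R <= n.+1%:R :> R by rewrite ler_nat.
have h2 : 1 <= n.+1%:R :> R by rewrite ler1n.
nra.
Qed.

(** The power 2 is the least one for which a bump is C^1. The kernel is not normalised; [moll]
    divides by its integral. *)
Definition molk j : 'rV[R]_n -> R := bump 2 ((j.+1%:R^-1) ^+ 2).

Definition moll j f x : R := (\int[mu]_y molk j y)^-1 * corr f (molk j) x.

Let rj0 j : 0 < j.+1%:R^-1 :> R. Proof. by rewrite invr_gt0. Qed.

Lemma partial_molk_bound j i x : `|partial i (molk j) x| <= 4.
Proof.
have [_ ->] := @C1_on_bump R n 0 (j.+1%:R^-1 ^+ 2).
have [rx|xr] := leP (j.+1%:R^-1) `|x|.
  by rewrite bump_eq0 ?(ltW (rj0 j))// mulr0 mul0r normr0.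
rewrite normrM normrN !normrM !normr_nat.
have j1 : j.+1%:R^-1 <= 1 :> R by rewrite invf_le1// ler1n.
have h1 : `|bump 1 (j.+1%:R^-1 ^+ 2) x| <= 1.
  rewrite ger0_norm ?bump_ge0// (le_trans (bump_le _ _ _))//.
  by rewrite expr1 exprn_ile1// ltW.
have h2 : `|x ord0 i| <= 1.
  by rewrite (le_trans (le_coord_norm _ _))// (le_trans (ltW xr)).
have h3 := normr_ge0 (bump 1 (j.+1%:R^-1 ^+ 2) x).
have h4 := normr_ge0 (x ord0 i).
nra.
Qed.

Lemma molk_bound j x : `|molk j x| <= (j.+1%:R^-1 ^+ 2) ^+ 2.
Proof. by rewrite ger0_norm ?bump_ge0 ?bump_le. Qed.

Lemma molk_support j x : molk j x != 0 -> `|x| < j.+1%:R^-1.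
Proof. by rewrite ltNge; apply: contra => jx; rewrite /molk bump_eq0// ltW. Qed.

(** On the ball that carries [f], [|f|] is at most [1 + |f| ^ p]. *)
Lemma Lp_L1 (p r : R) f : 1 <= p -> measurable_fun setT f ->
  (forall x, r < `|x| -> f x = 0) -> (\int[mu]_x (`|f x| `^ p)%:E < +oo)%E -> L1 f.
Proof.
move=> p1 mf fr fp.
have mfp : measurable_fun setT (fun x => `|f x| `^ p).
  by apply: (measurableT_comp (measurable_powR _)); exact: measurableT_comp.
have hp : L1 (fun x => `|f x| `^ p).
  by apply: L1_ge0 => // x; exact: powR_ge0.
pose K := [set x : 'rV[R]_n | `|x| <= r].
have mK : measurable K by exact: measurable_norm_ball.
have hK : L1 \1_K.
  apply: (@L1_bounded_support R n _ r 1) => //.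
    by move=> x; rewrite indicE; case: (_ \in _); rewrite ?normr1 ?normr0.
  by move=> x rx; rewrite indicE memNset//= => /(lt_le_trans rx); rewrite ltxx.
apply: L1_le (L1D hK hp) => // x; rewrite indicE.
have [xK|xK] := pselect (K x); last first.
  by rewrite memNset// fr ?normr0 ?add0r ?powR_ge0//; rewrite ltNge; apply/negP.
rewrite mem_set//=; have [h|h] := leP `|f x| 1; first by rewrite ler_wpDr ?powR_ge0.
by rewrite ler_wpDl//; apply: le1r_powR => //; exact: ltW.
Qed.

Lemma Lp_translation_continuous (p r : R) f : 1 <= p -> measurable_fun setT f ->
  (forall x, r < `|x| -> f x = 0) -> (\int[mu]_x (`|f x| `^ p)%:E < +oo)%E ->
  translation_continuous p f.
Proof.
move=> p1 mf fr fp.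
apply: (@translation_continuous_Lp R n p [set x | `|x| < `|r| + 1]) => //.
- by rewrite (lt_le_trans ltr01).
- rewrite (_ : [set x : 'rV[R]_n | _] = (fun x : 'rV[R]_n => `|x|) @^-1` [set y | y < `|r| + 1]) //.
  apply: open_comp; last exact: open_lt.
  by move=> x _; exact: norm_continuous.
- apply: (@le_lt_trans _ _ (mu [set x : 'rV[R]_n | `|x| <= `|r| + 1])).
    apply: le_measure; rewrite ?inE; last by move=> x /ltW.
      apply: open_measurable_rV.
      rewrite (_ : [set x : 'rV[R]_n | _] = (fun x : 'rV[R]_n => `|x|) @^-1` [set y | y < `|r| + 1]) //.
      apply: open_comp; last exact: open_lt.
      by move=> x _; exact: norm_continuous.
    exact: measurable_norm_ball.
  by rewrite lebesgue_rV_cube ?ltry// addr_ge0.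
- move=> x /negP; rewrite -leNgt => rx; apply: fr.
  by rewrite (lt_le_trans _ rx)// (le_lt_trans (ler_norm r))// ltrDl.
Qed.

Lemma pdist_moll (p r e : R) f : 1 < p -> measurable_fun setT f ->
  (forall x, r < `|x| -> f x = 0) -> (\int[mu]_x (`|f x| `^ p)%:E < +oo)%E -> 0 < e ->
  exists J, forall j, (J <= j)%N -> (pdist p (moll j f) f <= e%:E)%E.
Proof.
move=> p1 mf fr fp e0.
have hf := Lp_L1 (ltW p1) mf fr fp.
have t1 : translation_continuous 1 f.
  apply: (@Lp_translation_continuous 1 r) => //.
  by under eq_integral do rewrite powRr1//; exact: L1_lty.
have [d d0 hd] := Lp_translation_continuous (ltW p1) mf fr fp e0.
exists (Num.truncn (d^-1)) => j Jj.
have jd : j.+1%:R^-1 <= d.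
  rewrite -[leRHS]invrK lef_pV2 ?posrE ?invr_gt0//.
  by rewrite (le_trans (ltW (truncnS_gt _)))// ler_nat.
apply: (@pdist_mollify R n p _ e (j.+1%:R^-1) ((j.+1%:R^-1 ^+ 2) ^+ 2)) => //.
- apply: continuous_measurable_rV => x.
  exact: (continuous_corr hf t1 (measurable_bump _ _) (molk_bound j)).
- by move=> x; exact: bump_ge0.
- by move=> x; exact: bump_le.
- exact: L1_bump (ltW (rj0 j)).
- exact: ltW.
- exact: Rintegral_bump_gt0 (rj0 j).
- exact: molk_support.
- by move=> z zj; apply: hd; exact: lt_le_trans jd.
Qed.

Lemma moll_le (M : R) j f x : L1 f -> (forall x, `|f x| <= M) -> `|moll j f x| <= M.
Proof.
move=> hf fM; have c0 := Rintegral_bump_gt0 1 (rj0 j).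
have hk : L1 (molk j) by exact: L1_bump (ltW (rj0 j)).
have hkx : L1 (fun y => molk j (y - x)) := L1_translate (- x) hk.
have h := L1_corr x hf (measurable_bump _ _) (molk_bound j).
rewrite normrM gtr0_norm ?invr_gt0// ler_pdivrMl// mulrC.
apply: le_trans (le_normr_Rintegral _ h) _ => //.
rewrite -(Rintegral_translate (- x) (measurable_bump _ _)) -RintegralZl//.
apply: le_Rintegral => //; [exact: L1_norm|exact: L1Z|].
move=> y _; rewrite normrM (ger0_norm (bump_ge0 _ _ _)) ler_wpM2r//; exact: bump_ge0.
Qed.

Lemma C1_on_moll (M r : R) j f : measurable_fun setT f -> (forall x, `|f x| <= M) ->
  (forall x, r < `|x| -> f x = 0) ->
  C1_on setT (moll j f) /\ forall i x,
    partial i (moll j f) x = - (\int[mu]_y molk j y)^-1 * corr f (partial i (molk j)) x.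
Proof.
move=> mf fM fr.
have hf : L1 f by exact: L1_bounded_support mf fM fr.
have t1 : translation_continuous 1 f.
  apply: (@Lp_translation_continuous 1 r) => //.
  by under eq_integral do rewrite powRr1//; exact: L1_lty.
have [hk _] := @C1_on_bump R n 0 (j.+1%:R^-1 ^+ 2).
apply: (@C1_on_intro R n _ (fun i x => - (\int[mu]_y molk j y)^-1 * corr f (partial i (molk j)) x)) => [x i|i x].
  rewrite mulNr -mulrN.
  have h := @is_derive_corr R n f (molk j) _ _ x i hf hk (molk_bound j) (partial_molk_bound j i).
  exact: (@is_deriveZ R 'rV[R]_n R (corr f (molk j)) ((\int[mu]_y molk j y)^-1) x (e_ i) _ h).
have mp : measurable_fun setT (partial i (molk j)).
  by apply: continuous_measurable_rV => y; have [] := hk y I i.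
have h := continuous_corr (x := x) hf t1 mp (partial_molk_bound j i).
have hc : {for x, continuous (fun _ : 'rV[R]_n => - (\int[mu]_y molk j y)^-1)} by exact: cst_continuous.
exact: (cvgM hc h).
Qed.

End mollification.

(** * Domination of a fast sequence, and mollified weak gradients *)

Section approximation.
Context (R : realType) (n : nat).
Notation mu := (@lebesgue_rV R n).
Notation L1 f := (mu.-integrable [set: 'rV[R]_n] (EFin \o f)).
Notation e_ i := (delta_mx ord0 i : 'rV[R]_n).
Implicit Types (f g u : 'rV[R]_n -> R) (x z : 'rV[R]_n) (j : nat).

(** The series of the [F m] has integral at most 1, so its sum is finite almost everywhere. That sum
    dominates every term, and convergence of the series sends the terms to 0. *)
Lemma summable_dominated (F : nat -> 'rV[R]_n -> R) :
  (forall m, measurable_fun setT (F m)) -> (forall m x, 0 <= F m x) ->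
  (forall m, (\int[mu]_x (F m x)%:E <= (1 / (2 ^ m.+1)%:R)%:E)%E) ->
  exists h, [/\ L1 h, (forall x, 0 <= h x) &
    {ae mu, forall x, F m x @[m --> \oo] --> (0 : R) /\ forall m, F m x <= h x}].
Proof.
move=> mF F0 hF.
pose S x : \bar R := (\sum_(0 <= m <oo) (F m x)%:E)%E.
have mFE m : measurable_fun setT (fun x => (F m x)%:E) by exact/measurable_EFinP.
have F0' m x : (0 <= (F m x)%:E)%E by rewrite lee_fin.
have S0 x : (0 <= S x)%E by apply: nneseries_ge0.
have mS : measurable_fun setT S by apply: ge0_emeasurable_sum.
have iS : (\int[mu]_x S x <= 1%:E)%E.
  rewrite /S integral_nneseries//.
  apply: le_trans (@epsilon_trick0 R 1 xpredT ler01).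
  by apply: lee_nneseries => // m _ _; exact: integral_ge0.
have intS : mu.-integrable setT S.
  apply/integrableP; split => //.
  under eq_integral do rewrite gee0_abs//.
  exact: le_lt_trans iS (ltry _).
exists (fine \o S); split.
- apply: L1_ge0.
  + exact: (measurableT_comp (@fine_measurable R setT measurableT)).
  + by move=> x; exact: fine_ge0.
  + apply: le_lt_trans (ltry 1); apply: le_trans iS.
    apply: ge0_le_integral => //.
    * by move=> x _; rewrite lee_fin; exact: fine_ge0.
    * by apply/measurable_EFinP; exact: (measurableT_comp (@fine_measurable R setT measurableT)).
    * by move=> x _ /=; have := S0 x; case: (S x) => //= r; rewrite ?leey.
- by move=> x; exact: fine_ge0.
have := integrable_ae measurableT intS; apply: filterS => x /(_ I) Sfin.
have Sr : S x = (fine (S x))%:E by rewrite fineK.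
split; last first.
  move=> m; rewrite -lee_fin -Sr.
  have := @nneseries_lim_ge R (fun m => (F m x)%:E) xpredT 0 m.+1 (fun k _ _ => F0' k x).
  apply: le_trans; rewrite big_nat_recr//= leeDr//.
  by apply: sume_ge0.
have tail : (\sum_(N <= k <oo) (F k x)%:E)%E @[N --> \oo] --> (0 : \bar R)%E.
  apply: (@nneseries_tail_cvg R (fun m => (F m x)%:E) xpredT) => //.
  by rewrite -/(S x) Sr ltry.
apply/cvgrPdist_le => e e0.
have [N hN] := cvge0_le tail e0.
near=> m; rewrite sub0r normrN ger0_norm// -lee_fin.
apply: le_trans (hN m _); last by near: m; exists N.
have := @nneseries_lim_ge R (fun m => (F m x)%:E) xpredT m m.+1 (fun k _ _ => F0' k x).
by rewrite big_nat1.
Unshelve. all: by end_near. Qed.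

Lemma partial_translate f i x z : partial i (translate z f) x = partial i f (x + z).
Proof.
rewrite /partial /derive; congr (lim _).
rewrite (_ : (fun h : R => _) = (fun h : R => h^-1 *: (f (h *: e_ i + (x + z)) - f (x + z))))//.
by apply/funext => h; rewrite /translate addrA.
Qed.

Lemma C1_on_translate f z : C1_on setT f -> C1_on setT (translate z f).
Proof.
move=> hf x _ i; split.
  have [+ _] := hf (x + z) I i; rewrite /derivable.
  rewrite (_ : (fun h : R => h^-1 *: (translate z f (h *: e_ i + x) - translate z f x)) =
     (fun h : R => h^-1 *: (f (h *: e_ i + (x + z)) - f (x + z))))//.
  by apply/funext => h; rewrite /translate addrA.
rewrite (_ : partial i (translate z f) = (partial i f) \o (fun y => y + z)); last first.
  by apply/funext => y /=; rewrite partial_translate.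
apply: continuous_comp; last by have [_] := hf (x + z) I i.
have hc : {for x, continuous (fun _ : 'rV[R]_n => z)} by exact: cst_continuous.
have hi : {for x, continuous (fun y : 'rV[R]_n => y)} by exact: cvg_id.
exact: (cvgD hi hc).
Qed.

Lemma powR_cvg0_inv (p : R) (a : nat -> R) : 0 < p ->
  `|a m| `^ p @[m --> \oo] --> (0 : R) -> a m @[m --> \oo] --> (0 : R).
Proof.
move=> p0 ha; apply/norm_cvg0P.
have p'0 : 0 <= p^-1 by rewrite invr_ge0 ltW.
have E : (fun m => `|a m|) = (fun m => `| (`|a m| `^ p) | `^ p^-1).
  by apply/funext => m; rewrite (ger0_norm (powR_ge0 _ _)) -powRrM divff ?gt_eqF// powRr1.
have := @continuous_cvg _ _ _ _ _ _ _ _ (@continuous_norm_powR R p^-1 p'0 0) ha.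
rewrite normr0 powR0 ?invr_neq0 ?gt_eqF// E.
by apply.
Qed.

(** For [|x| < r] the translated kernel is a test function supported in the ball of radius [r + 1],
    where [f] and [g] stand for [u] and [Du]; the definition of the weak gradient then applies to
    it. *)
Lemma weak_gradient_corr (p r : R) u Du j f (g : 'I_n -> 'rV[R]_n -> R) x i :
  measurable_fun setT u -> measurable_fun setT f -> weak_gradient u Du ->
  {ae mu, forall y, `|y| <= r + 1 -> f y = u y} ->
  (forall y, `|y| <= r + 1 -> g i y = Du y ord0 i) -> `|x| < r ->
  corr f (partial i (@molk R n j)) x = - corr (g i) (@molk R n j) x.
Proof.
move=> mu_ mf wu fu gDu xr.
have [hk _] := @C1_on_bump R n 0 (j.+1%:R^-1 ^+ 2).
pose phi := translate (- x) (@molk R n j).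
have C1phi : C1_on setT phi by exact: C1_on_translate.
have supp y : r + 1 < `|y| -> j.+1%:R^-1 <= `|y - x|.
  move=> ry; have j1 : j.+1%:R^-1 <= 1 :> R by rewrite invf_le1// ler1n.
  have := lerB_dist y x; apply: le_trans; apply: (le_trans j1).
  by rewrite lerBrDr addrC; apply: ltW; apply: le_lt_trans ry; rewrite lerD2r ltW.
have phi0 y : r + 1 < `|y| -> phi y = 0.
  by move=> /supp ry; rewrite /phi /translate /molk bump_eq0// ltW// invr_gt0.
have dphi0 y : r + 1 < `|y| -> partial i phi y = 0.
  move=> /supp ry; rewrite /phi partial_translate.
  have [_ ->] := @C1_on_bump R n 0 (j.+1%:R^-1 ^+ 2).
  by rewrite bump_eq0 ?mulr0 ?mul0r// ltW// invr_gt0.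
have cphi : C1c phi by exact: C1c_intro phi0.
have mdphi : measurable_fun setT (partial i phi).
  by apply: continuous_measurable_rV => y; have [] := C1phi y I i.
have -> : corr f (partial i (@molk R n j)) x = \int[mu]_y (u y * partial i phi y).
  transitivity (\int[mu]_y (f y * partial i phi y)).
    by apply: eq_Rintegral => y _; rewrite /phi partial_translate.
  congr fine; apply: ae_eq_integral => //.
  - by apply/measurable_EFinP; exact: measurable_funM.
  - by apply/measurable_EFinP; exact: measurable_funM.
  - apply: filterS fu => y fuy _; congr (_%:E).
    have [yr|yr] := leP `|y| (r + 1); first by rewrite fuy.
    by rewrite dphi0// !mulr0.
rewrite (wu phi cphi i); congr (- _); apply: eq_Rintegral => y _.
have [yr|yr] := leP `|y| (r + 1); first by rewrite gDu.
have := phi0 y yr; rewrite /phi /translate => ->.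
by rewrite !mulr0.
Qed.

End approximation.

Section approximation_theorem.
Context (R : realType) (n : nat).
Notation mu := (@lebesgue_rV R n).
Notation L1 f := (mu.-integrable [set: 'rV[R]_n] (EFin \o f)).
Implicit Types (f g u : 'rV[R]_n -> R) (x z : 'rV[R]_n) (j : nat).

Lemma finite_pdist_moll (I : finType) (p r e : R) (g : I -> 'rV[R]_n -> R) :
  1 < p -> (forall i, measurable_fun setT (g i)) ->
  (forall i x, r < `|x| -> g i x = 0) ->
  (forall i, \int[mu]_x (`|g i x| `^ p)%:E < +oo)%E -> 0 < e ->
  exists j, forall i, (pdist p (moll j (g i)) (g i) <= e%:E)%E.
Proof.
move=> p1 mg gr gp e0.
have /choice[J hJ] : forall i, exists J, forall j, (J <= j)%N ->
    (pdist p (moll j (g i)) (g i) <= e%:E)%E.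
  by move=> i; exact: (@pdist_moll R n p r e (g i) p1 (mg i) (gr i) (gp i) e0).
exists (\max_i J i)%N => i; apply: hJ; exact: leq_bigmax.
Qed.

Lemma measurable_moll j f : measurable_fun setT f -> L1 f ->
  translation_continuous 1 f -> measurable_fun setT (moll j f).
Proof.
move=> mf hf t1; apply: measurable_funM => //.
apply: continuous_measurable_rV => x.
exact: (continuous_corr hf t1 (measurable_bump _ _) (molk_bound j)).
Qed.

Lemma patch_ball_Lp (p r : R) f : 0 < p -> Lp_loc p f ->
  [/\ measurable_fun setT (f \_ [set x | `|x| <= r]),
      (forall x, r < `|x| -> (f \_ [set x | `|x| <= r]) x = 0) &
      (\int[mu]_x (`|(f \_ [set x | `|x| <= r]) x| `^ p)%:E < +oo)%E].
Proof.
move=> p0 [mf fK]; pose K := [set x : 'rV[R]_n | `|x| <= r].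
have mK : measurable K by exact: measurable_norm_ball.
split.
- by apply/(measurable_restrictT _ mK); exact: measurable_funTS.
- move=> x rx; rewrite patchE memNset//= => /(lt_le_trans rx); by rewrite ltxx.
- have := fK K (@compact_norm_ball R n r).
  rewrite integral_mkcond; congr (_ < _)%E; apply: eq_integral => x _.
  rewrite !patchE; case: ifP => // _.
  by rewrite normr0 powR0// gt_eqF.
Qed.

(** The mollification indices are chosen so that the L^p errors are summable; [summable_dominated]
    then yields almost everywhere convergence and a common majorant at once. *)
Theorem weak_gradient_approximation (p r : R) u Du : 1 < p -> 0 < r ->
  W1p_loc p u Du -> Linfty_loc u ->
  exists M U h, [/\ 0 <= M, (forall m, C1_on setT (U m)),
    (forall m x, `|U m x| <= M), L1 h /\ (forall x, 0 <= h x) &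
    {ae mu, forall x, `|x| < r ->
      [/\ `|u x| <= M, U m x @[m --> \oo] --> u x,
       (forall i, partial i (U m) x @[m --> \oo] --> Du x ord0 i) &
       forall m i, `|partial i (U m) x - Du x ord0 i| `^ p <= h x]}].
Proof.
move=> p1 r0 [up Dup wu] [mu_ uloc].
have p0 : 0 < p by rewrite (lt_trans ltr01).
pose K := [set x : 'rV[R]_n | `|x| <= r + 1].
have mK : measurable K by exact: measurable_norm_ball.
have [M0 hM0] := uloc K (@compact_norm_ball R n (r + 1)).
pose M := Num.max M0 0.
have M_ge0 : 0 <= M by rewrite le_max lexx orbT.
have hM : {ae mu, forall x, K x -> `|u x| <= M}.
  by apply: filterS hM0 => x h /h /le_trans; apply; rewrite le_max lexx.
(* [u] is bounded only almost everywhere on [K]; discarding the points with [|u x| > M] makes [f],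
   hence its mollifications, bounded everywhere. *)
pose A := K `&` [set x | `|u x| <= M].
have mA : measurable A.
  rewrite /A; have mn : measurable_fun setT (fun x => `|u x|) by exact: measurableT_comp.
  apply: measurableI => //; rewrite -[X in measurable X]setTI.
  rewrite (_ : [set x | _] = (fun x => `|u x|) @^-1` `]-oo, M]).
    exact: mn.
  by apply/seteqP; split => x /=; rewrite in_itv.
pose f := u \_ A; pose g i := (fun x => Du x ord0 i) \_ K.
have mf : measurable_fun setT f.
  by apply/(measurable_restrictT _ mA); exact: measurable_funTS.
have fM x : `|f x| <= M.
  by rewrite /f patchE; case: ifPn => [|_]; rewrite ?normr0// inE => -[].
have fr x : r + 1 < `|x| -> f x = 0.
  move=> rx; rewrite /f patchE memNset// => -[/(lt_le_trans rx)]; by rewrite ltxx.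
have fu : {ae mu, forall y, `|y| <= r + 1 -> f y = u y}.
  apply: filterS hM => y hy yr; rewrite /f patchE mem_set//; split => //; exact: hy.
have hf : L1 f by exact: L1_bounded_support mf fM fr.
have gP i := patch_ball_Lp (r + 1) p0 (Dup i).
have mg i : measurable_fun setT (g i) by have [] := gP i.
have gr i x : r + 1 < `|x| -> g i x = 0 by have [_ h _] := gP i; exact: h.
have gp i : (\int[mu]_x (`|g i x| `^ p)%:E < +oo)%E by have [] := gP i.
have gDu i y : `|y| <= r + 1 -> g i y = Du y ord0 i.
  by move=> yr; rewrite /g patchE mem_set.
have fp : (\int[mu]_x (`|f x| `^ p)%:E < +oo)%E.
  have hfp : L1 (fun x => `|f x| `^ p).
    apply: (@L1_bounded_support R n _ (r + 1) (M `^ p)).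
    - by apply: (measurableT_comp (measurable_powR _)); exact: measurableT_comp.
    - move=> x; rewrite ger0_norm ?powR_ge0// ge0_ler_powR ?nnegrE ?(ltW p0)//.
    - by move=> x /fr ->; rewrite normr0 powR0// gt_eqF.
  have := L1_lty hfp.
  by under eq_integral do rewrite ger0_norm ?powR_ge0//.
(* The function and its [n] derivatives are mollified with one common index; [None] stands for the
   function. *)
pose G (o : option 'I_n) := if o is Some i then g i else f.
have mG o : measurable_fun setT (G o) by case: o.
have Gr o x : r + 1 < `|x| -> G o x = 0 by case: o => [i|]; [exact: gr|exact: fr].
have Gp o : (\int[mu]_x (`|G o x| `^ p)%:E < +oo)%E by case: o.
have GL o : L1 (G o) by exact: (Lp_L1 (ltW p1) (mG o) (Gr o) (Gp o)).
have Gt o : translation_continuous 1 (G o).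
  apply: (@Lp_translation_continuous R n 1 (r + 1)) => //; first exact: Gr.
  by under eq_integral do rewrite powRr1//; exact: L1_lty.
(* The [n.+1] components share the budget [1 / 2 ^ m.+1] of step [m]. *)
pose d (m : nat) : R := 1 / (2 ^ m.+1)%:R / n.+1%:R.
have d0 m : 0 < d m by rewrite !divr_gt0// ltr0n expn_gt0.
have /choice[J hJ] : forall m, exists j, forall o, (pdist p (moll j (G o)) (G o) <= (d m)%:E)%E.
  by move=> m; exact: (@finite_pdist_moll _ p (r + 1)).
pose F (m : nat) x := \sum_(o : option 'I_n) `|moll (J m) (G o) x - G o x| `^ p.
have mterm m o : measurable_fun setT (fun x => `|moll (J m) (G o) x - G o x| `^ p).
  apply: (measurableT_comp (measurable_powR _)); apply: measurableT_comp => //.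
  by apply: measurable_funB => //; exact: measurable_moll.
have F0 m x : 0 <= F m x by apply: sumr_ge0 => o _; exact: powR_ge0.
have mF m : measurable_fun setT (F m) by exact: measurable_sum.
have Fterm m o x : `|moll (J m) (G o) x - G o x| `^ p <= F m x.
  by rewrite /F (bigD1 o)//= lerDl; apply: sumr_ge0 => o' _; exact: powR_ge0.
have hF m : (\int[mu]_x (F m x)%:E <= (1 / (2 ^ m.+1)%:R)%:E)%E.
  rewrite /F; under eq_integral do rewrite -sumEFin.
  rewrite ge0_integral_sum//; last by move=> o; exact/measurable_EFinP.
  apply: (@le_trans _ _ (\sum_(o : option 'I_n) (d m)%:E)%E).
    by apply: lee_sum => o _; exact: hJ.
  rewrite sumEFin lee_fin sumr_const card_option card_ord -[leLHS]mulr_natr.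
  by rewrite /d divfK.
have [h [hL1 h0 hae]] := summable_dominated mF F0 hF.
have CU j := C1_on_moll j mf fM fr.
exists M, (fun m => moll (J m) f), h; split => //.
- by move=> m; have [] := CU (J m).
- by move=> m x; exact: moll_le.
have pE m i x : `|x| < r -> partial i (moll (J m) f) x = moll (J m) (g i) x.
  move=> xr; have [_ ->] := CU (J m).
  rewrite (@weak_gradient_corr R n p r u Du _ f g)//; first by rewrite mulrNN.
  exact: gDu.
apply: filterS2 hae hM => x [Fx hx] Mx xr.
have Kx : K x by rewrite /K /= ltW// (lt_trans xr)// ltrDl.
have conv o : moll (J m) (G o) x @[m --> \oo] --> G o x.
  apply/subr_cvg0; apply: (powR_cvg0_inv p0).
  apply: (@squeeze_cvgr _ _ _ _ (fun=> 0) (fun m => F m x)) => //; last exact: cvg_cst.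
  by near=> m; rewrite powR_ge0 Fterm.
split.
- exact: Mx.
- have := conv None; rewrite /G /f patchE mem_set//; split => //; exact: Mx.
- move=> i; under eq_fun do rewrite pE//.
  by have := conv (Some i); rewrite /G gDu.
- move=> m i; rewrite pE// -(gDu i x Kx).
  exact: le_trans (Fterm m (Some i) x) (hx m).
Unshelve. all: by end_near. Qed.

End approximation_theorem.

(** * Finsler norms *)

Section finsler_facts.
Context (R : realType) (N : nat).
Notation e_ i := (delta_mx ord0 i : 'rV[R]_N).
Implicit Types (x v w : 'rV[R]_N).

Lemma is_derive_scale (f : 'rV[R]_N -> R) (a l : R) x v :
  is_derive (a *: x) v f l -> is_derive x v (fun y => f (a *: y)) (l * a).
Proof.
move=> h; apply: is_derive_line0.
have h1 : is_derive (a * (0 : R)) 1 (fun t : R => f (a *: x + t *: v)) l.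
  by apply: is_derive_line; rewrite mulr0 scale0r addr0.
have h2 : is_derive (0 : R) 1 (fun s : R => a * s) a.
  have := @is_deriveZ R R R id a 0 1 1 (is_derive_id _ _).
  by rewrite [_ *: _]mulr1.
have := @is_derive1_comp R (fun t : R => f (a *: x + t *: v)) (fun s : R => a * s) 0 _ _ h1 h2.
by rewrite /comp; under eq_fun do rewrite -scalerA -scalerDr.
Qed.

Lemma is_derive_unique (V : normedModType R) (f : V -> R) (x v : V) (l l' : R) :
  is_derive x v f l -> is_derive x v f l' -> l = l'.
Proof. by move=> [_ <-] [_ <-]. Qed.

Lemma rV_sum_delta x : x = \sum_(i < N) x ord0 i *: e_ i.
Proof.
apply/rowP => j; rewrite summxE (bigD1 j)//= !mxE !eqxx mulr1 big1 ?addr0// => i ij.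
by rewrite !mxE eqxx eq_sym (negbTE ij) mulr0.
Qed.

Lemma open_neq0 : open [set x : 'rV[R]_N | x != 0].
Proof.
rewrite (_ : [set x : 'rV[R]_N | x != 0] = ~` [set 0]).
  by apply: closed_openC; apply: accessible_closed_set1; exact: hausdorff_accessible.
by apply/seteqP; split => y /= /eqP.
Qed.

Lemma nbhs_neq0 x : x != 0 -> \forall y \near x, y != 0.
Proof. by move=> x0; exact: (open_nbhs_nbhs (conj open_neq0 x0)). Qed.

Lemma compact_sphere : compact [set x : 'rV[R]_N | `|x| = 1].
Proof.
apply: (subclosed_compact _ (@compact_norm_ball R N 1)); last by move=> x /= ->.
rewrite (_ : [set x : 'rV[R]_N | `|x| = 1] = (fun x : 'rV[R]_N => `|x|) @^-1` [set 1]) //.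
apply: preimage_closed; last exact: closed_eq.
by move=> x _; exact: norm_continuous.
Qed.

(** Extreme values on the unit sphere of the sup norm; meant for homogeneous functions, whose size
    elsewhere then follows. *)
Lemma homogeneous_bound (f : 'rV[R]_N -> R) : (0 < N)%N ->
  (forall x, x != 0 -> {for x, continuous f}) ->
  exists2 C, 0 <= C & forall x, `|x| = 1 -> `|f x| <= C.
Proof.
move=> N0 cf.
pose i0 : 'I_N := Ordinal N0.
have [c Sc hc] : exists2 c, c \in [set x : 'rV[R]_N | `|x| = 1] &
    forall t, t \in [set x : 'rV[R]_N | `|x| = 1] -> `|f t| <= `|f c|.
  apply: (@EVT_max_rV R N (fun x => `|f x|)) => //.
  - exists (e_ i0) => /=; apply/eqP; rewrite eq_le norm_delta_le /=.
    by have := le_coord_norm (e_ i0) i0; rewrite mxE !eqxx normr1.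
  - exact: compact_sphere.
  - apply: continuous_in_subspaceT => x; rewrite inE /= => x1.
    apply: (@continuous_comp _ _ _ f (fun y : R => `|y|)); last exact: norm_continuous.
    apply: cf; rewrite -normr_eq0 x1; exact: oner_neq0.
exists (`|f c|) => // x x1; apply: hc; by rewrite inE.
Qed.

Variable H : 'rV[R]_N -> R.
Hypothesis hH : finsler_norm H.

Lemma finsler0 : H 0 = 0.
Proof. by have := finslerZ hH 0 0; rewrite scale0r normr0 mul0r. Qed.

Lemma finsler_gt0 x : x != 0 -> 0 < H x.
Proof.
move=> x0; rewrite lt_def finsler_ge0// andbT.
by apply: contra x0 => /eqP /(finsler_eq0 hH) ->.
Qed.

Lemma finslerN x : H (- x) = H x.
Proof. by rewrite -scaleN1r (finslerZ hH) normrN normr1 mul1r. Qed.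

Lemma finsler_le_norm x : H x <= (\sum_(i < N) H (e_ i)) * `|x|.
Proof.
rewrite {1}[x]rV_sum_delta mulr_suml.
have h (s : seq 'I_N) : H (\sum_(i <- s) x ord0 i *: e_ i) <= \sum_(i <- s) H (e_ i) * `|x|.
  elim: s => [|i s IH]; first by rewrite !big_nil finsler0.
  rewrite !big_cons (le_trans (finslerD hH _ _))// lerD//.
  by rewrite (finslerZ hH) mulrC ler_wpM2l ?finsler_ge0// le_coord_norm.
exact: h.
Qed.

Lemma finsler_lipschitz x y : `|H x - H y| <= H (x - y).
Proof.
rewrite ler_norml; apply/andP; split.
  rewrite lerNl opprB lerBlDr -(finslerN (x - y)) opprB.
  by rewrite -{1}(subrK x y); exact: finslerD.
rewrite lerBlDr -{1}(subrK y x); exact: finslerD.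
Qed.

Lemma continuous_finsler : continuous H.
Proof.
move=> x.
pose C := \sum_(i < N) H (e_ i).
have C0 : 0 <= C by apply: sumr_ge0 => i _; exact: finsler_ge0.
apply/(@cvgrPdist_le _ _ _ (nbhs x)) => e e0.
have d0 : 0 < e / (C + 1) by rewrite divr_gt0// ltr_wpDl.
apply/nbhs_ballP; exists (e / (C + 1)) => //= y; rewrite -ball_normE /ball_ /= => xy.
apply: (le_trans (finsler_lipschitz _ _)); apply: (le_trans (finsler_le_norm _)).
apply: (@le_trans _ _ (C * (e / (C + 1)))); first by rewrite ler_wpM2l// ltW.
by rewrite mulrCA ger_pMr// ler_pdivrMr ?ltr_wpDl// mul1r lerDl.
Qed.

Lemma finsler_ge_norm : (0 < N)%N -> exists2 c, 0 < c & forall x, c * `|x| <= H x.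
Proof.
move=> N0; pose i0 : 'I_N := Ordinal N0.
have [c Sc hc] : exists2 c, c \in [set x : 'rV[R]_N | `|x| = 1] &
    forall t, t \in [set x : 'rV[R]_N | `|x| = 1] -> H c <= H t.
  apply: (@EVT_min_rV R N H) => //.
  - exists (e_ i0) => /=; apply/eqP; rewrite eq_le norm_delta_le /=.
    by have := le_coord_norm (e_ i0) i0; rewrite mxE !eqxx normr1.
  - exact: compact_sphere.
  - apply: continuous_subspaceT; exact: continuous_finsler.
have c0 : c != 0.
  by move: Sc; rewrite inE /= => Sc; rewrite -normr_eq0 Sc oner_neq0.
exists (H c); first exact: finsler_gt0.
move=> x; have [->|x0] := eqVneq x 0; first by rewrite normr0 mulr0 finsler0.
have nx : 0 < `|x| by rewrite normr_gt0.
have -> : H x = `|x| * H (`|x|^-1 *: x).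
  by rewrite (finslerZ hH) ger0_norm ?invr_ge0// mulrA divff ?gt_eqF// mul1r.
rewrite mulrC ler_wpM2l//; apply: hc; rewrite inE /=.
by rewrite normrZ ger0_norm ?invr_ge0// mulVf ?gt_eqF.
Qed.

Let HC2 := finsler_C2 hH.

Lemma finsler_is_derive x i : x != 0 -> is_derive x (e_ i) H (partial i H x).
Proof. by move=> x0; have [h _] := HC2; have [d _] := h x x0 i; exact: derivableP. Qed.

Lemma finsler_is_derive2 x i j : x != 0 ->
  is_derive x (e_ i) (partial j H) (partial i (partial j H) x).
Proof. by move=> x0; have [_ h] := HC2; have [d _] := h j x x0 i; exact: derivableP. Qed.

Lemma continuous_partial_finsler x i : x != 0 -> {for x, continuous (partial i H)}.
Proof. by move=> x0; have [h _] := HC2; have [_ d] := h x x0 i. Qed.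

Lemma continuous_partial2_finsler x i j : x != 0 ->
  {for x, continuous (partial i (partial j H))}.
Proof. by move=> x0; have [_ h] := HC2; have [_ d] := h j x x0 i. Qed.

Lemma near0_gt0 : \forall h \near (0 : R), 0 < 1 + h.
Proof.
have := @lt_nbhsr R (-1) 0; rewrite oppr_lt0 ltr01 => /(_ isT).
by apply: filterS => h; rewrite -subr_gt0 opprK addrC.
Qed.

(** The derivative of [H] at [x] along [x] is computed twice: from [H ((1 + h) x) = (1 + h) H x] and
    from the partial derivatives. *)
Lemma finsler_euler x : x != 0 -> dotv (grad H x) x = H x.
Proof.
move=> x0; have [h1 _] := HC2.
have [df dE] := C1_on_differentiable open_neq0 h1 x0.
have : is_derive x x H (\sum_(i < N) x ord0 i * partial i H x).
  by rewrite -dE; apply: derivableP; exact: diff_derivable.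
have : is_derive x x H (H x).
  apply: is_derive_cvg; apply: (@cvg_trans _ ((fun=> H x) @ (0 : R)^')); last exact: cvg_cst.
  apply: near_eq_cvg; near=> h.
  have h0 : h != 0 by near: h; exact: nbhs_dnbhs_neq.
  have h1' : 0 < 1 + h by near: h; apply: nbhs_dnbhs; exact: near0_gt0.
  have E : h *: x + x = (1 + h) *: x by rewrite scalerDl scale1r addrC.
  rewrite E (finslerZ hH) gtr0_norm//.
  rewrite -[RHS]/(h^-1 * ((1 + h) * H x - H x)).
  by field.
move=> h2 h3; rewrite (is_derive_unique h2 h3) /dotv.
by apply: eq_bigr => i _; rewrite mxE mulrC.
Unshelve. all: by end_near. Qed.

(** The reverse triangle inequality bounds every difference quotient, and the bound survives in the
    limit. *)
Lemma partial_finsler_le x i : x != 0 -> `|partial i H x| <= H (e_ i).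
Proof.
move=> x0; have [d _] := finsler_is_derive i x0.
have := d; rewrite /derivable => /cvg_ex[l hl].
have -> : partial i H x = l by exact: cvg_lim hl.
have cl : closed [set y : R | `|y| <= H (e_ i)].
  rewrite (_ : [set y : R | _] = (fun y : R => `|y|) @^-1` [set y | y <= H (e_ i)]) //.
  apply: preimage_closed; last exact: closed_le.
  by move=> y _; exact: norm_continuous.
apply: (closed_cvg _ cl _ _ hl); near=> h.
have h0 : h != 0 by near: h; exact: nbhs_dnbhs_neq.
rewrite /= normrM normfV ler_pdivrMl ?normr_gt0//.
apply: (le_trans (finsler_lipschitz _ _)).
by rewrite addrK (finslerZ hH).
Unshelve. all: by end_near. Qed.

Lemma partial_finslerZ (a : R) x i : 0 < a -> x != 0 -> partial i H (a *: x) = partial i H x.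
Proof.
move=> a0 x0.
have ax0 : a *: x != 0 by rewrite scaler_eq0 negb_or gt_eqF.
have h1 := is_derive_scale (finsler_is_derive i ax0).
have h2 := @is_deriveZ R _ R H a x (e_ i) _ (finsler_is_derive i x0).
have h3 : is_derive x (e_ i) (fun y => H (a *: y)) (a *: partial i H x).
  rewrite (_ : (fun y => H (a *: y)) = a \*: H)//.
  by apply/funext => y; rewrite (finslerZ hH) gtr0_norm.
have := is_derive_unique h1 h3; rewrite [a *: partial i H x]mulrC.
by apply: mulIf; rewrite gt_eqF.
Qed.

Lemma partial2_finslerZ (a : R) x i j : 0 < a -> x != 0 ->
  partial i (partial j H) (a *: x) = a^-1 * partial i (partial j H) x.
Proof.
move=> a0 x0.
have ax0 : a *: x != 0 by rewrite scaler_eq0 negb_or gt_eqF.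
have h1 := is_derive_scale (finsler_is_derive2 i j ax0).
have h3 : is_derive x (e_ i) (fun y => partial j H (a *: y)) (partial i (partial j H) x).
  apply: near_eq_is_derive (finsler_is_derive2 i j x0).
  near=> y; rewrite partial_finslerZ//; near: y; exact: nbhs_neq0.
rewrite -(is_derive_unique h1 h3) mulrCA mulVf ?mulr1// gt_eqF//.
Unshelve. all: by end_near. Qed.

(** Euler's relation for [partial j H], which is homogeneous of degree 0. *)
Lemma hess_finsler_l x j : x != 0 -> \sum_(i < N) x ord0 i * hess H x i j = 0.
Proof.
move=> x0; have [_ h2] := HC2.
have [df dE] := C1_on_differentiable open_neq0 (h2 j) x0.
have a1 : is_derive x x (partial j H) (\sum_(i < N) x ord0 i * partial i (partial j H) x).
  by rewrite -dE; apply: derivableP; exact: diff_derivable.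
have a2 : is_derive x x (partial j H) 0.
  apply: is_derive_cvg; apply: (@cvg_trans _ ((fun=> 0 : R) @ (0 : R)^')); last exact: cvg_cst.
  apply: near_eq_cvg; near=> h.
  have h1' : 0 < 1 + h by near: h; apply: nbhs_dnbhs; exact: near0_gt0.
  have E : h *: x + x = (1 + h) *: x by rewrite scalerDl scale1r addrC.
  rewrite E partial_finslerZ// subrr.
  by rewrite scaler0.
apply: etrans (is_derive_unique a1 a2).
by apply: eq_bigr => i _; rewrite mxE.
Unshelve. all: by end_near. Qed.

(** Obtained by differentiating Euler's identity along [e_ i], rather than from the previous
    contraction through symmetry of the Hessian. *)
Lemma hess_finsler_r x i : x != 0 -> \sum_(j < N) hess H x i j * x ord0 j = 0.
Proof.
move=> x0.
have a1 : is_derive x (e_ i) (fun y => \sum_(j < N) partial j H y * y ord0 j)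
    (\sum_(j < N) (hess H x i j * x ord0 j + partial j H x * (i == j)%:R)).
  have hc j : is_derive x (e_ i) (fun y : 'rV[R]_N => y ord0 j) (i == j)%:R.
    apply: is_derive_cvg; apply: (@cvg_trans _ ((fun=> (i == j)%:R : R) @ (0 : R)^')); last exact: cvg_cst.
    apply: near_eq_cvg; near=> h.
    have h0 : h != 0 by near: h; exact: nbhs_dnbhs_neq.
    rewrite !mxE eqxx /= eq_sym addrK -[RHS]/(h^-1 * (h * _)) mulrA mulVf// mul1r.
    by case: eqP.
  have hp j : is_derive x (e_ i) (fun y => partial j H y * y ord0 j)
      (hess H x i j * x ord0 j + partial j H x * (i == j)%:R).
    have := @is_deriveM R _ (partial j H) (fun y : 'rV[R]_N => y ord0 j) x (e_ i) _ _ (finsler_is_derive2 i j x0) (hc j).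
    by rewrite addrC mxE [X in X + _]mulrC.
  have := @is_derive_sum R _ _ N (fun j y => partial j H y * y ord0 j) x (e_ i) _ hp.
  apply: near_eq_is_derive; near=> y.
  by rewrite fct_sumE.
have a2 : is_derive x (e_ i) (fun y => \sum_(j < N) partial j H y * y ord0 j) (partial i H x).
  apply: near_eq_is_derive (finsler_is_derive i x0).
  near=> y; rewrite -finsler_euler; last by near: y; exact: nbhs_neq0.
  by rewrite /dotv; apply: eq_bigr => j _; rewrite mxE.
have := is_derive_unique a1 a2; rewrite big_split /=.
rewrite [X in _ + X](bigD1 i)//= eqxx mulr1 [X in _ + (_ + X)]big1 ?addr0; last first.
  by move=> j ji; rewrite eq_sym (negbTE ji) mulr0.
by move/eqP; rewrite -subr_eq0 addrK => /eqP.
Unshelve. all: by end_near. Qed.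

Lemma ler_norm_dotv v w : `|dotv v w| <= (\sum_(i < N) `|v ord0 i|) * `|w|.
Proof.
rewrite mulr_suml; apply: (le_trans (ler_norm_sum _ _ _)); apply: ler_sum => i _.
by rewrite normrM ler_wpM2l// le_coord_norm.
Qed.

Lemma hess_quadE x v : dotv (v *m hess H x) v =
  \sum_(i < N) \sum_(j < N) v ord0 i * hess H x i j * v ord0 j.
Proof.
rewrite /dotv exchange_big; apply: eq_bigr => j _ /=.
by rewrite mxE mulr_suml.
Qed.

(** Second derivatives have degree -1, so their maxima on the sphere bound them by multiples of
    [1 / |x|], a factor compensated by [H x <= C1 * |x|]. The sum of the constants serves all four
    estimates. *)
Lemma finsler_bounds : (0 < N)%N -> exists2 C, 0 < C & forall x, x != 0 ->
  [/\ `|x| <= C * H x, H x <= C * `|x|,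
      forall v, `|dotv (grad H x) v| <= C * `|v| &
      forall v, `|dotv (v *m hess H x) v| * H x <= C * `|v| ^+ 2].
Proof.
move=> N0; have [c c0 hc] := finsler_ge_norm N0.
pose C1 := \sum_(i < N) H (e_ i).
have C10 : 0 <= C1 by apply: sumr_ge0 => i _; exact: finsler_ge0.
have /choice[K hK] : forall ij : 'I_N * 'I_N, exists K, 0 <= K /\
    forall x, `|x| = 1 -> `|partial ij.1 (partial ij.2 H) x| <= K.
  move=> [i j]; have [K K0 hK] := @homogeneous_bound (partial i (partial j H)) N0
    (fun x => @continuous_partial2_finsler x i j).
  by exists K.
pose C2 := \sum_(i < N) \sum_(j < N) K (i, j).
have C20 : 0 <= C2 by apply: sumr_ge0 => i _; apply: sumr_ge0 => j _; have [] := hK (i, j).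
exists (c^-1 + C1 + C1 * C2).
  by rewrite ltr_wpDr ?mulr_ge0// ltr_wpDr// invr_gt0.
move=> x x0; have nx : 0 < `|x| by rewrite normr_gt0.
have Hx := finsler_gt0 x0.
have CC : 0 <= C1 * C2 by rewrite mulr_ge0.
have ci : 0 <= c^-1 by rewrite invr_ge0 ltW.
split.
- apply: (@le_trans _ _ (c^-1 * H x)); first by rewrite ler_pdivlMl.
  by rewrite ler_wpM2r ?finsler_ge0// -addrA lerDl addr_ge0.
- apply: (le_trans (finsler_le_norm x)); rewrite ler_wpM2r// -/C1.
  by rewrite addrAC lerDr addr_ge0.
- move=> v; apply: (le_trans (ler_norm_dotv _ _)); rewrite ler_wpM2r//.
  apply: (@le_trans _ _ C1); last by rewrite addrAC lerDr addr_ge0.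
  by apply: ler_sum => i _; rewrite mxE partial_finsler_le.
- move=> v.
  have hb i j : `|hess H x i j| <= K (i, j) * `|x|^-1.
    have -> : hess H x i j = `|x|^-1 * partial i (partial j H) (`|x|^-1 *: x).
      rewrite partial2_finslerZ ?invr_gt0// invrK mulrA mulVf ?gt_eqF// mul1r.
      by rewrite mxE.
    rewrite normrM (ger0_norm (_ : 0 <= `|x|^-1)) ?invr_ge0// mulrC ler_wpM2r ?invr_ge0//.
    have [_ h] := hK (i, j); apply: h.
    by rewrite normrZ ger0_norm ?invr_ge0// mulVf ?gt_eqF.
  have hq : `|dotv (v *m hess H x) v| <= C2 * `|x|^-1 * `|v| ^+ 2.
    rewrite hess_quadE; apply: (le_trans (ler_norm_sum _ _ _)).
    rewrite /C2 !mulr_suml; apply: ler_sum => i _.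
    apply: (le_trans (ler_norm_sum _ _ _)).
    rewrite !mulr_suml; apply: ler_sum => j _.
    rewrite !normrM [leRHS](_ : _ = `|v| * (K (i, j) * `|x|^-1) * `|v|); last by ring.
    by rewrite !ler_pM ?mulr_ge0 ?le_coord_norm.
  apply: (@le_trans _ _ (C2 * `|x|^-1 * `|v| ^+ 2 * (C1 * `|x|))).
    by rewrite ler_pM ?finsler_ge0// finsler_le_norm.
  rewrite [leLHS](_ : _ = C1 * C2 * `|v| ^+ 2); last by field; rewrite gt_eqF.
  by rewrite ler_wpM2r ?sqr_ge0// lerDr addr_ge0.
Qed.

(** With [hess_comb], the algebra for test gradients of the form [a *: Du + w]: the gradient of [H]
    sees the radial part only through [H], and the Hessian does not see it at all. *)
Lemma dotv_grad_comb (a : R) x w : x != 0 ->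
  dotv (grad H x) (a *: x + w) = a * H x + dotv (grad H x) w.
Proof.
move=> x0; rewrite -(finsler_euler x0) /dotv mulr_sumr -big_split /=.
by apply: eq_bigr => i _; rewrite !mxE; ring.
Qed.

Lemma hess_comb (a : R) x w : x != 0 ->
  dotv ((a *: x + w) *m hess H x) (a *: x + w) = dotv (w *m hess H x) w.
Proof.
move=> x0; rewrite !hess_quadE.
have E1 : \sum_(i < N) \sum_(j < N) x ord0 i * hess H x i j * (a *: x + w) ord0 j = 0.
  rewrite exchange_big big1// => j _.
  by rewrite -mulr_suml (hess_finsler_l j x0) mul0r.
have E2 : \sum_(i < N) \sum_(j < N) w ord0 i * hess H x i j * x ord0 j = 0.
  rewrite big1// => i _.
  under eq_bigr do rewrite -mulrA.
  by rewrite -mulr_sumr (hess_finsler_r i x0) mulr0.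
transitivity (a * (\sum_(i < N) \sum_(j < N) x ord0 i * hess H x i j * (a *: x + w) ord0 j) +
   a * (\sum_(i < N) \sum_(j < N) w ord0 i * hess H x i j * x ord0 j) +
   \sum_(i < N) \sum_(j < N) w ord0 i * hess H x i j * w ord0 j); last first.
  by rewrite E1 E2 !mulr0 !add0r.
rewrite !mulr_sumr -!big_split; apply: eq_bigr => i _ /=.
rewrite !mulr_sumr -!big_split; apply: eq_bigr => j _ /=.
by rewrite !mxE; ring.
Qed.

End finsler_facts.

(** * Passing to the limit in the weak and stability inequalities *)

Section signed_power.
Context (R : realType).
Implicit Types (r s t : R).

(** The signed power of order [r + 1]: odd, and of class C^1 across 0 when [r > 0]. *)
Definition spow r s : R := `|s| `^ r * s.

Lemma is_derive_spow r s : 0 < r -> is_derive s 1 (spow r) ((r + 1) * `|s| `^ r).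
Proof.
move=> r0; have [s0|s0|->] := ltgtP s 0.
- have h : is_derive (- s) 1 (fun t : R => t `^ (r + 1)) ((r + 1) * (- s) `^ r).
    have := @is_derive1_powR R (r + 1) (- s); rewrite oppr_gt0 addrK => /(_ s0); exact.
  have hN : is_derive s 1 (fun t : R => - t) (- 1) by apply: is_deriveN.
  have h1 := @is_derive1_comp R (fun t : R => t `^ (r + 1)) (fun t : R => - t) s _ _ h hN.
  have h2 := @is_deriveN R _ R _ s 1 _ h1.
  rewrite ltr0_norm//; rewrite mulrN1 opprK in h2.
  apply: near_eq_is_derive h2; near=> t.
  have t0 : t < 0 by near: t; exact: lt_nbhsl.
  rewrite /= /spow ltr0_norm// -[X in _ = _ * X]opprK mulrN; congr (- _).
  rewrite -[X in _ * X](powRr1 (_ : 0 <= - t)) ?oppr_ge0 ?(ltW t0)//.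
  by rewrite -powRD// oppr_eq0 (lt_eqF t0) implybT.
- have h : is_derive s 1 (fun t : R => t `^ (r + 1)) ((r + 1) * s `^ r).
    by have := @is_derive1_powR R (r + 1) s s0; rewrite addrK.
  rewrite gtr0_norm//; apply: near_eq_is_derive h; near=> t.
  have t0 : 0 < t by near: t; exact: lt_nbhsr.
  rewrite /spow gtr0_norm// -[X in _ = _ * X](powRr1 (ltW t0)) -powRD//.
  by rewrite (gt_eqF t0) implybT.
- rewrite normr0 powR0 ?gt_eqF// mulr0; apply: is_derive_cvg.
  rewrite /spow mulr0.
  apply: (@cvg_trans _ ((fun h : R => `|h| `^ r) @ (0 : R)^')).
    apply: near_eq_cvg; near=> h.
    have h0 : h != 0 by near: h; exact: nbhs_dnbhs_neq.
    rewrite subr0 [h *: 1]mulr1 addr0 -[RHS]/(h^-1 * (`|h| `^ r * h)).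
    by rewrite mulrCA mulVf ?mulr1.
  apply: cvg_within_filter.
  have := @continuous_norm_powR R r (ltW r0) 0.
  by rewrite /continuous_at normr0 powR0 ?gt_eqF.
Unshelve. all: by end_near. Qed.

Lemma continuous_spow r : 0 < r -> continuous (spow r).
Proof.
move=> r0 s; apply/differentiable_continuous/derivable1_diffP.
by have [] := is_derive_spow s r0.
Qed.

Lemma continuous_dspow r : 0 < r -> continuous (fun s => (r + 1) * `|s| `^ r).
Proof.
move=> r0 s; apply: cvgM; first exact: cvg_cst.
exact: continuous_norm_powR (ltW r0) s.
Qed.

Lemma spow_le r s (M : R) : 0 < r -> `|s| <= M -> `|spow r s| <= M `^ r * M.
Proof.
move=> r0 sM; have M0 : 0 <= M by exact: le_trans sM.
rewrite normrM ger0_norm ?powR_ge0// ler_pM ?powR_ge0//.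
by rewrite ge0_ler_powR ?nnegrE// ltW.
Qed.

Lemma dspow_le r s (M : R) : 0 < r -> `|s| <= M ->
  `|(r + 1) * `|s| `^ r| <= (r + 1) * M `^ r.
Proof.
move=> r0 sM; have M0 : 0 <= M by exact: le_trans sM.
have r1 : 0 <= r + 1 by rewrite addr_ge0// ltW.
rewrite ger0_norm ?mulr_ge0 ?powR_ge0// ler_wpM2l//.
by rewrite ge0_ler_powR ?nnegrE// ltW.
Qed.

End signed_power.

Lemma cvg_seq_comp (R : realType) (G : R -> R) (a : nat -> R) (l : R) :
  continuous G -> a k @[k --> \oo] --> l -> G (a k) @[k --> \oo] --> G l.
Proof.
move=> cG al; have := @continuous_cvg _ _ _ _ _ _ _ _ (cG l) al.
by apply.
Qed.

Lemma continuous_partial (R : realType) n (f : 'rV[R]_n -> R) i :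
  C1_on setT f -> continuous (partial i f).
Proof. by move=> hf x; have [] := hf x I i. Qed.

(** * Admissible integrands and limits along approximate tests *)

Section limits.
Context (R : realType) (n : nat).
Notation mu := (@lebesgue_rV R n).
Notation L1 f := (mu.-integrable [set: 'rV[R]_n] (EFin \o f)).
Implicit Types (x v w : 'rV[R]_n).

Lemma Rdominated_cvg (f_ : nat -> 'rV[R]_n -> R) (f T : 'rV[R]_n -> R) :
  (forall m, measurable_fun setT (f_ m)) -> measurable_fun setT f -> L1 T ->
  {ae mu, forall x, f_ m x @[m --> \oo] --> f x /\ forall m, `|f_ m x| <= T x} ->
  L1 f /\ \int[mu]_x f_ m x @[m --> \oo] --> \int[mu]_x f x.
Proof.
move=> mf_ mf hT hae.
have [||hf _ hc] := @dominated_convergence _ _ R mu setT measurableT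
  (fun m x => (f_ m x)%:E) (fun x => (f x)%:E) (fun x => (T x)%:E)
  (fun m => (measurable_EFinP _ _).2 (mf_ m)) ((measurable_EFinP _ _).2 mf) _ hT _.
- apply: filterS hae => x [hx _] _; apply: cvg_EFin; first exact: nearW.
  exact: hx.
- by apply: filterS hae => x [_ hx] m _; rewrite lee_fin.
split => //; rewrite /Rintegral; apply: fine_cvg.
by rewrite fineK//; exact: (integrable_fin_num measurableT hf).
Qed.

Lemma L1_sum (I : finType) (f : I -> 'rV[R]_n -> R) :
  (forall i, L1 (f i)) -> L1 (fun x => \sum_(i : I) f i x).
Proof.
move=> hf; elim: (index_enum I) => [|i s IH].
  under eq_fun do rewrite big_nil.
  by apply: L1_ge0 => //; rewrite integral0.
under eq_fun do rewrite big_cons.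
exact: L1D.
Qed.

(** What dominated convergence asks of an integrand [Q (Du x) (grad phi x)] when [phi] runs through
    approximate tests. Only the second argument varies, so continuity is asked in it alone;
    [admissible_0] confines the integrand to the support of the cut-off. *)
Record admissible (p : R) (Q : 'rV[R]_n -> 'rV[R]_n -> R) := {
  admissible_cvg : forall xi (v_ : nat -> 'rV[R]_n) v,
    (forall i, v_ m ord0 i @[m --> \oo] --> v ord0 i) ->
    Q xi (v_ m) @[m --> \oo] --> Q xi v ;
  admissible_meas : forall X Y : 'rV[R]_n -> 'rV[R]_n,
    (forall i, measurable_fun setT (fun x => X x ord0 i)) ->
    (forall i, measurable_fun setT (fun x => Y x ord0 i)) ->
    measurable_fun setT (fun x => Q (X x) (Y x)) ;
  admissible_le : exists2 C, 0 <= C &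
    forall xi v, `|Q xi v| <= C * (1 + `|xi| + `|v|) `^ p ;
  admissible_0 : forall xi, Q xi 0 = 0 }.

(** The gradient of [spow r u * zeta], with [s] and [D] in place of [u] and its gradient, so that a
    weak gradient can be inserted. *)
Definition tvec (r : R) (zeta : 'rV[R]_n -> R) (s : R) (D : 'rV[R]_n) x : 'rV[R]_n :=
  (zeta x * ((r + 1) * `|s| `^ r)) *: D + spow r s *: grad zeta x.

Lemma test_function (r rho : R) m (U : 'rV[R]_n -> R) : 0 < r -> 0 <= rho ->
  C1_on setT U ->
  C1c (fun x => spow r (U x) * bump m.+2 (rho ^+ 2) x) /\
  forall x, grad (fun x => spow r (U x) * bump m.+2 (rho ^+ 2) x) x =
    tvec r (bump m.+2 (rho ^+ 2)) (U x) (grad U x) x.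
Proof.
move=> r0 rho0 hU.
have [hG dG] := C1_on_comp (fun s => is_derive_spow s r0) (continuous_dspow r0) hU.
have [hz _] := @C1_on_bump R n m (rho ^+ 2).
have [hf df] := C1_on_mul hG hz.
split.
  apply: (@C1c_intro _ _ _ rho) => // x rx.
  by rewrite bump_eq0 ?mulr0// ltW.
move=> x; apply/rowP => i; rewrite !mxE df dG addrC; congr (_ + _).
by rewrite mulrA.
Qed.

Lemma powR_norm_le_sum (p : R) v : 0 < p -> `|v| `^ p <= \sum_(i < n) `|v ord0 i| `^ p.
Proof.
move=> p0; set s := \sum_(i < n) _.
have s0 : 0 <= s by apply: sumr_ge0 => i _; exact: powR_ge0.
have h : `|v| <= s `^ p^-1.
  apply: rV_norm_le => [|i]; first exact: powR_ge0.
  rewrite -[leLHS](powRr1 (normr_ge0 _)) -(mulfV (lt0r_neq0 p0)) powRrM.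
  rewrite ge0_ler_powR ?nnegrE ?invr_ge0 ?powR_ge0 ?(ltW p0)//.
  by rewrite /s (bigD1 i)//= lerDl; apply: sumr_ge0 => j _; exact: powR_ge0.
apply: (@le_trans _ _ ((s `^ p^-1) `^ p)).
  by rewrite ge0_ler_powR ?nnegrE ?powR_ge0 ?(ltW p0).
by rewrite -powRrM mulVf ?gt_eqF// powRr1.
Qed.

Lemma powR_sum3_le (p a b c : R) : 0 <= p -> 0 <= a -> 0 <= b -> 0 <= c ->
  (a + b + c) `^ p <= 2 `^ p * 2 `^ p * (a `^ p + b `^ p + c `^ p).
Proof.
move=> p0 a0 b0 c0.
have h1 := powR_normD_le (a + b) c p0.
have h2 := powR_normD_le a b p0.
rewrite !ger0_norm ?addr_ge0// in h1 h2.
have e1 : 1 <= 2 `^ p :> R.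
  by rewrite -[leLHS](powRr0 2) ler_powR// ler1n.
have c1 := powR_ge0 c p.
apply: (le_trans h1); rewrite -mulrA ler_wpM2l ?powR_ge0//.
rewrite mulrDr; apply: lerD => //.
by rewrite ler_peMl.
Qed.

Lemma grad_bump_eq0 m (rho : R) x : 0 <= rho -> rho <= `|x| ->
  grad (bump m.+2 (rho ^+ 2)) x = 0.
Proof.
move=> rho0 rx; apply/rowP => i; rewrite !mxE.
have [_ ->] := @C1_on_bump R n m (rho ^+ 2).
by rewrite bump_eq0// mulr0 mul0r.
Qed.

Lemma grad_bump_le m (rho : R) x : 0 <= rho ->
  `|grad (bump m.+2 (rho ^+ 2)) x| <= m.+2%:R * 2 * rho * bump m.+1 (rho ^+ 2) x.
Proof.
move=> rho0.
have g0 : 0 <= m.+2%:R * 2 * rho * bump m.+1 (rho ^+ 2) x.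
  by rewrite !mulr_ge0// bump_ge0.
have [rx|xr] := leP rho `|x|; first by rewrite grad_bump_eq0 ?normr0.
apply: rV_norm_le => // i; rewrite mxE.
have [_ ->] := @C1_on_bump R n m (rho ^+ 2).
rewrite !normrM normrN normrM !normr_nat (ger0_norm (bump_ge0 _ _ _)).
rewrite [leRHS](_ : _ = m.+2%:R * bump m.+1 (rho ^+ 2) x * (2 * rho)); last by ring.
rewrite ler_wpM2l ?mulr_ge0 ?bump_ge0// ler_wpM2l//.
by rewrite (le_trans (le_coord_norm _ _))// ltW.
Qed.

Lemma tvec_eq0 (r rho : R) m s D x : 0 <= rho -> rho <= `|x| ->
  tvec r (bump m.+2 (rho ^+ 2)) s D x = 0.
Proof.
by move=> rho0 rx; rewrite /tvec bump_eq0// mul0r scale0r grad_bump_eq0// scaler0 addr0.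
Qed.

Lemma tvec_le (r rho M : R) m : 0 < r -> 0 <= rho -> 0 <= M ->
  exists2 A, 0 <= A & forall s D x, `|s| <= M ->
    `|tvec r (bump m.+2 (rho ^+ 2)) s D x| <= A * (1 + `|D|).
Proof.
move=> r0 rho0 M0.
pose Z0 := (rho ^+ 2) ^+ m.+2.
pose Z1 := m.+2%:R * 2 * rho * (rho ^+ 2) ^+ m.+1.
pose A1 := Z0 * ((r + 1) * M `^ r); pose A2 := M `^ r * M * Z1.
have Z00 : 0 <= Z0 by rewrite exprn_ge0// sqr_ge0.
have Z10 : 0 <= Z1.
  by apply: mulr_ge0; [rewrite !mulr_ge0|rewrite exprn_ge0// sqr_ge0].
have r1 : 0 <= r + 1 by rewrite addr_ge0// ltW.
have A10 : 0 <= A1 by apply: (mulr_ge0 Z00); apply: mulr_ge0 => //; exact: powR_ge0.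
have A20 : 0 <= A2.
  by apply: mulr_ge0 => //; apply: mulr_ge0 => //; exact: powR_ge0.
exists (A1 + A2); first by rewrite addr_ge0.
move=> s D x sM; apply: (le_trans (ler_normD _ _)); rewrite (normrZ _ D) (normrZ _ (grad _ x)).
have h1 : `|bump m.+2 (rho ^+ 2) x * ((r + 1) * `|s| `^ r)| <= A1.
  rewrite normrM ler_pM//; last exact: dspow_le.
  by rewrite ger0_norm ?bump_ge0 ?bump_le.
have h2 : `|spow r s| * `|grad (bump m.+2 (rho ^+ 2)) x| <= A2.
  rewrite ler_pM//; first exact: spow_le.
  apply: (le_trans (grad_bump_le _ _ rho0)).
  by rewrite ler_wpM2l ?bump_le// !mulr_ge0.
have D0 := normr_ge0 D.
apply: (le_trans (lerD (ler_wpM2r D0 h1) h2)).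
rewrite [leRHS](_ : _ = A1 * `|D| + A2 + (A1 + A2 * `|D|)); last by ring.
by rewrite lerDl; apply: addr_ge0 => //; exact: mulr_ge0.
Qed.

Lemma measurable_dotv (X Y : 'rV[R]_n -> 'rV[R]_n) :
  (forall i, measurable_fun setT (fun x => X x ord0 i)) ->
  (forall i, measurable_fun setT (fun x => Y x ord0 i)) ->
  measurable_fun setT (fun x => dotv (X x) (Y x)).
Proof. by move=> mX mY; apply: measurable_sum => i; exact: measurable_funM. Qed.

Lemma measurable_spow r (f : 'rV[R]_n -> R) : measurable_fun setT f ->
  measurable_fun setT (fun x => spow r (f x)).
Proof.
move=> mf; apply: measurable_funM => //.
by apply: (measurableT_comp (measurable_powR _)); exact: measurableT_comp.
Qed.

Lemma measurable_tvec (r rho : R) m (u : 'rV[R]_n -> R) (D : 'rV[R]_n -> 'rV[R]_n) i :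
  measurable_fun setT u -> (forall i, measurable_fun setT (fun x => D x ord0 i)) ->
  measurable_fun setT (fun x => tvec r (bump m.+2 (rho ^+ 2)) (u x) (D x) x ord0 i).
Proof.
move=> mu_ mD.
rewrite (_ : (fun x => _) = fun x => bump m.+2 (rho ^+ 2) x * ((r + 1) * `|u x| `^ r) * D x ord0 i
   + spow r (u x) * partial i (bump m.+2 (rho ^+ 2)) x); last first.
  by apply/funext => x; rewrite !mxE.
apply: measurable_funD; apply: measurable_funM => //.
- apply: measurable_funM; first exact: measurable_bump.
  apply: measurable_funM => //.
  by apply: (measurableT_comp (measurable_powR _)); exact: measurableT_comp.
- exact: measurable_spow.
- apply: continuous_measurable_rV => y.
  by have [hz _] := @C1_on_bump R n m (rho ^+ 2); have [] := hz y I i.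
Qed.

Section approximants.
Variables (p r rho M : R) (m : nat) (u : 'rV[R]_n -> R) (Du : 'rV[R]_n -> 'rV[R]_n).
Variables (U : nat -> 'rV[R]_n -> R) (h : 'rV[R]_n -> R).
Hypotheses (p1 : 1 < p) (r0 : 0 < r) (rho0 : 0 < rho) (M0 : 0 <= M).
Hypotheses (mu_ : measurable_fun setT u) (Dup : forall i, Lp_loc p (fun x => Du x ord0 i)).
Hypotheses (hU : forall k, C1_on setT (U k)) (UM : forall k x, `|U k x| <= M).
Hypotheses (hL1 : L1 h) (h0 : forall x, 0 <= h x).
Hypothesis hae : {ae mu, forall x, `|x| < rho + 1 ->
  [/\ `|u x| <= M, U k x @[k --> \oo] --> u x,
    (forall i, partial i (U k) x @[k --> \oo] --> Du x ord0 i) &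
    forall k i, `|partial i (U k) x - Du x ord0 i| `^ p <= h x]}.

Let zeta := @bump R n m.+2 (rho ^+ 2).
Let phi k x := spow r (U k x) * zeta x.
Let mDu i : measurable_fun setT (fun x => Du x ord0 i). Proof. by have [] := Dup i. Qed.
Let K := [set x : 'rV[R]_n | `|x| <= rho].
Let mK : measurable K. Proof. exact: measurable_norm_ball. Qed.

Let L1K : L1 \1_K.
Proof.
apply: (@L1_bounded_support R n _ rho 1) => //.
  by move=> x; rewrite indicE; case: (_ \in _); rewrite ?normr1 ?normr0.
by move=> x rx; rewrite indicE memNset//= => /(lt_le_trans rx); rewrite ltxx.
Qed.

(** Test gradients are at most [A * (1 + |grad (U k)|)], and [|grad (U k)| <= |Du| + h ^ (1/p)];
    raising to the power [p] gives a majorant built from [|Du| ^ p] and [h], the same for all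
    [k]. *)
Lemma limit_admissible Q : admissible p Q ->
  L1 (fun x => Q (Du x) (tvec r zeta (u x) (Du x) x)) /\
  \int[mu]_x Q (Du x) (grad (phi k) x) @[k --> \oo] -->
    \int[mu]_x Q (Du x) (tvec r zeta (u x) (Du x) x).
Proof.
move=> aQ; have p0 : 0 < p by rewrite (lt_trans ltr01).
have [C C0 hC] := admissible_le aQ.
have [A A0 hA] := @tvec_le r rho M m r0 (ltW rho0) M0.
have gE k x : grad (phi k) x = tvec r zeta (U k x) (grad (U k) x) x.
  by have [_ ->] := test_function m r0 (ltW rho0) (hU k).
pose C' := C * ((1 + A) `^ p * (2 `^ p * 2 `^ p)).
have C'0 : 0 <= C' by rewrite !mulr_ge0 ?powR_ge0.
pose T x := C' * (\1_K x + \sum_(i < n) `|((fun x => Du x ord0 i) \_ K) x| `^ p + h x).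
have hT : L1 T.
  apply: L1Z; apply: L1D => //; apply: L1D => //.
  apply: L1_sum => i; have [mg _ gp] := patch_ball_Lp rho p0 (Dup i).
  have mgp : measurable_fun setT (fun x => `|((fun x => Du x ord0 i) \_ K) x| `^ p).
    by apply: (measurableT_comp (measurable_powR _)); exact: measurableT_comp.
  exact: (L1_ge0 mgp (fun x => powR_ge0 _ _) gp).
have T0 x : 0 <= T x.
  rewrite mulr_ge0// addr_ge0// addr_ge0//.
  by apply: sumr_ge0 => i _; exact: powR_ge0.
apply: Rdominated_cvg hT _.
- move=> k; under eq_fun do rewrite gE.
  apply: (admissible_meas aQ) => // i; apply: measurable_tvec.
    by apply: continuous_measurable_rV; exact: C1_on_continuous.
  move=> j; under eq_fun do rewrite mxE.
  by apply: continuous_measurable_rV; exact: continuous_partial.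
- by apply: (admissible_meas aQ) => // i; exact: measurable_tvec.
apply: filterS hae => x hx; have [rx|xr] := leP rho `|x|.
  rewrite tvec_eq0 ?(ltW rho0)//; split => [|k].
    by under eq_fun do rewrite gE tvec_eq0 ?(ltW rho0)//; exact: cvg_cst.
  by rewrite gE tvec_eq0 ?(ltW rho0)// (admissible_0 aQ) normr0.
have [|uM Uu DU hD] := hx; first by rewrite (lt_trans xr)// ltrDl.
split => [|k].
  apply: (admissible_cvg aQ) => i; under eq_fun do rewrite gE.
  rewrite (_ : (fun k => _) = fun k => zeta x * ((r + 1) * `|U k x| `^ r) * partial i (U k) x
     + spow r (U k x) * partial i zeta x); last first.
    by apply/funext => k; rewrite !mxE.
  rewrite (_ : tvec _ _ _ _ _ _ _ = zeta x * ((r + 1) * `|u x| `^ r) * Du x ord0 i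
     + spow r (u x) * partial i zeta x); last by rewrite !mxE.
  have c1 : (r + 1) * `|U k x| `^ r @[k --> \oo] --> (r + 1) * `|u x| `^ r.
    exact: (cvg_seq_comp (@continuous_dspow R r r0) Uu).
  have c2 : spow r (U k x) @[k --> \oo] --> spow r (u x).
    exact: (cvg_seq_comp (@continuous_spow R r r0) Uu).
  have cc (c : R) : (fun _ : nat => c) k @[k --> \oo] --> c by exact: cvg_cst.
  exact: (cvgD (cvgM (cvgM (cc (zeta x)) c1) (DU i)) (cvgM c2 (cc _))).
rewrite gE; apply: (le_trans (hC _ _)).
rewrite /T /C' -mulrA ler_wpM2l//.
pose h' := h x `^ p^-1.
have h'0 : 0 <= h' by exact: powR_ge0.
have gU : `|grad (U k) x| <= `|Du x| + h'.
  apply: rV_norm_le => [|i]; first by rewrite addr_ge0.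
  rewrite mxE -[X in `|X|](subrK (Du x ord0 i)) addrC.
  apply: (le_trans (ler_normD _ _)); apply: lerD; first exact: le_coord_norm.
  rewrite -[leLHS](powRr1 (normr_ge0 _)) -(mulfV (lt0r_neq0 p0)) powRrM.
  by rewrite ge0_ler_powR ?nnegrE ?invr_ge0 ?powR_ge0 ?(ltW p0).
have tb := hA (U k x) (grad (U k) x) x (UM k x).
have b1 : 1 + `|Du x| + `|tvec r zeta (U k x) (grad (U k) x) x| <= (1 + A) * (1 + `|Du x| + h').
  rewrite mulrDl mul1r; apply: lerD; first by rewrite lerDl.
  by apply: (le_trans tb); rewrite ler_wpM2l// -addrA lerD2l.
have s0 : 0 <= 1 + `|Du x| + h' by rewrite !addr_ge0.
apply: (@le_trans _ _ (((1 + A) * (1 + `|Du x| + h')) `^ p)).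
  by rewrite ge0_ler_powR ?nnegrE ?(ltW p0) ?mulr_ge0 ?addr_ge0.
rewrite powRM ?addr_ge0// -mulrA ler_wpM2l ?powR_ge0//.
apply: (le_trans (powR_sum3_le _ _ _ _)) => //; first exact: ltW.
rewrite ler_wpM2l ?mulr_ge0 ?powR_ge0//.
have Kx : x \in K by rewrite inE /K /= ltW.
rewrite powR1 indicE Kx; apply: lerD; last first.
  by rewrite /h' -powRrM mulVf ?gt_eqF// powRr1.
rewrite lerD2l; apply: (le_trans (powR_norm_le_sum _ p0)).
by apply: ler_sum => i _; rewrite patchE Kx.
Qed.

(** For the terms without gradients: [psi] is the identity in the equation and the square in the
    stability inequality. *)
Lemma limit_lower (g : 'rV[R]_n -> R) (psi : R -> R) (Cg Cp : R) :
  0 <= Cg -> 0 <= Cp -> measurable_fun setT g -> (forall x, `|u x| <= M -> `|g x| <= Cg) ->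
  continuous psi -> psi 0 = 0 ->
  (forall s, `|s| <= M `^ r * M * (rho ^+ 2) ^+ m.+2 -> `|psi s| <= Cp) ->
  L1 (fun x => g x * psi (spow r (u x) * zeta x)) /\
  \int[mu]_x (g x * psi (phi k x)) @[k --> \oo] -->
    \int[mu]_x (g x * psi (spow r (u x) * zeta x)).
Proof.
move=> Cg0 Cp0 mg hg cpsi psi0 hpsi.
have mpsi f : measurable_fun setT f -> measurable_fun setT (fun x : 'rV[R]_n => psi (f x)).
  by move=> mf; apply: (measurableT_comp (continuous_measurable_fun cpsi)).
have z0 x : rho <= `|x| -> zeta x = 0 by move=> rx; rewrite /zeta bump_eq0// ltW.
apply: (@Rdominated_cvg _ _ (fun x => Cg * Cp * \1_K x)).
- move=> k; apply: measurable_funM => //; apply: mpsi; apply: measurable_funM.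
    by apply: measurable_spow; apply: continuous_measurable_rV; exact: C1_on_continuous.
  exact: measurable_bump.
- apply: measurable_funM => //; apply: mpsi; apply: measurable_funM.
    exact: measurable_spow.
  exact: measurable_bump.
- exact: L1Z.
apply: filterS hae => x hx; have [rx|xr] := leP rho `|x|.
  rewrite /phi z0// mulr0 psi0 mulr0; split => [|k].
    by under eq_fun do rewrite mulr0 psi0 mulr0; exact: cvg_cst.
  rewrite mulr0 psi0 mulr0 normr0 indicE.
  by rewrite mulr_ge0// ?mulr_ge0.
have [|uM Uu _ _] := hx; first by rewrite (lt_trans xr)// ltrDl.
have Kx : x \in K by rewrite inE /K /= ltW.
split => [|k].
  have c2 : spow r (U k x) @[k --> \oo] --> spow r (u x).
    exact: (cvg_seq_comp (@continuous_spow R r r0) Uu).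
  have cc (c : R) : (fun _ : nat => c) k @[k --> \oo] --> c by exact: cvg_cst.
  have c3 : spow r (U k x) * zeta x @[k --> \oo] --> spow r (u x) * zeta x.
    exact: (cvgM c2 (cc (zeta x))).
  have {}c3 : psi (phi k x) @[k --> \oo] --> psi (spow r (u x) * zeta x).
    exact: (cvg_seq_comp cpsi c3).
  exact: (cvgM (cc (g x)) c3).
rewrite indicE Kx mulr1 normrM ler_pM//; first exact: hg.
apply: hpsi; rewrite normrM ler_pM//; first exact: spow_le.
by rewrite ger0_norm ?bump_ge0 ?bump_le.
Qed.

End approximants.

End limits.

Lemma powR_sq (R : realType) (p S : R) : 0 < p -> 0 <= S -> S `^ (p - 2) * S ^+ 2 = S `^ p.
Proof.
move=> p0 S0; rewrite -powR_mulrn// -powRD; first by congr (_ `^ _); rewrite subrK.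
by rewrite subrK (gt_eqF p0).
Qed.

(** * The flux, radial and tangential integrands are admissible *)

Section growth_facts.
Context (R : realType) (n : nat) (p kappa gamma Gamma : R) (B : R -> R).
Context (H : 'rV[R]_n -> R).
Hypotheses (n0 : (0 < n)%N) (hH : finsler_norm H) (hp : 2 <= p).
Hypotheses (hk : 0 <= kappa <= 1) (hg : 0 < gamma) (hG : 0 < Gamma).
Hypothesis hB : growth p kappa gamma Gamma B.
Implicit Types (xi v : 'rV[R]_n).

Let p0 : 0 < p. Proof. by rewrite (lt_le_trans _ hp). Qed.
Let p20 : 0 <= p - 2. Proof. by rewrite subr_ge0. Qed.

Lemma measurable_off0_comp (f : 'rV[R]_n -> R) (X : 'rV[R]_n -> 'rV[R]_n) :
  (forall xi, xi != 0 -> {for xi, continuous f}) ->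
  (forall i, measurable_fun setT (fun x => X x ord0 i)) ->
  measurable_fun setT (fun x => if X x == 0 then 0 else f (X x)).
Proof.
move=> cf mX; apply: (measurableT_comp (measurable_rV_off0 (0 : R) cf)).
exact: measurable_fun_rVP.
Qed.

Lemma continuous_growth1 xi : xi != 0 -> {for xi, continuous (fun xi => derive1 B (H xi))}.
Proof.
move=> xi0; have [_ d2 _] := growth_C2 hB (finsler_gt0 hH xi0).
apply: (@continuous_comp _ _ _ H (derive1 B)); first exact: continuous_finsler.
exact/differentiable_continuous/derivable1_diffP.
Qed.

Lemma continuous_growth2 xi : xi != 0 -> {for xi, continuous (fun xi => derive1n 2 B (H xi))}.
Proof.
move=> xi0; have [_ _ d2] := growth_C2 hB (finsler_gt0 hH xi0).
by apply: (@continuous_comp _ _ _ H (derive1n 2 B)); first exact: continuous_finsler.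
Qed.

Definition flux_form xi v := dotv (flux B H xi) v.

Definition radial_form xi v : R := if xi == 0 then 0 else
  derive1n 2 B (H xi) * dotv (grad H xi) v ^+ 2.

Definition tangential_form xi v : R := if xi == 0 then 0 else
  derive1 B (H xi) * dotv (v *m hess H xi) v.

(** One quantity [S] dominates all sizes at once, so that each form is bounded by a constant times
    [S ^ (p - 2) * S ^ 2 = S ^ p]. *)
Lemma weight_le (C S : R) xi v : 0 < C -> H xi <= C * `|xi| ->
  S = (1 + C) * (1 + `|xi| + `|v|) ->
  [/\ (kappa + H xi) `^ (p - 2) <= S `^ (p - 2), H xi <= S, `|v| <= S & 0 <= S].
Proof.
move=> C0 HC SE; have /andP[k0 k1] := hk.
have x0 := normr_ge0 xi; have v0 := normr_ge0 v; have H0 := finsler_ge0 hH xi.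
have hS : S = 1 + `|xi| + `|v| + C + C * `|xi| + C * `|v| by rewrite SE; ring.
have cv : 0 <= C * `|v| by rewrite mulr_ge0// ltW.
have cx : 0 <= C * `|xi| by rewrite mulr_ge0// ltW.
have S0 : 0 <= S by rewrite hS; lra.
split => //; last 2 first.
- by rewrite hS; lra.
- by rewrite hS; lra.
apply: ge0_ler_powR => //; rewrite ?nnegrE ?addr_ge0//.
by rewrite hS; lra.
Qed.

Lemma admissible_flux : admissible p flux_form.
Proof.
have [C C0 hC] := finsler_bounds hH n0.
split.
- move=> xi v_ v hv.
  apply: (@cvg_fin_sum R nat \oo _ n (fun i k => flux B H xi ord0 i * v_ k ord0 i)
    (fun i => flux B H xi ord0 i * v ord0 i)) => i.
  by apply: cvgM => //; exact: cvg_cst.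
- move=> X Y mX mY; apply: measurable_dotv => // i.
  rewrite (_ : (fun x => _) = fun x => if X x == 0 then 0 else
      derive1 B (H (X x)) * partial i H (X x)); last first.
    by apply/funext => x; rewrite /flux; case: ifPn => _; rewrite !mxE.
  apply: (@measurable_off0_comp (fun xi => derive1 B (H xi) * partial i H xi)) => // xi xi0.
  have c1 : {for xi, continuous (fun xi => derive1 B (H xi))} by exact: continuous_growth1.
  have c2 : {for xi, continuous (partial i H)} by exact: continuous_partial_finsler.
  exact: (cvgM c1 c2).
- exists (Gamma * C * (1 + C) `^ p) => [|xi v].
    by rewrite !mulr_ge0 ?powR_ge0// ltW.
  rewrite /flux_form /flux; have [xi0|xi0] := eqVneq xi 0.
    rewrite /dotv big1 ?normr0 ?mulr_ge0 ?powR_ge0 ?(ltW hG) ?(ltW C0)// => i _.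
    by rewrite mxE mul0r.
  have [hx1 hx2 hx3 _] := hC xi xi0.
  have [S SE] : exists S, S = (1 + C) * (1 + `|xi| + `|v|) by eexists.
  have [w1 w2 w3 S0] := weight_le C0 hx2 SE.
  have Hx := finsler_gt0 hH xi0.
  have /andP[_ b1] := growth_deriv1 hB Hx.
  have [_ b0 _] := growth_gt0 hB Hx.
  have -> : dotv (derive1 B (H xi) *: grad H xi) v = derive1 B (H xi) * dotv (grad H xi) v.
    by rewrite /dotv mulr_sumr; apply: eq_bigr => i _; rewrite !mxE mulrA.
  rewrite normrM gtr0_norm//.
  rewrite -[leRHS]mulrA -powRM ?addr_ge0 ?(ltW C0)// -SE -(powR_sq p0 S0).
  rewrite [leRHS](_ : _ = (Gamma * S `^ (p - 2) * S) * (C * S)); last by ring.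
  apply: ler_pM => //; first exact: ltW.
    apply: (le_trans b1); rewrite ler_pM ?mulr_ge0 ?powR_ge0 ?(ltW hG)// ?(ltW Hx)//.
    by rewrite ler_wpM2l// ltW.
  by apply: (le_trans (hx3 v)); rewrite ler_wpM2l// ltW.
- by move=> xi; rewrite /flux_form /dotv big1// => i _; rewrite mxE mulr0.
Qed.

Lemma admissible_radial : admissible p radial_form.
Proof.
have [C C0 hC] := finsler_bounds hH n0.
split.
- move=> xi v_ v hv; rewrite /radial_form; case: ifPn => _; first exact: cvg_cst.
  have hd : dotv (grad H xi) (v_ m) @[m --> \oo] --> dotv (grad H xi) v.
    apply: (@cvg_fin_sum R nat \oo _ n (fun i k => grad H xi ord0 i * v_ k ord0 i)
      (fun i => grad H xi ord0 i * v ord0 i)) => i.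
    by apply: cvgM => //; exact: cvg_cst.
  by apply: cvgM; [exact: cvg_cst|exact: (cvgM hd hd)].
- move=> X Y mX mY.
  rewrite (_ : (fun x => _) = fun x => (if X x == 0 then 0 else derive1n 2 B (H (X x))) *
     (\sum_(i < n) (if X x == 0 then 0 else partial i H (X x)) * Y x ord0 i) ^+ 2); last first.
    apply/funext => x; rewrite /radial_form; case: ifPn => _; first by rewrite mul0r.
    by congr (_ * _ ^+ 2); apply: eq_bigr => i _; rewrite mxE.
  apply: measurable_funM.
    exact: (@measurable_off0_comp (fun xi => derive1n 2 B (H xi))) continuous_growth2 mX.
  apply: measurable_funX; apply: measurable_sum => i; apply: measurable_funM => //.
  by apply: (@measurable_off0_comp (partial i H)) => // xi xi0; exact: continuous_partial_finsler.
- have p1 : 0 <= p - 1 by rewrite subr_ge0 (le_trans _ hp)// ler1n.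
  have K0 : 0 <= Gamma * (p - 1) * C ^+ 2 * (1 + C) `^ p.
    by rewrite mulr_ge0 ?powR_ge0// mulr_ge0 ?sqr_ge0// mulr_ge0// ltW.
  exists (Gamma * (p - 1) * C ^+ 2 * (1 + C) `^ p) => // xi v.
  rewrite /radial_form; have [xi0|xi0] := eqVneq xi 0.
    by rewrite normr0 mulr_ge0// powR_ge0.
  have [hx1 hx2 hx3 _] := hC xi xi0.
  have [S SE] : exists S, S = (1 + C) * (1 + `|xi| + `|v|) by eexists.
  have [w1 w2 w3 S0] := weight_le C0 hx2 SE.
  have Hx := finsler_gt0 hH xi0.
  have /andP[_ b1] := growth_deriv2 hB Hx.
  have [_ _ b0] := growth_gt0 hB Hx.
  rewrite normrM gtr0_norm// normrX.
  rewrite -[leRHS]mulrA -powRM ?addr_ge0 ?(ltW C0)// -SE -(powR_sq p0 S0).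
  rewrite [leRHS](_ : _ = (Gamma * (p - 1) * S `^ (p - 2)) * (C * S) ^+ 2); last by ring.
  apply: ler_pM; [exact: ltW|by rewrite exprn_even_ge0| |].
    by apply: (le_trans b1); rewrite ler_wpM2l// mulr_ge0// ltW.
  rewrite lerXn2r ?nnegrE ?mulr_ge0 ?(ltW C0)//.
  by apply: (le_trans (hx3 v)); rewrite ler_wpM2l// ltW.
- move=> xi; rewrite /radial_form; case: ifPn => // _.
  have -> : dotv (grad H xi) 0 = 0 by rewrite /dotv big1// => i _; rewrite !mxE mulr0.
  by rewrite expr0n mulr0.
Qed.

Lemma admissible_tangential : admissible p tangential_form.
Proof.
have [C C0 hC] := finsler_bounds hH n0.
split.
- move=> xi v_ v hv; rewrite /tangential_form; case: ifPn => _; first exact: cvg_cst.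
  apply: cvgM; first exact: cvg_cst.
  under eq_fun do rewrite hess_quadE; rewrite hess_quadE.
  apply: (@cvg_fin_sum R nat \oo _ n (fun i k => \sum_(j < n) v_ k ord0 i * hess H xi i j * v_ k ord0 j)
    (fun i => \sum_(j < n) v ord0 i * hess H xi i j * v ord0 j)) => i.
  apply: (@cvg_fin_sum R nat \oo _ n (fun j k => v_ k ord0 i * hess H xi i j * v_ k ord0 j)
    (fun j => v ord0 i * hess H xi i j * v ord0 j)) => j.
  have cc : (fun _ : nat => hess H xi i j) k @[k --> \oo] --> hess H xi i j by exact: cvg_cst.
  exact: (cvgM (cvgM (hv i) cc) (hv j)).
- move=> X Y mX mY.
  rewrite (_ : (fun x => _) = fun x => (if X x == 0 then 0 else derive1 B (H (X x))) *
     (\sum_(i < n) \sum_(j < n) Y x ord0 i * (if X x == 0 then 0 else partial i (partial j H) (X x)) * Y x ord0 j)); last first.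
    apply/funext => x; rewrite /tangential_form; case: ifPn => _; first by rewrite mul0r.
    rewrite hess_quadE; congr (_ * _); apply: eq_bigr => i _; apply: eq_bigr => j _.
    by rewrite mxE.
  apply: measurable_funM.
    exact: (@measurable_off0_comp (fun xi => derive1 B (H xi))) continuous_growth1 mX.
  apply: measurable_sum => i; apply: measurable_sum => j; apply: measurable_funM => //.
  apply: measurable_funM => //.
  by apply: (@measurable_off0_comp (partial i (partial j H))) => // xi xi0; exact: continuous_partial2_finsler.
- exists (Gamma * C * (1 + C) `^ p) => [|xi v].
    by rewrite !mulr_ge0 ?powR_ge0// ltW.
  rewrite /tangential_form; have [xi0|xi0] := eqVneq xi 0.
    by rewrite normr0 !mulr_ge0 ?powR_ge0 ?(ltW hG) ?(ltW C0).
  have [hx1 hx2 _ hx4] := hC xi xi0.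
  have [S SE] : exists S, S = (1 + C) * (1 + `|xi| + `|v|) by eexists.
  have [w1 w2 w3 S0] := weight_le C0 hx2 SE.
  have Hx := finsler_gt0 hH xi0.
  have /andP[_ b1] := growth_deriv1 hB Hx.
  have [_ b0 _] := growth_gt0 hB Hx.
  rewrite normrM gtr0_norm//.
  rewrite -[leRHS]mulrA -powRM ?addr_ge0 ?(ltW C0)// -SE -(powR_sq p0 S0).
  apply: (@le_trans _ _ (Gamma * (kappa + H xi) `^ (p - 2) * (`|dotv (v *m hess H xi) v| * H xi))).
    apply: (le_trans (ler_wpM2r (normr_ge0 _) b1)).
    by apply: eq_ler; ring.
  rewrite [leRHS](_ : _ = (Gamma * S `^ (p - 2)) * (C * S ^+ 2)); last by ring.
  apply: ler_pM; rewrite ?mulr_ge0 ?powR_ge0 ?(ltW hG) ?(ltW Hx)//.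
    by rewrite ler_wpM2l// ltW.
  apply: (le_trans (hx4 v)); rewrite ler_wpM2l ?(ltW C0)//.
  by rewrite lerXn2r ?nnegrE.
- move=> xi; rewrite /tangential_form; case: ifPn => // _.
  have -> : dotv (0 *m hess H xi) 0 = 0 by rewrite /dotv big1// => i _; rewrite !mxE mulr0.
  by rewrite mulr0.
Qed.

End growth_facts.

(** * The equation and the stability inequality for tests built from u itself *)

Section limit_identities.
Context (R : realType) (n : nat) (p kappa gamma Gamma q : R) (B : R -> R).
Context (H : 'rV[R]_n -> R) (u : 'rV[R]_n -> R) (Du : 'rV[R]_n -> 'rV[R]_n).
Hypotheses (n0 : (0 < n)%N) (hH : finsler_norm H) (hp : 2 <= p).
Hypotheses (hk : 0 <= kappa <= 1) (hG : 0 < Gamma).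
Hypothesis hB : growth p kappa gamma Gamma B.
Hypotheses (hq : 1 < q) (hu : weak_solution p q B H u Du).
Notation mu := (@lebesgue_rV R n).
Notation L1 f := (mu.-integrable [set: 'rV[R]_n] (EFin \o f)).

Let p1 : 1 < p. Proof. by rewrite (lt_le_trans _ hp)// ltr1n. Qed.

Let measurable_u : measurable_fun setT u.
Proof. by have [] := weak_solution_Linfty hu. Qed.

(** Each [U k] gives a genuine C^1 test, for which the two sides agree; they converge to the two
    sides claimed here. *)
Lemma weak_limit_equation (r rho : R) m : 0 < r -> 0 < rho ->
  let zeta := @bump R n m.+2 (rho ^+ 2) in
  L1 (fun x => flux_form B H (Du x) (tvec r zeta (u x) (Du x) x)) /\
  \int[mu]_x flux_form B H (Du x) (tvec r zeta (u x) (Du x) x) =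
  \int[mu]_x (`|u x| `^ (q - 1) * u x * (spow r (u x) * zeta x)).
Proof.
move=> r0 rho0 zeta.
have rho1 : 0 < rho + 1 by rewrite addr_gt0.
have [M [U [h [M0 hU UM [hL1 h0] hae]]]] :=
  weak_gradient_approximation p1 rho1 (weak_solution_W1p hu) (weak_solution_Linfty hu).
have [_ Dup _] := weak_solution_W1p hu.
have aF := admissible_flux n0 hH hp hk hG hB.
have [hL cL] := @limit_admissible R n p r rho M m u Du U h p1 r0 rho0 M0 measurable_u Dup hU UM hL1 h0 hae _ aF.
split => //.
have q10 : 0 < q - 1 by rewrite subr_gt0.
have cid0 : continuous (id : R -> R) by move=> s; exact: cvg_id.
have [_ cR] := @limit_lower R n p r rho M m u Du U h r0 rho0 measurable_u hU UM hae
  (fun x => `|u x| `^ (q - 1) * u x) id (M `^ (q - 1) * M) (M `^ r * M * (rho ^+ 2) ^+ m.+2)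
  (mulr_ge0 (powR_ge0 _ _) M0)
  (mulr_ge0 (mulr_ge0 (powR_ge0 _ _) M0) (exprn_ge0 _ (sqr_ge0 _)))
  (measurable_spow (q - 1) measurable_u) (fun x => @spow_le R (q - 1) (u x) M q10)
  cid0 erefl (fun s => id).
apply: cvg_unique cL _; first exact: Rhausdorff.
apply: cvg_trans cR; apply: near_eq_cvg; near=> k.
have [hc _] := test_function m r0 (ltW rho0) (hU k).
by rewrite /= -(weak_solution_eq hu hc).
Unshelve. all: by end_near. Qed.

Lemma weak_limit_stability (r rho : R) m : 0 < r -> 0 < rho -> stable q B H u Du ->
  let zeta := @bump R n m.+2 (rho ^+ 2) in
  [/\ L1 (fun x => radial_form B H (Du x) (tvec r zeta (u x) (Du x) x)),
      L1 (fun x => tangential_form B H (Du x) (tvec r zeta (u x) (Du x) x)),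
      L1 (fun x => q * `|u x| `^ (q - 1) * (spow r (u x) * zeta x) ^+ 2) &
  0 <= \int[mu]_x radial_form B H (Du x) (tvec r zeta (u x) (Du x) x) +
       \int[mu]_x tangential_form B H (Du x) (tvec r zeta (u x) (Du x) x) -
       \int[mu]_x (q * `|u x| `^ (q - 1) * (spow r (u x) * zeta x) ^+ 2)].
Proof.
move=> r0 rho0 hst zeta.
have rho1 : 0 < rho + 1 by rewrite addr_gt0.
have [M [U [h [M0 hU UM [hL1 h0] hae]]]] :=
  weak_gradient_approximation p1 rho1 (weak_solution_W1p hu) (weak_solution_Linfty hu).
have [_ Dup _] := weak_solution_W1p hu.
have aR := admissible_radial n0 hH hp hk hG hB.
have aT := admissible_tangential n0 hH hp hk hG hB.
have [hL cL] := @limit_admissible R n p r rho M m u Du U h p1 r0 rho0 M0 measurable_u Dup hU UM hL1 h0 hae _ aR.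
have [hL' cL'] := @limit_admissible R n p r rho M m u Du U h p1 r0 rho0 M0 measurable_u Dup hU UM hL1 h0 hae _ aT.
have q10 : 0 < q - 1 by rewrite subr_gt0.
have q0 : 0 < q by rewrite (lt_trans ltr01).
have mg : measurable_fun setT (fun x => q * `|u x| `^ (q - 1)).
  by apply: measurable_funM => //; apply: (measurableT_comp (measurable_powR _)); exact: measurableT_comp.
have gM x : `|u x| <= M -> `|q * `|u x| `^ (q - 1)| <= q * M `^ (q - 1).
  move=> uM; rewrite ger0_norm ?mulr_ge0 ?powR_ge0 ?(ltW q0)// ler_wpM2l ?(ltW q0)//.
  by rewrite ge0_ler_powR ?nnegrE ?(ltW q10).
have A0 : 0 <= M `^ r * M * (rho ^+ 2) ^+ m.+2.
  exact: (mulr_ge0 (mulr_ge0 (powR_ge0 _ _) M0) (exprn_ge0 _ (sqr_ge0 _))).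
have [hR cR] := @limit_lower R n p r rho M m u Du U h r0 rho0 measurable_u hU UM hae
  (fun x => q * `|u x| `^ (q - 1)) (fun s => s ^+ 2) (q * M `^ (q - 1)) ((M `^ r * M * (rho ^+ 2) ^+ m.+2) ^+ 2)
  (mulr_ge0 (ltW q0) (powR_ge0 _ _)) (sqr_ge0 _) mg gM
  (@exprn_continuous R 2) (expr0n _ _)
  (fun s (hs : `|s| <= _) => ltac:(by rewrite normrX lerXn2r ?nnegrE)).
split => //.
have cc := cvgB (cvgD cL cL') cR.
refine (@cvgr_to_ge _ _ _ _ _ _ 0 (cc _ _) _); near=> k.
have [hc _] := test_function m r0 (ltW rho0) (hU k).
exact: (hst _ hc).
Unshelve. all: by end_near. Qed.

End limit_identities.

(** * The pointwise estimate *)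

Section young.
Context (R : realType).

(** Either [y ^ 2 <= e * x ^ 2], and the first term suffices, or [x] is at most [y / sqrt e], and
    the second does. *)
Lemma young_powR_le (p e : R) : 2 <= p -> 0 < e ->
  exists2 C, 0 <= C & forall x y, 0 <= x -> 0 <= y ->
    x `^ (p - 2) * y ^+ 2 <= e * (x `^ (p - 2) * x ^+ 2) + C * y `^ p.
Proof.
move=> p2 e0; pose k := Num.sqrt e^-1.
have p20 : 0 <= p - 2 by rewrite subr_ge0.
exists (k `^ (p - 2)); first exact: powR_ge0.
move=> x y x0 y0; have [yx|xy] := leP (y ^+ 2) (e * x ^+ 2).
  rewrite -[leLHS]addr0 lerD ?mulr_ge0 ?powR_ge0//.
  by rewrite [leRHS]mulrCA ler_wpM2l// powR_ge0.
rewrite -[leLHS]add0r lerD//; first by rewrite !mulr_ge0 ?powR_ge0 ?sqr_ge0// ltW.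
rewrite -(powR_sq (lt_le_trans (ltr0Sn R 1) p2) y0) [leRHS]mulrA -powRM ?sqrtr_ge0// ler_wpM2r ?sqr_ge0// ge0_ler_powR ?nnegrE ?mulr_ge0 ?sqrtr_ge0//.
rewrite -(@ler_pXn2r _ 2) ?nnegrE ?mulr_ge0 ?sqrtr_ge0// exprMn sqr_sqrtr ?invr_ge0 ?(ltW e0)//.
by rewrite mulrC ler_pdivlMr// mulrC ltW.
Qed.

(** Same dichotomy, on whether [theta ^ r <= e * t ^ (sigma - tau)]; otherwise [t ^ (sigma - tau)]
    is below [theta ^ r / e], and so [t ^ tau] is below a power of theta. *)
Lemma young_powR_le_mixed (tau sigma r e : R) : 0 < tau -> tau < sigma -> 0 < e ->
  exists2 C, 0 <= C & forall t theta, 0 <= t -> 0 < theta ->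
    t `^ tau * theta `^ r <=
    e * t `^ sigma + C * theta `^ (r * sigma / (sigma - tau)).
Proof.
move=> tau0 ts e0; have d0 : 0 < sigma - tau by rewrite subr_gt0.
exists ((e^-1) `^ (tau / (sigma - tau))); first exact: powR_ge0.
move=> t theta t0 th0.
have [h|h] := leP (theta `^ r) (e * t `^ (sigma - tau)).
  rewrite -[leLHS]addr0 lerD ?mulr_ge0 ?powR_ge0//.
  apply: (le_trans (ler_wpM2l (powR_ge0 _ _) h)).
  rewrite mulrCA -powRD ?(gt_eqF tau0)// addrC subrK// gt_eqF//.
  exact: lt_trans ts.
rewrite -[leLHS]add0r lerD//; first by rewrite mulr_ge0 ?powR_ge0 ?ltW.
have -> : theta `^ (r * sigma / (sigma - tau)) =
    (theta `^ r) `^ (tau / (sigma - tau)) * theta `^ r.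
  rewrite -powRrM -powRD ?(gt_eqF th0) ?implybT//; congr (_ `^ _).
  by field; rewrite gt_eqF.
rewrite mulrA -powRM ?invr_ge0 ?powR_ge0 ?(ltW e0)// ler_wpM2r ?powR_ge0//.
have -> : t `^ tau = (t `^ (sigma - tau)) `^ (tau / (sigma - tau)).
  by rewrite -powRrM mulrCA divff ?mulr1// gt_eqF.
rewrite ge0_ler_powR ?nnegrE ?mulr_ge0 ?powR_ge0 ?invr_ge0 ?(ltW e0) ?divr_ge0 ?(ltW tau0) ?(ltW d0)//.
by rewrite mulrC ler_pdivlMr// mulrC ltW.
Qed.

Lemma powRD_le (r a b : R) : 0 <= r -> 0 <= a -> 0 <= b ->
  (a + b) `^ r <= 2 `^ r * (a `^ r + b `^ r).
Proof.
move=> r0 a0 b0; wlog ab : a b a0 b0 / a <= b => [hw|].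
  have [ab|/ltW ba] := leP a b; first exact: hw.
  by rewrite addrC [X in _ * X]addrC; exact: hw.
apply: (@le_trans _ _ ((2 * b) `^ r)).
  rewrite ge0_ler_powR ?nnegrE ?addr_ge0 ?mulr_ge0//.
  by rewrite mulr_natl mulr2n lerD2r.
by rewrite powRM// ler_wpM2l ?powR_ge0// lerDr powR_ge0.
Qed.

(** The weight splits into its [kappa] and [h] parts. The [h] part takes Young twice: first to
    produce [t ^ (alpha - 1 + p) * theta ^ p], then to reach [t ^ (q + alpha)], where [p - 1 < q]
    enters. The [kappa] part takes it once. Hence the two powers of theta. *)
Lemma cutoff_young (p kappa q alpha e : R) :
  2 <= p -> 0 <= kappa <= 1 -> p - 1 < q -> 1 < alpha -> 0 < e ->
  exists2 C, 0 <= C & forall h t theta, 0 <= h -> 0 <= t -> 0 < theta ->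
    (kappa + h) `^ (p - 2) * t `^ (alpha + 1) * theta ^+ 2 <=
    e * ((kappa + h) `^ (p - 2) * h ^+ 2 * t `^ (alpha - 1) + t `^ (q + alpha)) +
    C * (theta `^ (p * (q + alpha) / (q - p + 1)) +
         kappa `^ (p - 2) * theta `^ (2 * (q + alpha) / (q - 1))).
Proof.
move=> p2 /andP[k0 k1] hq al1 e0.
have p0 : 0 < p by rewrite (lt_le_trans _ p2).
have p20 : 0 <= p - 2 by rewrite subr_ge0.
have q1 : 1 < q by apply: le_lt_trans hq; rewrite lerBrDr.
have al0 : 0 < alpha by rewrite (lt_trans ltr01).
pose c := 2 `^ (p - 2) : R; have c0 : 0 < c by rewrite powR_gt0.
(* The factor [c] is lost in splitting the weight, and [t ^ (q + alpha)] is charged twice. *)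
pose e' := e / (2 * c).
have e'0 : 0 < e' by rewrite divr_gt0// mulr_gt0.
have [C1 C10 h1] := young_powR_le p2 e'0.
(* The second use of Young is multiplied by the constant of the first, and [C1 * e2 <= e']. *)
pose e2 := e' / (C1 + 1).
have e20 : 0 < e2 by rewrite divr_gt0// ltr_wpDl.
have ta : 0 < alpha - 1 + p by rewrite addr_gt0// subr_gt0.
have ts : alpha - 1 + p < q + alpha by lra.
have [C2 C20 h2] := @young_powR_le_mixed _ _ p _ ta ts e20.
have ta' : 0 < alpha + 1 by rewrite addr_gt0.
have ts' : alpha + 1 < q + alpha by lra.
have [C3 C30 h3] := @young_powR_le_mixed _ _ 2 _ ta' ts' e'0.
exists (c * (C1 * C2 + C3)); first by rewrite mulr_ge0 ?addr_ge0 ?mulr_ge0// ltW.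
move=> h t theta hh0 t0 th0.
have T1 : t `^ (alpha + 1) = t ^+ 2 * t `^ (alpha - 1).
  rewrite -powR_mulrn// -powRD; first by congr (_ `^ _); ring.
  by apply/implyP => /eqP; lra.
have T2 : t `^ p * t `^ (alpha - 1) = t `^ (alpha - 1 + p).
  by rewrite -powRD ?[p + _]addrC// gt_eqF.
have /= := h3 t theta t0 th0; have /= := h2 t theta t0 th0.
have /= := h1 h (t * theta) hh0 (mulr_ge0 t0 (ltW th0)).
rewrite (powR_mulrn 2 (ltW th0)).
have -> : q + alpha - (alpha - 1 + p) = q - p + 1 by ring.
have -> : q + alpha - (alpha + 1) = q - 1 by ring.
have wle := powRD_le p20 k0 hh0.
rewrite powRM ?(ltW th0)//.
have w0 : h `^ (p - 2) <= (kappa + h) `^ (p - 2).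
  by apply: ge0_ler_powR => //; rewrite ?nnegrE ?addr_ge0// lerDr.
have k2 : kappa `^ (p - 2) <= 1.
  have := @ge0_ler_powR R _ p20 kappa 1; rewrite powR1 !nnegrE; exact.
have kp0 := powR_ge0 kappa (p - 2).
rewrite -/c in wle.
have tp0 := powR_ge0 t (alpha - 1); have tq0 := powR_ge0 t (q + alpha).
have sp0 := powR_ge0 theta (p * (q + alpha) / (q - p + 1)).
have s20 := powR_ge0 theta (2 * (q + alpha) / (q - 1)).
have hp0 := powR_ge0 h (p - 2).
move: T2 T1 w0 wle k2 kp0 tp0 tq0 sp0 s20 hp0.
move: (t `^ (q + alpha)) (theta `^ (p * (q + alpha) / (q - p + 1)))
  (theta `^ (2 * (q + alpha) / (q - 1))) (t `^ (alpha - 1 + p)) (t `^ p) (theta `^ p)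
  (t `^ (alpha - 1)) (h `^ (p - 2)) ((kappa + h) `^ (p - 2)) (kappa `^ (p - 2)) (t `^ (alpha + 1)).
move=> tq sp s2 tap tp thp ta1 hp w k tal T2 T1 w0 wle k2 kp0 tp0 tq0 sp0 s20 hp0 i1 i2 i3.
have th2 := sqr_ge0 theta; have hh := sqr_ge0 h.
have j1 : hp * (tal * theta ^+ 2) <= e' * (hp * h ^+ 2 * ta1) + C1 * (tap * thp).
  rewrite T1 -T2 [leLHS](_ : _ = hp * (t * theta) ^+ 2 * ta1); last by ring.
  by rewrite (le_trans (ler_wpM2r tp0 i1))//; apply: eq_ler; ring.
have j2 : C1 * (tap * thp) <= e' * tq + C1 * C2 * sp.
  apply: (le_trans (ler_wpM2l C10 i2)); rewrite mulrDr [C1 * (C2 * _)]mulrA lerD2r mulrA.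
  rewrite ler_wpM2r// /e2 mulrCA ger_pMr// ler_pdivrMr ?ltr_wpDl// mul1r lerDl.
  exact: ler01.
have j3 : k * (tal * theta ^+ 2) <= e' * tq + C3 * (k * s2).
  apply: (le_trans (ler_wpM2l kp0 i3)); rewrite mulrDr; apply: lerD; last by rewrite mulrCA.
  by rewrite ler_piMl// mulr_ge0// ltW.
have tal0 : 0 <= tal by rewrite T1 mulr_ge0// sqr_ge0.
have j4 : e' * (hp * h ^+ 2 * ta1) <= e' * (w * h ^+ 2 * ta1).
  by rewrite ler_wpM2l ?(ltW e'0)// ler_wpM2r// ler_wpM2r.
have j0 : w * (tal * theta ^+ 2) <= c * (k + hp) * (tal * theta ^+ 2).
  by rewrite ler_wpM2r// mulr_ge0.
have j5 : k * (tal * theta ^+ 2) + hp * (tal * theta ^+ 2) <=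
  2 * e' * (w * h ^+ 2 * ta1 + tq) + (C1 * C2 + C3) * (sp + k * s2).
  have z1 : 0 <= C1 * C2 * (k * s2) by rewrite !mulr_ge0.
  have z2 : 0 <= C3 * sp by rewrite !mulr_ge0.
  have z3 : 0 <= e' * (w * h ^+ 2 * ta1).
    by rewrite mulr_ge0 ?(ltW e'0)// mulr_ge0// mulr_ge0// (le_trans hp0).
  by lra.
rewrite -[leLHS]mulrA; apply: (le_trans j0).
rewrite -mulrA mulrDl; apply: (le_trans (ler_wpM2l (ltW c0) j5)).
apply: eq_ler; rewrite /e'; field.
by rewrite gt_eqF.
Qed.

End young.

(** * Bounds for the three forms in terms of energy and remainder *)

Section pointwise.
Context (R : realType) (n : nat) (p kappa gamma Gamma : R) (B : R -> R).
Context (H : 'rV[R]_n -> R).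
Hypotheses (n0 : (0 < n)%N) (hH : finsler_norm H) (hp : 2 <= p).
Hypotheses (hk : 0 <= kappa <= 1) (hg : 0 < gamma) (hG : 0 < Gamma).
Hypothesis hB : growth p kappa gamma Gamma B.
Implicit Types (x xi : 'rV[R]_n) (s rho : R).

(** The factor [rho / (rho ^ 2 - dotv x x)], called theta elsewhere, bounds the logarithmic gradient
    of the cut-off up to a constant. *)
Lemma grad_bump_le_theta m rho x : 0 <= rho -> 0 < rho ^+ 2 - dotv x x ->
  `|grad (bump m.+2 (rho ^+ 2)) x| <=
  2 * m.+2%:R * (rho / (rho ^+ 2 - dotv x x)) * bump m.+2 (rho ^+ 2) x.
Proof.
move=> rho0 b0; apply: (le_trans (grad_bump_le m x rho0)).
rewrite /bump max_r ?(ltW b0)//; move: b0; move: (rho ^+ 2 - dotv x x) => b b0.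
by apply: eq_ler; rewrite [b ^+ m.+2]exprS; field; rewrite gt_eqF.
Qed.

(** By Euler's identity the first two factors are the flux at [xi] paired with [xi]; the last is the
    weight coming from the test. *)
Definition energy (alpha : R) s xi := derive1 B (H xi) * H xi * `|s| `^ (alpha - 1).

(** The contribution of the gradient of the cut-off, after bounding its square by theta squared
    times the squared cut-off, up to constants. *)
Definition remainder (alpha rho : R) x s xi :=
  (kappa + H xi) `^ (p - 2) * `|s| `^ (alpha + 1) * (rho / (rho ^+ 2 - dotv x x)) ^+ 2.

Let powRD2 (r t : R) : 0 < r -> 0 <= t -> t `^ (r + 2) = t `^ r * t ^+ 2.
Proof.
move=> r0 t0; rewrite -powR_mulrn// -powRD// gt_eqF//.
by rewrite addr_gt0.
Qed.

Lemma sqr_powR_half (r t : R) : (t `^ (r / 2)) ^+ 2 = t `^ r.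
Proof. by rewrite -powR_mulrn ?powR_ge0// -powRrM divfK. Qed.

Lemma dotvZr (a : R) x y : dotv x (a *: y) = a * dotv x y.
Proof. by rewrite /dotv mulr_sumr; apply: eq_bigr => i _; rewrite mxE mulrCA. Qed.

Lemma dotvZl (a : R) x y : dotv (a *: x) y = a * dotv x y.
Proof. by rewrite /dotv mulr_sumr; apply: eq_bigr => i _; rewrite mxE mulrA. Qed.

(** Real-number core of [flux_form_lower]. The cross term goes into the energy when
    [t * K * th <= delta * h], and otherwise into the remainder through [b <= Gamma * w * h]. *)
Lemma absorb_flux (K delta alpha w h b t th tau Z sd : R) :
  0 < delta -> 0 <= tau -> 0 <= t -> 0 <= th -> 0 <= Z -> 0 <= K -> 0 <= w -> 0 < h -> 0 < b ->
  b <= Gamma * w * h -> `|sd| <= tau * t * (K * th * Z) ->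
  ((alpha - delta) * (b * h * tau) - Gamma * K ^+ 2 / delta * (w * (tau * t ^+ 2) * th ^+ 2)) * Z
  <= b * (Z * (alpha * tau) * h + sd).
Proof.
move=> d0 tau0 t0 th0 Z0 K0 w0 h0 b0 hb; rewrite ler_norml => /andP[hsd _].
have key : b * (t * K * th) <= delta * (b * h) + Gamma * K ^+ 2 / delta * (w * t ^+ 2 * th ^+ 2).
  have [h1|h1] := leP (t * K * th) (delta * h).
    rewrite -[leLHS]addr0 lerD//; first by rewrite [leRHS]mulrCA ler_wpM2l// ltW.
    by rewrite mulr_ge0// ?mulr_ge0 ?sqr_ge0 ?invr_ge0// ltW.
  rewrite -[leLHS]add0r lerD//; first by rewrite !mulr_ge0// ltW.
  have i1 : b <= Gamma * w * (t * K * th / delta).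
    rewrite (le_trans hb)// ler_wpM2l ?mulr_ge0 ?(ltW hG)//.
    by rewrite ler_pdivlMr// mulrC ltW.
  have z : 0 <= t * K * th by rewrite !mulr_ge0.
  apply: (le_trans (ler_wpM2r z i1)).
  by apply: eq_ler; field; rewrite gt_eqF.
have z : 0 <= tau * Z by rewrite mulr_ge0.
have := ler_wpM2r z key; have := ler_wpM2l (ltW b0) hsd.
by lra.
Qed.

(** The radial part of the test gradient is [alpha * |s| ^ (alpha - 1)] times the cut-off and [xi],
    which yields [alpha] times the energy; [delta] pays for the cut-off gradient. *)
Lemma flux_form_lower (alpha delta : R) m : 1 < alpha -> 0 < delta ->
  exists2 C, 0 <= C & forall rho x s xi, xi != 0 -> 0 <= rho -> 0 < rho ^+ 2 - dotv x x ->
    ((alpha - delta) * energy alpha s xi - C * remainder alpha rho x s xi) *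
      bump m.+2 (rho ^+ 2) x <=
    flux_form B H xi (tvec (alpha - 1) (bump m.+2 (rho ^+ 2)) s xi x).
Proof.
move=> al1 d0; have [C C0 hC] := finsler_bounds hH n0.
pose K := C * (2 * m.+2%:R); have K0 : 0 <= K by rewrite !mulr_ge0// ltW.
exists (Gamma * K ^+ 2 / delta).
  by rewrite !mulr_ge0 ?sqr_ge0 ?invr_ge0// ltW.
move=> rho x s xi xi0 rho0 b0.
have [_ _ hx3 _] := hC xi xi0.
have hgr := grad_bump_le_theta m rho0 b0.
have hd := le_trans (hx3 (grad (bump m.+2 (rho ^+ 2)) x)) (ler_wpM2l (ltW C0) hgr).
have Hx := finsler_gt0 hH xi0.
have /andP[_ b1] := growth_deriv1 hB Hx.
have [_ B0 _] := growth_gt0 hB Hx.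
have Z0 := @bump_ge0 R n m.+2 (rho ^+ 2) x.
have th0 : 0 <= rho / (rho ^+ 2 - dotv x x) by rewrite divr_ge0// ltW.
rewrite /flux_form /flux (negbTE xi0) dotvZl /tvec dotv_grad_comb// dotvZr /energy /remainder.
rewrite subrK [alpha + 1](_ : _ = alpha - 1 + 2); last by ring.
rewrite powRD2 ?subr_gt0//.
apply: absorb_flux; rewrite ?powR_ge0//.
rewrite normrM /spow normrM (ger0_norm (powR_ge0 _ _)) ler_wpM2l ?mulr_ge0 ?powR_ge0//.
by apply: (le_trans hd); apply: eq_ler; rewrite /K; ring.
Qed.

(** The radial part enters with the factor [((alpha + 1) / 2) ^ 2], and the ratio of the bounds on
    B'' and B' turns it into energy. The square of the sum is split with weights [1 + delta] and
    [1 + delta^-1]. *)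
Lemma radial_form_upper (alpha delta : R) m : 1 < alpha -> 0 < delta ->
  exists2 C, 0 <= C & forall rho x s xi, xi != 0 -> 0 <= rho -> 0 < rho ^+ 2 - dotv x x ->
    radial_form B H xi (tvec ((alpha - 1) / 2) (bump m.+2 (rho ^+ 2)) s xi x) <=
    ((1 + delta) * (Gamma * (p - 1) / gamma * ((alpha + 1) ^+ 2 / 4)) * energy alpha s xi +
     C * remainder alpha rho x s xi) * bump m.+2 (rho ^+ 2) x ^+ 2.
Proof.
move=> al1 d0; have [C C0 hC] := finsler_bounds hH n0.
pose K := C * (2 * m.+2%:R); have K0 : 0 <= K by rewrite !mulr_ge0// ltW.
have p10 : 0 <= p - 1 by rewrite subr_ge0 (le_trans _ hp)// ler1n.
exists ((1 + delta^-1) * (Gamma * (p - 1) * K ^+ 2)).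
  by rewrite mulr_ge0 ?addr_ge0 ?invr_ge0 ?(ltW d0)// !mulr_ge0 ?sqr_ge0// ltW.
move=> rho x s xi xi0 rho0 b0.
have [_ _ hx3 _] := hC xi xi0.
have hgr := grad_bump_le_theta m rho0 b0.
have hd := le_trans (hx3 (grad (bump m.+2 (rho ^+ 2)) x)) (ler_wpM2l (ltW C0) hgr).
have Hx := finsler_gt0 hH xi0.
have /andP[b1 _] := growth_deriv1 hB Hx.
have /andP[_ b2] := growth_deriv2 hB Hx.
have [_ _ B0] := growth_gt0 hB Hx.
have Z0 := @bump_ge0 R n m.+2 (rho ^+ 2) x.
have th0 : 0 <= rho / (rho ^+ 2 - dotv x x) by rewrite divr_ge0// ltW.
rewrite /radial_form (negbTE xi0) /tvec dotv_grad_comb// dotvZr /energy /remainder.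
rewrite [alpha + 1](_ : _ = alpha - 1 + 2); last by ring.
rewrite powRD2 ?subr_gt0//.
have tauE := esym (sqr_powR_half (alpha - 1) `|s|).
have hsd : `|spow ((alpha - 1) / 2) s * dotv (grad H xi) (grad (bump m.+2 (rho ^+ 2)) x)| <=
    `|s| `^ ((alpha - 1) / 2) * `|s| * (K * (rho / (rho ^+ 2 - dotv x x)) * bump m.+2 (rho ^+ 2) x).
  rewrite normrM /spow normrM (ger0_norm (powR_ge0 _ _)) ler_wpM2l ?mulr_ge0 ?powR_ge0//.
  by apply: (le_trans hd); apply: eq_ler; rewrite /K; ring.
have sE : (`|s| `^ ((alpha - 1) / 2) * `|s| * (K * (rho / (rho ^+ 2 - dotv x x)) * bump m.+2 (rho ^+ 2) x)) ^+ 2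
  = `|s| `^ (alpha - 1) * `|s| ^+ 2 * K ^+ 2 * (rho / (rho ^+ 2 - dotv x x)) ^+ 2 * bump m.+2 (rho ^+ 2) x ^+ 2.
  by rewrite tauE; ring.
have sd2 : (spow ((alpha - 1) / 2) s * dotv (grad H xi) (grad (bump m.+2 (rho ^+ 2)) x)) ^+ 2 <=
  `|s| `^ (alpha - 1) * `|s| ^+ 2 * K ^+ 2 * (rho / (rho ^+ 2 - dotv x x)) ^+ 2 * bump m.+2 (rho ^+ 2) x ^+ 2.
  rewrite -sE -real_normK ?num_real// lerXn2r ?nnegrE// (le_trans _ hsd)//.
move: hsd sE hd hgr => _ _ _ _.
have aE : (bump m.+2 (rho ^+ 2) x * (((alpha - 1) / 2 + 1) * `|s| `^ ((alpha - 1) / 2)) * H xi) ^+ 2 =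
  (alpha + 1) ^+ 2 / 4 * H xi ^+ 2 * `|s| `^ (alpha - 1) * bump m.+2 (rho ^+ 2) x ^+ 2.
  by rewrite tauE; field.
have al2 : alpha - 1 + 2 = alpha + 1 by ring.
rewrite al2.
set b := (X in X * (_ + _) ^+ 2 <= _).
set b' := derive1 B (H xi).
have {}B0 : 0 < b by [].
have {}b1 : gamma * (kappa + H xi) `^ (p - 2) * H xi <= b' by [].
have {}b2 : b <= Gamma * (p - 1) * (kappa + H xi) `^ (p - 2) by [].
(* The long expressions become variables, so that only a polynomial inequality remains. *)
move: b b' aE sd2 (powR_ge0 `|s| (alpha - 1)) (powR_ge0 (kappa + H xi) (p - 2)) B0 b1 b2 Hx Z0 => b b'.
move: (bump m.+2 (rho ^+ 2) x * (((alpha - 1) / 2 + 1) * `|s| `^ ((alpha - 1) / 2)) * H xi).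
move: (spow ((alpha - 1) / 2) s * dotv (grad H xi) (grad (bump m.+2 (rho ^+ 2)) x)).
move: (rho / _) th0 (bump m.+2 (rho ^+ 2) x) (`|s| `^ (alpha - 1)) (H xi) ((kappa + H xi) `^ (p - 2)).
move=> th th0 Z tau h w e a aE sd2 tau0 w0 b0' b1 b2 h0 Z0.
have ae : (a + e) ^+ 2 <= (1 + delta) * a ^+ 2 + (1 + delta^-1) * e ^+ 2.
  rewrite -subr_ge0 (_ : _ - _ = (delta * a - e) ^+ 2 / delta).
    by rewrite divr_ge0 ?sqr_ge0// ltW.
  by field; rewrite gt_eqF.
have i1 := ler_wpM2l (ltW b0') ae.
have i2 : b * h ^+ 2 <= Gamma * (p - 1) / gamma * (b' * h).
  rewrite (_ : Gamma * (p - 1) / gamma * (b' * h) = (Gamma * (p - 1)) * (b' / gamma) * h); last by ring.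
  rewrite expr2 mulrA ler_wpM2r ?(ltW h0)//.
  apply: (le_trans (ler_wpM2r (ltW h0) b2)); rewrite -[leLHS]mulrA.
  apply: ler_wpM2l; first by rewrite mulr_ge0// ltW.
  rewrite ler_pdivlMr// mulrC mulrA.
  exact: b1.
have c0 : 0 <= (1 + delta) * ((alpha + 1) ^+ 2 / 4 * tau * Z ^+ 2).
  by rewrite mulr_ge0 ?addr_ge0 ?(ltW d0)// mulr_ge0 ?sqr_ge0// mulr_ge0// divr_ge0 ?sqr_ge0.
have i3 := ler_wpM2r c0 i2.
have e0 := sqr_ge0 e.
have i4 : b * e ^+ 2 <= Gamma * (p - 1) * w * (tau * `|s| ^+ 2 * K ^+ 2 * th ^+ 2 * Z ^+ 2).
  by apply: ler_pM => //; exact: ltW.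
have dd : 0 <= 1 + delta^-1 by rewrite addr_ge0// invr_ge0 ltW.
have i5 := ler_wpM2l dd i4.
apply: (le_trans i1); have := lerD i3 i5.
rewrite aE; congr (_ <= _); ring.
Qed.

(** No energy appears: the Hessian of [H] kills the radial part of the test gradient, leaving the
    cut-off part alone. *)
Lemma tangential_form_upper (alpha : R) m : 1 < alpha ->
  exists2 C, 0 <= C & forall rho x s xi, xi != 0 -> 0 <= rho -> 0 < rho ^+ 2 - dotv x x ->
    tangential_form B H xi (tvec ((alpha - 1) / 2) (bump m.+2 (rho ^+ 2)) s xi x) <=
    C * remainder alpha rho x s xi * bump m.+2 (rho ^+ 2) x ^+ 2.
Proof.
move=> al1; have [C C0 hC] := finsler_bounds hH n0.
pose K := 2 * m.+2%:R : R; have K0 : 0 <= K by rewrite !mulr_ge0// ltW.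
exists (Gamma * C * K ^+ 2).
  by rewrite !mulr_ge0 ?sqr_ge0// ltW.
move=> rho x s xi xi0 rho0 b0.
have [_ _ _ hx4] := hC xi xi0.
have hgr := grad_bump_le_theta m rho0 b0.
have Hx := finsler_gt0 hH xi0.
have /andP[_ b1] := growth_deriv1 hB Hx.
have [_ B0 _] := growth_gt0 hB Hx.
have Z0 := @bump_ge0 R n m.+2 (rho ^+ 2) x.
have th0 : 0 <= rho / (rho ^+ 2 - dotv x x) by rewrite divr_ge0// ltW.
rewrite /tangential_form (negbTE xi0) /tvec hess_comb// /remainder.
rewrite [alpha + 1](_ : _ = alpha - 1 + 2); last by ring.
rewrite powRD2 ?subr_gt0//.
have tauE := esym (sqr_powR_half (alpha - 1) `|s|).
have := hx4 (spow ((alpha - 1) / 2) s *: grad (bump m.+2 (rho ^+ 2)) x).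
set q0 := dotv _ _.
have -> : `|spow ((alpha - 1) / 2) s *: grad (bump m.+2 (rho ^+ 2)) x| ^+ 2 =
   `|s| `^ (alpha - 1) * `|s| ^+ 2 * `|grad (bump m.+2 (rho ^+ 2)) x| ^+ 2.
  by rewrite normrZ /spow normrM (ger0_norm (powR_ge0 _ _)) tauE; ring.
have g2 : `|grad (bump m.+2 (rho ^+ 2)) x| ^+ 2 <=
    K ^+ 2 * (rho / (rho ^+ 2 - dotv x x)) ^+ 2 * bump m.+2 (rho ^+ 2) x ^+ 2.
  have kz := mulr_ge0 (mulr_ge0 K0 th0) Z0.
  by rewrite -!exprMn lerXn2r ?nnegrE ?kz.
have u0 : 0 <= C * (`|s| `^ (alpha - 1) * `|s| ^+ 2).
  by rewrite !mulr_ge0 ?powR_ge0 ?sqr_ge0// ltW.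
have := ler_wpM2l u0 g2; rewrite -[X in X <= _]mulrA => i1 i2.
have {i1}i2 := le_trans i2 i1.
have i3 : derive1 B (H xi) * q0 <= Gamma * (kappa + H xi) `^ (p - 2) * (`|q0| * H xi).
  rewrite [leRHS](_ : _ = Gamma * (kappa + H xi) `^ (p - 2) * H xi * `|q0|); last by ring.
  apply: (@le_trans _ _ (derive1 B (H xi) * `|q0|)).
    by rewrite ler_wpM2l ?(ltW B0)// ler_norm.
  by rewrite ler_wpM2r.
have u1 : 0 <= Gamma * (kappa + H xi) `^ (p - 2) by rewrite mulr_ge0 ?powR_ge0// ltW.
apply: (le_trans i3); apply: (le_trans (ler_wpM2l u1 i2)).
by apply: eq_ler; ring.
Qed.

End pointwise.

(** * Choice of the exponent and of the small parameter *)

Section exponents.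
Context (R : realType).

(** The last condition is a quadratic inequality in alpha whose two roots have product 1; alpha is
    placed midway between the larger of 1 and [c] and the larger root. *)
Lemma exponent_choice (a q c : R) : 0 < a -> a < q ->
  a * c < 2 * q - a + 2 * Num.sqrt (q * (q - a)) ->
  exists alpha, [/\ 1 < alpha, c < alpha & a * (alpha + 1) ^+ 2 < 4 * q * alpha].
Proof.
move=> a0 aq hc; have q0 : 0 < q by rewrite (lt_trans a0).
have qa : 0 < q - a by rewrite subr_gt0.
have Q0 : 0 < q * (q - a) by rewrite mulr_gt0.
have s2 := sqr_sqrtr (ltW Q0); have s0 : 0 < Num.sqrt (q * (q - a)) by rewrite sqrtr_gt0.
move: hc s2 s0; move: (Num.sqrt _) => s hc s2 s0.
have sqa : q - a < s.
  rewrite -(@ltr_pXn2r _ 2) ?nnegrE ?(ltW qa) ?(ltW s0)// s2 expr2.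
  by rewrite ltr_pM2r// gtrBl.
(* The larger root of [a * (x + 1) ^ 2 = 4 * q * x]. *)
pose b := (2 * q - a + 2 * s) / a.
have bE : a * b = 2 * q - a + 2 * s by rewrite /b mulrCA divff ?mulr1// gt_eqF.
have b1 : 1 < b by rewrite /b ltr_pdivlMr// mul1r; lra.
have cb : c < b by rewrite /b ltr_pdivlMr// mulrC.
pose d := Num.max 1 c.
have db : d < b by rewrite gt_max b1 cb.
have [d1 dc] : 1 <= d /\ c <= d by rewrite !le_max !lexx orbT.
exists ((d + b) / 2); set al := _ / 2.
have alb : al < b by rewrite /al; lra.
have dal : d < al by rewrite /al; lra.
have al1 : 1 < al by rewrite (le_lt_trans d1).
split => //; first by rewrite (le_lt_trans dc).
(* Factorisation at the root [b]: the second factor is [a] times the distance from [al] to the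
   smaller root. *)
rewrite -subr_gt0 (_ : _ - _ = (b - al) * (a * al + a * b - (4 * q - 2 * a)) +
   (4 * q * b - a * (b + 1) ^+ 2)); last by ring.
have -> : 4 * q * b - a * (b + 1) ^+ 2 = 0.
  apply: (mulfI (lt0r_neq0 a0)); rewrite mulr0.
  transitivity (4 * q * (a * b) - (a * b + a) ^+ 2); first by ring.
  rewrite bE; transitivity (4 * (q * (q - a)) - 4 * s ^+ 2); first by ring.
  by rewrite s2 subrr.
rewrite addr0 mulr_gt0 ?subr_gt0// bE.
have : a < a * al by rewrite ltr_pMr.
by lra.
Qed.

(** At [d = 0] the inequality reads [c / al < q]. The number [D] is a crude bound on the slope in
    [d], with [d * D] equal to the gap [q * al - c]. *)
Lemma small_parameter (c al q : R) : 0 <= c -> 1 < al -> c < q * al -> 0 < q ->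
  exists2 d, 0 < d & [/\ 0 < al - 2 * d &
   ((1 + d) * c + d) / (al - 2 * d) + (((1 + d) * c + d) / (al - 2 * d) + 1) * d < q].
Proof.
move=> c0 al1 hc q0.
pose D := 2 * (3 * c + 2 + al + 2 * q + q * al).
have qal : 0 < q * al by rewrite mulr_gt0// (lt_trans ltr01).
have D0 : 0 < D by rewrite /D; lra.
pose d := (q * al - c) / D.
have d0 : 0 < d by rewrite divr_gt0// subr_gt0.
have dD : d * D = q * al - c by rewrite divfK// gt_eqF.
have d2 : d < 1 / 2 by rewrite /d ltr_pdivrMr// /D; lra.
exists d => //.
have ad : 0 < al - 2 * d by lra.
split => //.
rewrite (_ : _ + _ = (((1 + d) * c + d) * (1 + d) + d * (al - 2 * d)) / (al - 2 * d)); last first.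
  by field; rewrite gt_eqF.
rewrite ltr_pdivrMr//.
have dd := mulr_ge0 (ltW d0) (ltW d0).
have dc : d * d * c <= d * c.
  by rewrite ler_wpM2r// ger_pMl//; lra.
have : 0 <= d * c by rewrite mulr_ge0// ltW.
have : 0 <= d * q by rewrite mulr_ge0// ltW.
have : 0 < d * al by rewrite mulr_gt0// (lt_trans ltr01).
have : 0 < d * (q * al) by rewrite mulr_gt0.
move: dD; rewrite /D; lra.
Qed.

End exponents.

(** * The combined pointwise inequality *)

Section pointwise_estimate.
Context (R : realType) (n : nat) (p kappa gamma Gamma q : R) (B : R -> R).
Context (H : 'rV[R]_n -> R).
Hypotheses (n0 : (0 < n)%N) (hH : finsler_norm H) (hp : 2 <= p).
Hypotheses (hk : 0 <= kappa <= 1) (hg : 0 < gamma) (hG : 0 < Gamma).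
Hypothesis hB : growth p kappa gamma Gamma B.
Implicit Types (x xi : 'rV[R]_n) (s rho : R).

(** The powers of theta from [cutoff_young], evaluated at the order [1 / rho] that theta has near
    the origin. *)
Definition decay (alpha rho : R) :=
  rho `^ (- (p * (q + alpha) / (q - p + 1))) +
  kappa `^ (p - 2) * rho `^ (- (2 * (q + alpha) / (q - 1))).

(** With [b] for [rho ^ 2 - dotv x x], the product is [rho ^ sg * b ^ (K - sg)]: as [K] is at least
    [sg], the singularity at the edge of the ball is gone and the worst case is [b = rho ^ 2]. *)
Lemma theta_bump_le K (sg rho : R) x : 0 < rho -> sg <= K%:R -> 0 < rho ^+ 2 - dotv x x ->
  (rho / (rho ^+ 2 - dotv x x)) `^ sg * bump K (rho ^+ 2) x <= (rho ^+ 2) ^+ K * rho `^ (- sg).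
Proof.
move=> rho0 sK b0; have dx0 : 0 <= dotv x x by apply: sumr_ge0 => i _; rewrite -expr2 sqr_ge0.
have ble : rho ^+ 2 - dotv x x <= rho ^+ 2 by rewrite gerBl.
rewrite /bump max_r ?(ltW b0)//; move: b0 ble; move: (rho ^+ 2 - dotv x x) => b b0 ble.
have r20 : 0 < rho ^+ 2 by rewrite exprn_gt0.
have spl (y : R) : 0 < y -> y ^+ K = y `^ sg * y `^ (K%:R - sg).
  by move=> y0; rewrite -powRD ?(gt_eqF y0) ?implybT// addrC subrK powR_mulrn// ltW.
have r2 : (rho ^+ 2) `^ sg = rho `^ sg * rho `^ sg by rewrite expr2 powRM// ltW.
rewrite (spl b)// (spl (rho ^+ 2))// mulrA -powRM ?divr_ge0 ?(ltW b0) ?(ltW rho0)//.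
rewrite divfK ?gt_eqF// [leRHS]mulrAC powRN r2 mulfK ?(lt0r_neq0 (powR_gt0 _ rho0))//.
rewrite ler_wpM2l ?powR_ge0//.
apply: ge0_ler_powR => //; rewrite ?nnegrE ?subr_ge0 ?(ltW b0) ?(ltW r20)//.
Qed.

(** After integration the flux term equals the integral J of [|u| ^ (q + alpha)] times the squared
    cut-off, and stability bounds [q] J by the left side; [lam + nu < q] is what lets J be
    absorbed. *)
Lemma forms_upper_lt_q (alpha : R) m : p - 1 < q -> 1 < alpha ->
  Gamma * (p - 1) / gamma * (alpha + 1) ^+ 2 < 4 * q * alpha ->
  p * (q + alpha) / (q - p + 1) <= (m.*2.+2).+2%:R ->
  2 * (q + alpha) / (q - 1) <= (m.*2.+2).+2%:R ->
  exists lam nu C, [/\ 0 <= lam, 0 <= nu, lam + nu < q, 0 <= C &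
    forall rho x s xi, 0 < rho ->
      radial_form B H xi (tvec ((alpha - 1) / 2) (bump m.+2 (rho ^+ 2)) s xi x) +
      tangential_form B H xi (tvec ((alpha - 1) / 2) (bump m.+2 (rho ^+ 2)) s xi x) <=
      lam * flux_form B H xi (tvec (alpha - 1) (bump (m.*2.+2).+2 (rho ^+ 2)) s xi x) +
      nu * (`|s| `^ (q + alpha) * bump (m.*2.+2).+2 (rho ^+ 2) x) +
      C * ((rho ^+ 2) ^+ (m.*2.+2).+2 * decay alpha rho)].
Proof.
move=> pq al1 hc sp s2; have p10 : 0 <= p - 1 by rewrite subr_ge0 (le_trans _ hp)// ler1n.
have q0 : 0 < q by exact: le_lt_trans pq.
pose c0 := Gamma * (p - 1) / gamma * ((alpha + 1) ^+ 2 / 4).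
have c00 : 0 <= c0.
  rewrite mulr_ge0 ?divr_ge0 ?sqr_ge0 ?(ltW hg)//.
  by rewrite mulr_ge0// ltW.
have c0q : c0 < q * alpha.
  by rewrite /c0 mulrA ltr_pdivrMr// [ltRHS](_ : _ = 4 * q * alpha)//; ring.
have [d d0 [ad lq]] := small_parameter c00 al1 c0q q0.
have [C1 C10 h1] := flux_form_lower n0 hH hG hB m.*2.+2 al1 d0.
have [C2 C20 h2] := radial_form_upper n0 hH hp hg hG hB m al1 d0.
have [C3 C30 h3] := tangential_form_upper n0 hH hG hB m al1.
pose Cs := C1 + C2 + C3; have Cs0 : 0 <= Cs by rewrite !addr_ge0.
(* Keeps [Cs] times the Young error below [d] times the energy plus [|s| ^ (q + alpha)]; [gamma^-1]
   is the cost of bounding the weight by the energy. *)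
pose e := d / ((Cs + 1) * (1 + gamma^-1)).
have g1 : 0 < gamma^-1 by rewrite invr_gt0.
have Cs1 : 0 < Cs + 1 by rewrite ltr_wpDl.
have g2 : 0 < 1 + gamma^-1 by rewrite addr_gt0.
have e0 : 0 < e by rewrite divr_gt0// mulr_gt0.
have [C4 C40 h4] := cutoff_young hp hk pq al1 e0.
(* After absorption the flux controls [alpha - 2 * d] times the energy, and [lam] trades the energy
   in the radial form for flux. *)
pose lam := ((1 + d) * c0 + d) / (alpha - 2 * d).
have n1 : 0 <= (1 + d) * c0 + d.
  exact: (addr_ge0 (mulr_ge0 (addr_ge0 ler01 (ltW d0)) c00) (ltW d0)).
have lam0 : 0 <= lam by rewrite divr_ge0// ltW.
have lam1 : 0 <= lam + 1 by rewrite addr_ge0.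
exists lam, ((lam + 1) * d), ((lam + 1) * (Cs * C4)); split => //.
- exact: mulr_ge0 lam1 (ltW d0).
- exact: mulr_ge0 lam1 (mulr_ge0 Cs0 C40).
move=> rho x s xi rho0.
have De0 : 0 <= decay alpha rho by rewrite addr_ge0 ?mulr_ge0 ?powR_ge0.
have L0 : 0 <= (rho ^+ 2) ^+ (m.*2.+2).+2 * decay alpha rho.
  by rewrite mulr_ge0// exprn_ge0// sqr_ge0.
have Z0 k : 0 <= bump k (rho ^+ 2) x := bump_ge0 _ _ _.
have LC0 : 0 <= (lam + 1) * (Cs * C4) * ((rho ^+ 2) ^+ (m.*2.+2).+2 * decay alpha rho).
  exact: (mulr_ge0 (mulr_ge0 lam1 (mulr_ge0 Cs0 C40)) L0).
have J0 : 0 <= (lam + 1) * d * (`|s| `^ (q + alpha) * bump (m.*2.+2).+2 (rho ^+ 2) x).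
  exact: (mulr_ge0 (mulr_ge0 lam1 (ltW d0)) (mulr_ge0 (powR_ge0 _ _) (Z0 _))).
(* At [xi = 0] the forms vanish by convention, and outside the Euclidean ball the tests vanish; in
   both cases the right side is nonnegative. *)
have [xi0|xi0] := eqVneq xi 0.
  rewrite /radial_form /tangential_form /flux_form /flux xi0 eqxx.
  rewrite [dotv 0 _](_ : _ = 0) ?mulr0 ?add0r ?addr_ge0//.
  by rewrite /dotv big1// => i _; rewrite mxE mul0r.
have [b0|b0] := leP (rho ^+ 2 - dotv x x) 0.
  have bz k : bump k.+1 (rho ^+ 2) x = 0 by rewrite /bump max_l// expr0n.
  have gz k : grad (bump k.+2 (rho ^+ 2)) x = 0.
    apply/eqP; rewrite -normr_le0 (le_trans (grad_bump_le k x (ltW rho0)))//.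
    by rewrite bz mulr0.
  have tz r k : tvec r (bump k.+2 (rho ^+ 2)) s xi x = 0.
    by rewrite /tvec bz gz mul0r scale0r scaler0 addr0.
  rewrite !tz (admissible_0 (admissible_radial n0 hH hp hk hG hB)).
  rewrite (admissible_0 (admissible_tangential n0 hH hp hk hG hB)).
  by rewrite (admissible_0 (admissible_flux n0 hH hp hk hG hB)) mulr0 !add0r addr_ge0.
have := h1 rho x s xi xi0 (ltW rho0) b0.
have := lerD (h2 rho x s xi xi0 (ltW rho0) b0) (h3 rho x s xi xi0 (ltW rho0) b0).
rewrite sqr_bump.
have th0 : 0 < rho / (rho ^+ 2 - dotv x x) by rewrite divr_gt0.
have Hx := finsler_gt0 hH xi0.
have i4 := h4 (H xi) `|s| _ (ltW Hx) (normr_ge0 _) th0.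
have t1 := theta_bump_le rho0 sp b0; have t2 := theta_bump_le rho0 s2 b0.
rewrite -/c0.
have /andP[b1 _] := growth_deriv1 hB Hx.
have hE : (kappa + H xi) `^ (p - 2) * H xi ^+ 2 * `|s| `^ (alpha - 1) <= gamma^-1 * energy B H alpha s xi.
  rewrite /energy [leRHS]mulrA ler_wpM2r ?powR_ge0// expr2 !mulrA ler_wpM2r ?(ltW Hx)//.
  by rewrite [leRHS]mulrC ler_pdivlMr// mulrC mulrA.
have E0 : 0 <= energy B H alpha s xi.
  have [_ B0 _] := growth_gt0 hB Hx.
  by rewrite /energy !mulr_ge0 ?powR_ge0// ltW.
have k0 := powR_ge0 kappa (p - 2).
have T0 := powR_ge0 `|s| (q + alpha).
have W0 : 0 <= remainder p kappa H alpha rho x s xi.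
  by rewrite /remainder mulr_ge0 ?sqr_ge0// mulr_ge0 ?powR_ge0.
move: i4 t1 t2 hE E0 k0 T0 W0 (Z0 (m.*2.+2).+2); rewrite -/(remainder p kappa H alpha rho x s xi) /decay.
move: (remainder _ _ _ _ _ _ _ _) => W.
move: (energy B H alpha s xi) => E.
set q1 := flux_form _ _ _ _; set q2 := radial_form _ _ _ _; set q3 := tangential_form _ _ _ _.
move: q1 q2 q3 => q1 q2 q3.
move: (`|s| `^ (q + alpha)) (bump (m.*2.+2).+2 (rho ^+ 2) x) (kappa `^ (p - 2)) => T Z k.
move: ((rho ^+ 2) ^+ (m.*2.+2).+2) => KK.
move: (_ `^ (p * (q + alpha) / (q - p + 1))) (_ `^ (2 * (q + alpha) / (q - 1))) => th1 th2.
move: (rho `^ _) (rho `^ _) => r2 r1.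
move: (_ * H xi ^+ 2 * _) => wht.
move=> i4 t1 t2 hE E0 k0 T0 W0 Zp i23 i1.
have eD : e * ((Cs + 1) * (1 + gamma^-1)) = d by rewrite /e divfK// gt_eqF// mulr_gt0.
have WZ : W * Z <= e * (gamma^-1 * E + T) * Z + C4 * (KK * (r1 + k * r2)).
  apply: (le_trans (ler_wpM2r Zp i4)); rewrite mulrDl; apply: lerD.
    by rewrite ler_wpM2r// ler_wpM2l ?(ltW e0)// lerD2r.
  rewrite -mulrA ler_wpM2l// mulrDl mulrDr lerD//.
  by rewrite -mulrA [leRHS]mulrCA ler_wpM2l.
have X : Cs * (W * Z) <= d * ((E + T) * Z) + Cs * C4 * (KK * (r1 + k * r2)).
  apply: (le_trans (ler_wpM2l Cs0 WZ)); rewrite mulrDr; apply: lerD; last by rewrite mulrA.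
  rewrite -eD mulrA [X in _ <= X]mulrA ler_wpM2r//.
  rewrite -[leRHS]mulrA mulrCA ler_wpM2l ?(ltW e0)//.
  have a1 : 0 <= Cs * gamma^-1 by rewrite mulr_ge0// ltW.
  have a2 : 0 <= Cs * gamma^-1 * T by rewrite mulr_ge0.
  have a3 : 0 <= Cs * E by rewrite mulr_ge0.
  have a4 : 0 <= gamma^-1 * T by rewrite mulr_ge0// ltW.
  have a5 : 0 <= gamma^-1 * E by rewrite mulr_ge0// ltW.
  by lra.
have W1 : C1 * (W * Z) <= Cs * (W * Z) by rewrite ler_wpM2r ?mulr_ge0// /Cs -addrA lerDl addr_ge0.
have W2 : (C2 + C3) * (W * Z) <= Cs * (W * Z) by rewrite ler_wpM2r ?mulr_ge0// /Cs -addrA lerDr.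
have i1' : (alpha - 2 * d) * (E * Z) <= q1 + d * (T * Z) + Cs * C4 * (KK * (r1 + k * r2)) by lra.
have i2' : q2 + q3 <= ((1 + d) * c0 + d) * (E * Z) + d * (T * Z) + Cs * C4 * (KK * (r1 + k * r2)) by lra.
have lamE : (1 + d) * c0 + d = lam * (alpha - 2 * d) by rewrite /lam divfK// gt_eqF.
rewrite lamE in i2'.
have := ler_wpM2l lam0 i1'.
by move: i2'; clear -lam; clearbody lam; lra.
Qed.

End pointwise_estimate.

(** * Conclusion *)

Section conclusion.
Context (R : realType) (n : nat) (p kappa gamma Gamma q : R) (B : R -> R).
Context (H : 'rV[R]_n -> R) (u : 'rV[R]_n -> R) (Du : 'rV[R]_n -> 'rV[R]_n).
Hypotheses (n0 : (0 < n)%N) (hH : finsler_norm H) (hp : 2 <= p).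
Hypotheses (hk : 0 <= kappa <= 1) (hg : 0 < gamma) (hG : 0 < Gamma).
Hypothesis hB : growth p kappa gamma Gamma B.
Hypotheses (hq : 1 < q) (hu : weak_solution p q B H u Du) (hst : stable q B H u Du).
Notation mu := (@lebesgue_rV R n).
Notation L1 f := (mu.-integrable [set: 'rV[R]_n] (EFin \o f)).

Let measurable_u : measurable_fun setT u.
Proof. by have [] := weak_solution_Linfty hu. Qed.

Lemma powR_weight (r s t : R) : 0 < r -> 0 < s -> `|t| `^ r * `|t| `^ s * t ^+ 2 = `|t| `^ (r + s + 2).
Proof.
move=> r0 s0; rewrite -(real_normK (num_real t)) -[`|t| ^+ 2]powR_mulrn//.
by rewrite -!powRD// gt_eqF// !addr_gt0.
Qed.

Lemma L1_indic_ball (r : R) : 0 <= r ->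
  L1 (\1_[set x : 'rV[R]_n | `|x| <= r]) /\
  \int[mu]_x (\1_[set x : 'rV[R]_n | `|x| <= r] x) = (2 * r) ^+ n.
Proof.
move=> r0; have mb := @measurable_norm_ball R n r.
have hL : L1 (\1_[set x : 'rV[R]_n | `|x| <= r]).
  apply: (@L1_bounded_support R n _ r 1).
  - exact: measurable_indic.
  - by move=> x; rewrite indicE ger0_norm; case: (_ \in _).
  - by move=> x rx; rewrite indicE memNset//= leNgt rx.
split => //; apply: EFin_inj; rewrite EFin_Rintegral// integral_indic// setIT.
exact: lebesgue_rV_cube.
Qed.

Let RintegralZ (c : R) f : L1 f -> \int[mu]_x (c * f x) = c * \int[mu]_x f x.
Proof. by move=> hf; apply: RintegralZl. Qed.

Let Rintegral_add f g : L1 f -> L1 g ->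
  \int[mu]_x (f x + g x) = \int[mu]_x f x + \int[mu]_x g x.
Proof. by move=> hf hg'; apply: RintegralD. Qed.

(** The equation is tested with the square of the cut-off used in stability, hence the doubled
    power. The factor [2 ^ n] comes from the volume of the cube that carries the constant term. *)
Lemma caccioppoli (alpha : R) m : p - 1 < q -> 1 < alpha ->
  Gamma * (p - 1) / gamma * (alpha + 1) ^+ 2 < 4 * q * alpha ->
  p * (q + alpha) / (q - p + 1) <= (m.*2.+2).+2%:R ->
  2 * (q + alpha) / (q - 1) <= (m.*2.+2).+2%:R ->
  exists2 C, 0 <= C & forall rho, 0 < rho ->
    L1 (fun x => `|u x| `^ (q + alpha) * bump (m.*2.+2).+2 (rho ^+ 2) x) /\
    \int[mu]_x (`|u x| `^ (q + alpha) * bump (m.*2.+2).+2 (rho ^+ 2) x) <=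
    C * ((rho ^+ 2) ^+ (m.*2.+2).+2 * decay p kappa q alpha rho * rho ^+ n).
Proof.
move=> pq al1 hc sp s2.
have [lam [nu [C [lam0 nu0 lnq C0 hpt]]]] := forms_upper_lt_q n0 hH hp hk hg hG hB pq al1 hc sp s2.
have ln0 : 0 < q - (lam + nu) by rewrite subr_gt0.
have q1 : 0 < q - 1 by rewrite subr_gt0.
have a1 : 0 < alpha - 1 by rewrite subr_gt0.
have a2 : 0 < (alpha - 1) / 2 by rewrite divr_gt0.
exists (C * 2 ^+ n / (q - (lam + nu))).
  by rewrite divr_ge0 ?(ltW ln0)// mulr_ge0// exprn_ge0.
move=> rho rho0.
have [E1 E2] := weak_limit_equation n0 hH hp hk hG hB hq hu m.*2.+2 a1 rho0.
have [S1 S2 S3 S4] := weak_limit_stability n0 hH hp hk hG hB hq hu m a2 rho0 hst.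
have JE x : `|u x| `^ (q - 1) * u x * (spow (alpha - 1) (u x) * bump (m.*2.+2).+2 (rho ^+ 2) x) =
    `|u x| `^ (q + alpha) * bump (m.*2.+2).+2 (rho ^+ 2) x.
  rewrite (_ : q + alpha = q - 1 + (alpha - 1) + 2); last by ring.
  by rewrite -powR_weight// /spow; ring.
(* The square of the stability test restores the integrand of the equation, times [q]. *)
have JS x : q * `|u x| `^ (q - 1) * (spow ((alpha - 1) / 2) (u x) * bump m.+2 (rho ^+ 2) x) ^+ 2 =
    q * (`|u x| `^ (q + alpha) * bump (m.*2.+2).+2 (rho ^+ 2) x).
  rewrite (_ : q + alpha = q - 1 + (alpha - 1) + 2); last by ring.
  rewrite -powR_weight// /spow.
  by rewrite -sqr_bump -(sqr_powR_half (alpha - 1)); ring.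
have hJ : L1 (fun x => `|u x| `^ (q + alpha) * bump (m.*2.+2).+2 (rho ^+ 2) x).
  rewrite (_ : (fun x => _) = (fun x => q^-1 * (q * `|u x| `^ (q - 1) *
    (spow ((alpha - 1) / 2) (u x) * bump m.+2 (rho ^+ 2) x) ^+ 2))).
    exact: L1Z.
  by apply/funext => x; rewrite JS mulKf// gt_eqF// (lt_trans ltr01).
split => //.
have JS' := @eq_Rintegral _ _ R mu setT _ _ (fun x _ => JS x).
have JE' := @eq_Rintegral _ _ R mu setT _ _ (fun x _ => JE x).
move: S4; rewrite JS' (RintegralZ _ hJ); rewrite JE' in E2.
rewrite -(Rintegral_add S1 S2).
have [I1 I2] := L1_indic_ball (ltW rho0).
have L0 : 0 <= (rho ^+ 2) ^+ (m.*2.+2).+2 * decay p kappa q alpha rho.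
  exact: (mulr_ge0 (exprn_ge0 _ (sqr_ge0 _)) (addr_ge0 (powR_ge0 _ _) (mulr_ge0 (powR_ge0 _ _) (powR_ge0 _ _)))).
move: L0 hpt; set L := fun rho : R => (rho ^+ 2) ^+ (m.*2.+2).+2 * decay p kappa q alpha rho.
rewrite -/(L rho) => L0 hpt.
have hle x : radial_form B H (Du x) (tvec ((alpha - 1) / 2) (bump m.+2 (rho ^+ 2)) (u x) (Du x) x) +
  tangential_form B H (Du x) (tvec ((alpha - 1) / 2) (bump m.+2 (rho ^+ 2)) (u x) (Du x) x) <=
  lam * flux_form B H (Du x) (tvec (alpha - 1) (bump m.*2.+4 (rho ^+ 2)) (u x) (Du x) x) +
  nu * (`|u x| `^ (q + alpha) * bump m.*2.+4 (rho ^+ 2) x) +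
  C * L rho * \1_[set x : 'rV[R]_n | `|x| <= rho] x.
  have [xr|rx] := leP `|x| rho.
    by rewrite indicE mem_set// mulr1; exact: hpt.
  have rx' := ltW rx; rewrite indicE memNset ?mulr0 ?addr0//=; last by rewrite leNgt rx.
  have tz r k : tvec r (bump k.+2 (rho ^+ 2)) (u x) (Du x) x = 0.
    by apply: tvec_eq0 rx'; exact: ltW.
  rewrite !tz.
  rewrite (admissible_0 (admissible_radial n0 hH hp hk hG hB)).
  rewrite (admissible_0 (admissible_tangential n0 hH hp hk hG hB)).
  by rewrite (admissible_0 (admissible_flux n0 hH hp hk hG hB)) bump_eq0 ?(ltW rho0)// !mulr0 addr0.
have := le_Rintegral measurableT (L1D S1 S2)
  (L1D (L1D (L1Z lam E1) (L1Z nu hJ)) (L1Z (C * L rho) I1)) (fun x _ => hle x).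
rewrite (Rintegral_add (L1D (L1Z lam E1) (L1Z nu hJ)) (L1Z (C * L rho) I1)).
rewrite (Rintegral_add (L1Z lam E1) (L1Z nu hJ)).
rewrite (RintegralZ _ E1) (RintegralZ _ hJ) (RintegralZ _ I1) I2 E2.
set J := \int[mu]_x (_ * bump _ _ _); set S := \int[mu]_x (_ + _).
move=> h1 h2; rewrite -mulrA mulrAC -[leRHS]mulrA.
rewrite [leRHS](_ : _ = (C * L rho * (2 * rho) ^+ n) / (q - (lam + nu))); last first.
  by rewrite exprMn; ring.
by rewrite ler_pdivlMr//; lra.
Qed.

(** The alternative in the last hypothesis reflects that the second decay term is absent when
    [kappa ^ (p - 2)] is 0. Otherwise both decay exponents must beat the volume growth [rho ^ n]. *)
Lemma solution_eq0 (alpha : R) : p - 1 < q -> 1 < alpha ->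
  Gamma * (p - 1) / gamma * (alpha + 1) ^+ 2 < 4 * q * alpha ->
  n%:R < p * (q + alpha) / (q - p + 1) ->
  kappa `^ (p - 2) = 0 \/ n%:R < 2 * (q + alpha) / (q - 1) ->
  {ae mu, forall x, u x = 0}.
Proof.
move=> pq al1 hc np n2.
pose sp := p * (q + alpha) / (q - p + 1); pose s2 := 2 * (q + alpha) / (q - 1).
(* A cut-off power beyond both exponents, as [theta_bump_le] requires. *)
have [K spK s2K] : exists2 K, sp <= K%:R & s2 <= K%:R.
  exists (maxn (Num.truncn sp).+1 (Num.truncn s2).+1).
    by rewrite (le_trans (ltW (truncnS_gt _)))// ler_nat leq_maxl.
  by rewrite (le_trans (ltW (truncnS_gt _)))// ler_nat leq_maxr.
have KK : K%:R <= (K.*2.+2).+2%:R :> R.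
  by rewrite ler_nat -addnn -!addnS leq_addr.
have [C C0 hJ] := caccioppoli pq al1 hc (le_trans spK KK) (le_trans s2K KK).
have [d d0 [D D0 hD]] : exists2 d, 0 < d & exists2 D, 0 <= D &
    forall rho, 1 <= rho -> decay p kappa q alpha rho * rho ^+ n <= D * rho `^ (- d).
  have kp0 := powR_ge0 kappa (p - 2).
  have hs (sg d rho : R) : 1 <= rho -> d <= sg - n%:R -> rho `^ (- sg) * rho ^+ n <= rho `^ (- d).
    move=> r1 ds; have r0 : 0 < rho by rewrite (lt_le_trans ltr01).
    rewrite -powR_mulrn ?(ltW r0)// -powRD ?(gt_eqF r0) ?implybT//.
    by rewrite ler_powR//; lra.
  case: n2 => [k0|n2].
    exists (sp - n%:R); first by rewrite subr_gt0.
    exists 1 => // rho r1; rewrite /decay k0 mul0r addr0 mul1r.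
    exact: hs.
  exists (Num.min (sp - n%:R) (s2 - n%:R)); first by rewrite lt_min !subr_gt0 np.
  exists (1 + kappa `^ (p - 2)) => [|rho r1]; first by rewrite addr_ge0.
  rewrite /decay mulrDl [leRHS]mulrDl mul1r; apply: lerD; first by apply: hs; rewrite // ge_min lexx.
  by rewrite -mulrA ler_wpM2l//; apply: hs; rewrite // ge_min lexx orbT.
pose M := (K.*2.+2).+2.
pose E := 2 ^+ M * C * D : R; have E0 : 0 <= E.
  exact: (mulr_ge0 (mulr_ge0 (exprn_ge0 _ (ler0n _ _)) C0) D0).
have ball0 k : {ae mu, forall x, `|x| <= k%:R -> u x = 0}.
  pose A := [set x : 'rV[R]_n | `|x| <= k%:R].
  pose f x := `|u x| `^ (q + alpha) * \1_A x.
  have f0 x : 0 <= f x by rewrite mulr_ge0 ?powR_ge0.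
  have mf : measurable_fun setT f.
    apply: measurable_funM.
      by apply: (measurableT_comp (measurable_powR _)); exact: measurableT_comp.
    by apply: measurable_indic; exact: measurable_norm_ball.
  (* From this radius on, [dotv x x <= rho ^ 2 / 2] whenever [|x| <= k], so the cut-off is at least
     [(rho ^ 2 / 2) ^ M] there. *)
  pose rho0 : R := 1 + 2 * n%:R * k%:R.
  have r01 : 1 <= rho0 by rewrite lerDl !mulr_ge0.
  have ler0n2 : 0 <= 2 :> R by [].
  have fle rho x : rho0 <= rho ->
      f x <= (2 / rho ^+ 2) ^+ M * (`|u x| `^ (q + alpha) * bump M (rho ^+ 2) x).
    move=> rr; have rho1 : 1 <= rho by exact: le_trans rr.
    have r20 : 0 < rho ^+ 2 by rewrite exprn_gt0// (lt_le_trans ltr01).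
    have [xk|kx] := leP `|x| k%:R; last first.
      rewrite /f indicE memNset ?mulr0; last by rewrite /A/= leNgt kx.
      exact: (mulr_ge0 (exprn_ge0 _ (divr_ge0 ler0n2 (ltW r20))) (mulr_ge0 (powR_ge0 _ _) (bump_ge0 _ _ _))).
    rewrite /f indicE mem_set// mulr1 mulrCA ler_peMr ?powR_ge0// /bump -exprMn.
    rewrite exprn_ege1// mulrAC ler_pdivlMr// mul1r.
    have dx : dotv x x <= rho ^+ 2 / 2.
      apply: (le_trans (dotv_le_sqr_norm x)).
      have n1 : 1 <= n%:R :> R by rewrite ler1n.
      have i1 : `|x| ^+ 2 <= k%:R ^+ 2 by rewrite lerXn2r ?nnegrE.
      apply: (le_trans (ler_wpM2l (ler0n _ n) i1)).
      have i2 : rho0 ^+ 2 <= rho ^+ 2.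
        by rewrite lerXn2r ?nnegrE// (le_trans ler01)// (le_trans r01).
      rewrite ler_pdivlMr//; apply: le_trans i2; rewrite /rho0.
      have k0 : 0 <= k%:R :> R by [].
      have i3 : n%:R * k%:R ^+ 2 <= n%:R * (n%:R * k%:R ^+ 2) :> R.
        by rewrite ler_wpM2l// ler_peMl ?sqr_ge0.
      have i4 : 0 <= n%:R * k%:R :> R by rewrite mulr_ge0.
      have i5 : 0 <= n%:R * (n%:R * k%:R ^+ 2) :> R by rewrite !mulr_ge0 ?sqr_ge0.
      move: i3 i4 i5; move: (n%:R) (k%:R) => a b; lra.
    have : rho ^+ 2 / 2 <= Num.max 0 (rho ^+ 2 - dotv x x) by rewrite le_max; apply/orP; right; lra.
    lra.
  have Lf : L1 f.
    have [J1 _] := hJ rho0 (lt_le_trans ltr01 r01).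
    apply: (L1_le mf _ (L1Z ((2 / rho0 ^+ 2) ^+ M) J1)) => x.
    by rewrite ger0_norm//; exact: fle.
  have If rho : rho0 <= rho -> \int[mu]_x f x <= E * rho `^ (- d).
    move=> rr; have rho1 : 1 <= rho by exact: le_trans rr.
    have rho00 : 0 < rho by exact: lt_le_trans rho1.
    have [J1 J2] := hJ rho rho00.
    have := le_Rintegral measurableT Lf (L1Z ((2 / rho ^+ 2) ^+ M) J1) (fun x _ => fle rho x rr).
    rewrite (RintegralZ _ J1) => /le_trans; apply.
    have z : 0 <= (2 / rho ^+ 2) ^+ M by rewrite exprn_ge0// divr_ge0// sqr_ge0.
    apply: (le_trans (ler_wpM2l z J2)).
    rewrite [leLHS](_ : _ = 2 ^+ M * C * (decay p kappa q alpha rho * rho ^+ n)).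
      rewrite /E -[leRHS]mulrA; apply: ler_wpM2l; last exact: hD.
      exact: (mulr_ge0 (exprn_ge0 _ ler0n2) C0).
    rewrite expr_div_n -/M; field.
    by rewrite expf_neq0// expf_neq0// gt_eqF.
  have I0 : \int[mu]_x f x = 0.
    apply/eqP; rewrite eq_le Rintegral_ge0// andbT leNgt; apply/negP => I0.
    (* A radius at which [E * rho ^ (- d)] would fall below a positive integral. *)
    pose rho := Num.max rho0 (((E + 1) / \int[mu]_x f x) `^ d^-1).
    have rr : rho0 <= rho by rewrite le_max lexx.
    have rho00 : 0 < rho by rewrite (lt_le_trans _ rr)// (lt_le_trans _ r01).
    have := If rho rr; rewrite powRN ler_pdivlMr ?powR_gt0//.
    apply/negP; rewrite -ltNge (@lt_le_trans _ _ (E + 1)) ?ltrDl//.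
    rewrite mulrC -ler_pdivrMr//.
    have z : 0 <= (E + 1) / \int[mu]_x f x by rewrite divr_ge0 ?addr_ge0// ltW.
    have -> : (E + 1) / \int[mu]_x f x = (((E + 1) / \int[mu]_x f x) `^ d^-1) `^ d.
      by rewrite -powRrM mulVf ?powRr1// gt_eqF.
    have rl : ((E + 1) / \int[mu]_x f x) `^ d^-1 <= rho by rewrite le_max lexx orbT.
    by apply: ge0_ler_powR rl; rewrite ?nnegrE ?powR_ge0 ?(ltW d0) ?(ltW rho00).
  have := EFin_Rintegral Lf; rewrite I0 => /esym I1.
  have mE : measurable_fun setT (EFin \o f) by exact/measurable_EFinP.
  have [h _] := ae_eq_integral_abs mu measurableT mE.
  have abs0 : (\int[mu]_x `|(f x)%:E| = 0)%E.
    by rewrite -[RHS]I1; apply: eq_integral => x _; rewrite gee0_abs ?lee_fin.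
  apply: filterS (h abs0) => x fx xk.
  have [fx0] : (f x)%:E = 0%:E by exact: fx.
  have : f x == 0 by rewrite fx0.
  rewrite /f mulf_eq0 powR_eq0 normr_eq0 indicE mem_set// oner_eq0 orbF.
  by move=> /andP[/eqP].
apply: filterS (ae_foralln ball0) => x hx.
by apply: (hx (Num.truncn `|x|).+1); exact/ltW/truncnS_gt.
Qed.

End conclusion.

(** The two bounds on B' compared at [t = 1]. In the theorem this gives [p - 1 <= a0], and hence
    [p - 1 < q] in every case. *)
Lemma growth_gamma_le (R : realType) (p kappa gamma Gamma : R) (B : R -> R) :
  0 <= kappa -> growth p kappa gamma Gamma B -> gamma <= Gamma.
Proof.
move=> k0 hB; have /andP[b1 b2] := growth_deriv1 hB (@ltr01 R).
have := le_trans b1 b2; rewrite !mulr1 ler_pM2r// powR_gt0//.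
by rewrite ltr_wpDl.
Qed.

Unset Implicit Arguments.

Theorem theorem1p3 (R : realType) (N : nat) (hN : (2 <= N)%N)
  (H : 'rV[R]_N -> R) (hH : finsler_norm H)
  (p kappa gamma Gamma : R) (hp : 2 <= p) (hkappa : 0 <= kappa <= 1)
  (hgamma : 0 < gamma) (hGamma : 0 < Gamma)
  (B : R -> R) (hB : growth p kappa gamma Gamma B)
  (q : R) (hq : 1 < q)
  (u : 'rV[R]_N -> R) (Du : 'rV[R]_N -> 'rV[R]_N)
  (hu : weak_solution p q B H u Du) (hstable : stable q B H u Du)
  (hcases :
    (let a := Gamma ^+ 2 * kappa `^ (p - 2) * gamma^-1 * (p - 1) ^+ 2 in
     [/\ 1 <= Gamma * kappa `^ (p - 2) * (p - 1),
         a < q &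
         N%:R < 2 * ((a * (q - 1) + 2 * q + 2 * Num.sqrt (q * (q - a)))
                     / (a * (q - 1)))])
    \/
    (let a := kappa `^ (2 - p) * gamma^-1 in
     [/\ 0 < Gamma * kappa `^ (p - 2) * (p - 1) < 1,
         a < q &
         N%:R < 2 * ((a * (q - 1) + 2 * q + 2 * Num.sqrt (q * (q - a)))
                     / (a * (q - 1)))])
    \/
    (let a := Gamma * gamma^-1 * (p - 1) in
     [/\ kappa = 0,
         a < q &
         N%:R < p * ((a * (q - 1) + 2 * q + 2 * Num.sqrt (q * (q - a)))
                     / (a * (q - (p - 1))))])) :
  {ae @lebesgue_rV R N, forall x, u x = 0}.
Proof.
have /andP[k0 _] := hkappa.
have gG := growth_gamma_le k0 hB.
have N0 : (0 < N)%N by rewrite (leq_trans _ hN).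
have p1 : 1 <= p - 1 by rewrite lerBrDr.
have p0 : 0 < p by rewrite (lt_le_trans _ hp).
have q1 : 0 < q - 1 by rewrite subr_gt0.
(* The constant in the condition on alpha. In each of the three cases the constant [a] of the
   hypothesis is at least [a0], so an alpha good for [a] is good for [a0]. *)
pose a0 := Gamma * (p - 1) / gamma.
have pa0 : p - 1 <= a0.
  by rewrite /a0 ler_pdivlMr// mulrC ler_wpM2r// (le_trans ler01).
have a00 : 0 < a0 by rewrite (lt_le_trans ltr01)// (le_trans p1).
have finish a c : a0 <= a -> a < q -> a * c < 2 * q - a + 2 * Num.sqrt (q * (q - a)) ->
    (forall alpha, 1 < alpha -> c < alpha -> N%:R < p * (q + alpha) / (q - p + 1) /\
      (kappa `^ (p - 2) = 0 \/ N%:R < 2 * (q + alpha) / (q - 1))) ->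
    {ae @lebesgue_rV R N, forall x, u x = 0}.
  move=> a0a aq ac hc.
  have [alpha [al1 cal hal]] := exponent_choice (lt_le_trans a00 a0a) aq ac.
  have [np n2] := hc _ al1 cal.
  apply: (solution_eq0 N0 hH hp hkappa hgamma hGamma hB hq hu hstable _ al1 _ np n2).
    by rewrite (le_lt_trans pa0)// (le_lt_trans a0a).
  by apply: le_lt_trans hal; rewrite ler_wpM2r// sqr_ge0.
(* For [p >= 2] the second decay exponent is the smaller one, so it alone decides the first two
   cases. *)
have s2_sp (alpha : R) : p - 1 < q -> 1 < alpha ->
    2 * (q + alpha) / (q - 1) <= p * (q + alpha) / (q - p + 1).
  move=> pq al1; have qp : 0 < q - p + 1 by lra.
  rewrite ler_pdivrMr// mulrAC ler_pdivlMr// -subr_ge0.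
  rewrite (_ : _ - _ = (q + alpha) * ((p - 2) * (q + 1))); last by ring.
  by rewrite !mulr_ge0//; lra.
have finish2 a : a0 <= a -> a < q ->
    N%:R < 2 * ((a * (q - 1) + 2 * q + 2 * Num.sqrt (q * (q - a))) / (a * (q - 1))) ->
    {ae @lebesgue_rV R N, forall x, u x = 0}.
  move=> a0a aq; have a1 := lt_le_trans a00 a0a.
  rewrite mulrA ltr_pdivlMr ?mulr_gt0// => hN2.
  (* The threshold is the alpha for which [2 * (q + alpha) / (q - 1)] equals [N]. *)
  apply: (finish a (N%:R * (q - 1) / 2 - q)) => //; first by lra.
  move=> alpha al1 cal.
  have n2 : N%:R < 2 * (q + alpha) / (q - 1) by rewrite ltr_pdivlMr//; lra.
  split; last by right.
  by apply: (lt_le_trans n2); apply: s2_sp => //; rewrite (le_lt_trans pa0)// (le_lt_trans a0a).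
case: hcases => [|[]] /=; set a := (X in X < q) => -[h1 aq hn].
- apply: (finish2 a) => //.
  (* Here [a] is [a0] times the quantity assumed to be at least 1. *)
  rewrite /a0 /a (_ : _ * _ ^+ 2 = Gamma * (p - 1) / gamma * (Gamma * kappa `^ (p - 2) * (p - 1))); last by ring.
  by rewrite ler_peMr// ltW.
- apply: (finish2 a) => //.
  (* Here [a0 <= a] amounts to [Gamma * (p - 1) * kappa ^ (p - 2) <= 1], and the positivity
     assumption makes [kappa ^ (p - 2)] invertible. *)
  case/andP: h1 => h0 h1; rewrite /a0 /a ler_wpM2r ?invr_ge0 ?(ltW hgamma)//.
  have w0 : 0 < kappa `^ (p - 2).
    have := powR_ge0 kappa (p - 2); rewrite le_eqVlt => /orP[/eqP w0|//].
    by move: h0; rewrite -w0 mulr0 mul0r ltxx.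
  rewrite (_ : 2 - p = - (p - 2)); last by ring.
  by rewrite powRN -[leRHS]mul1r ler_pdivlMr// mulrAC ltW.
- have aE : a = a0 by rewrite /a /a0; ring.
  rewrite -/a in hn; clearbody a.
  have qp : 0 < q - (p - 1) by rewrite subr_gt0 (le_lt_trans pa0)// -aE.
  have a1 : 0 < a by rewrite aE.
  move: hn; rewrite mulrA ltr_pdivlMr ?(mulr_gt0 a1 qp)// => hn.
  apply: (finish a (N%:R * (q - (p - 1)) / p - q)) => //; first by rewrite aE.
    rewrite mulrBr mulrA ltrBlDr ltr_pdivrMr//; lra.
  move=> alpha al1; rewrite ltrBlDr ltr_pdivrMr// => cal.
  have np : N%:R < p * (q + alpha) / (q - p + 1).
    by rewrite ltr_pdivlMr; lra.
  (* For [p = 2] the power [kappa ^ (p - 2)] is 1 even at [kappa = 0], but then the two decay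
     exponents coincide. *)
  split => //; have [p2|p2] := eqVneq p 2.
    by right; move: np; rewrite p2; congr (_ < _ / _); ring.
  by left; rewrite h1 powR0// subr_eq0.
Qed.
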